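(* Let $f\in\mathcal{S}^{*}_{\tau}$ and let $\tilde{\tau}(z)=z\exp\int_{0}^{z}\frac{\arctan t}{t}\,dt$ for $z\in\mathbb{D}$. Then the following hold: (1) Subordination results: $\dfrac{zf'(z)}{f(z)}\prec \dfrac{z\tilde{\tau}'(z)}{\tilde{\tau}(z)}$ and $\dfrac{f(z)}{z}\prec \dfrac{\tilde{\tau}(z)}{z}$. (2) Growth theorem: for $|z|=r<1$, $-\tilde{\tau}(-r)\leq |f(z)|\leq \tilde{\tau}(r)$. (3) Covering theorem: either $f$ is a rotation of $\tilde{\tau}$ or $\{w:|w|<-\tilde{\tau}(-1)\}\subset f(\mathbb{D})$, where $-\tilde{\tau}(-1)=\lim_{r\to 1}-\tilde{\tau}(-r)$. (4) Rotation theorem: for $|z|=r<1$, $\left|\arg \dfrac{f(z)}{z}\right|\leq \max_{|z|=r}\arg \dfrac{\tilde{\tau}(z)}{z}$. Equality holds in (2) and (4) for some non-zero $z$ if and only if $f$ is a rotation of $\tilde{\tau}$.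
   Context: $\mathbb{D}=\{z\in\mathbb{C}:|z|<1\}$. $\mathcal{A}$ is the class of analytic functions $f$ on $\mathbb{D}$ of the form $f(z)=z+\sum_{n\ge 2}a_nz^n$. For analytic $g,h$ on $\mathbb{D}$, $g\prec h$ (subordination) means $g(z)=h(\omega(z))$ for some analytic $\omega:\mathbb{D}\to\mathbb{D}$ with $\omega(0)=0$, $|\omega(z)|\le|z|$. Here $\arctan$ denotes the principal branch, analytic on $\mathbb{D}$ with $\arctan 0=0$. $\mathcal{S}^{*}_{\tau}=\{f\in\mathcal{A}: zf'(z)/f(z)\prec 1+\arctan z\}$. The quotients $f(z)/z$, $zf'(z)/f(z)$, etc. are taken to have value $1$ at $z=0$; $\arg (f(z)/z)$ is the continuous branch vanishing at $z=0$. A rotation of a function $g\in\mathcal{A}$ is a function $e^{-i\theta}g(e^{i\theta}z)$ with $\theta\in\mathbb{R}$. *)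

(* Defs.v *)
From Stdlib Require Import Reals.
From Coquelicot Require Export Coquelicot.
Open Scope R_scope.
Open Scope C_scope.

(** * Analytic functions on the unit disk

    Functions on the disk are total functions [C -> C]; only their values on
    the (open) unit disk matter. *)

Definition in_disk (z : C) : Prop := Cmod z < 1.

(* Complex differentiability at every point of the open disk. *)
Definition analytic_on_disk (f : C -> C) : Prop :=
  forall z : C, in_disk z -> ex_derive (K := C_AbsRing) (V := C_NormedModule) f z.

Definition class_A (f : C -> C) : Prop :=
  analytic_on_disk f /\
  exists a : nat -> C,
    a 0%nat = 0 /\ a 1%nat = 1 /\
    forall z : C, in_disk z ->
      is_pseries (K := C_AbsRing) (V := C_NormedModule) a z (f z).

Definition subordinate (g h : C -> C) : Prop :=
  exists w : C -> C,
    analytic_on_disk w /\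
    w 0 = 0 /\
    (forall z : C, in_disk z -> in_disk (w z)) /\
    (forall z : C, in_disk z -> (Cmod (w z) <= Cmod z)%R) /\
    (forall z : C, in_disk z -> g z = h (w z)).

(* f(z)/z, with value 1 at z = 0. *)
Definition quot_id (f : C -> C) (z : C) : C :=
  if Ceq_dec z 0 then 1 else f z / z.

(* z f'(z)/f(z), with value 1 at z = 0. At a zero z <> 0 of f, Coquelicot's
   total division gives 0; as 0 is not a value of 1 + arctan on the disk
   (Re arctan > - PI/4), [class_Stau] below still forces f(z) <> 0 for
   0 < |z| < 1. *)
Definition log_deriv_quot (f : C -> C) (z : C) : C :=
  if Ceq_dec z 0 then 1 else z * C_derive f z / f z.

(** * Elementary functions *)

Definition Cexp (z : C) : C :=
  RtoC (exp (Re z)) * (cos (Im z), sin (Im z)).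

(* Principal argument, with values in (-PI, PI), off the half-line
   (-oo, 0]: half-angle formula. *)
Definition Carg (z : C) : R := (2 * atan (Im z / (Cmod z + Re z)))%R.

Definition Clog (z : C) : C := (ln (Cmod z), Carg z).

(* Principal branch, arctan 0 = 0. For |z| < 1 both 1 + iz and 1 - iz have
   positive real part. *)
Definition Carctan (z : C) : C :=
  (Clog (1 + Ci * z) - Clog (1 - Ci * z)) / (2 * Ci).

(* Integral of g from 0 to z, taken along the segment [0, z] (it does not
   depend on the path for g analytic on the disk and z in the disk). *)
Definition Cint0 (g : C -> C) (z : C) : C :=
  RInt (V := C_R_CompleteNormedModule) (fun s : R => z * g (RtoC s * z)) 0%R 1%R.

(** * The class S*_tau and its extremal function *)

Definition class_Stau (f : C -> C) : Prop :=
  class_A f /\ subordinate (log_deriv_quot f) (fun z => 1 + Carctan z).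

Definition tau (z : C) : C := z * Cexp (Cint0 (quot_id Carctan) z).

(* tau takes real values on (-1, 1); this is tau(x) as a real number. *)
Definition tau_re (x : R) : R := Re (tau (RtoC x)).

Definition is_rotation_of (f g : C -> C) : Prop :=
  exists theta : R, forall z : C, in_disk z ->
    f z = Cexp (- (Ci * RtoC theta)) * g (Cexp (Ci * RtoC theta) * z).

(* [a] is the continuous branch on the disk of the argument of [g] that
   vanishes at 0. *)
Definition is_arg_branch (g : C -> C) (a : C -> R) : Prop :=
  a 0 = 0%R /\
  forall z : C, in_disk z ->
    continuous a z /\ g z = RtoC (Cmod (g z)) * Cexp (Ci * RtoC (a z)).

(* M is the maximum of [a] on the circle |z| = r. *)
Definition is_circle_max (a : C -> R) (r M : R) : Prop :=
  (exists z : C, Cmod z = r /\ a z = M) /\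
  (forall z : C, Cmod z = r -> (a z <= M)%R).

(* Main.v *)
(** Write f(z)/z = exp G(z) and tau(z)/z = exp H(z), so that z G' = arctan w with a
    Schwarz function w, and z H' = arctan z.

    Growth and rotation: in each of the four directions e = 1, -1, i, -i the real part
    of conj(e) arctan on |z| <= r is largest at e r (from the explicit level curves
    cos(2 Re a) / cosh(2 Im a) = (1 - |z|^2) / (1 + |z|^2), a = arctan z). Integrating
    along rays gives Re(conj(e) G(z)) <= Re(conj(e) H(e |z|)), and equality at some
    z <> 0 forces |G'(0)| = 1.

    Subordination: Re H' >= 1/2, so H is injective with a Lipschitz inverse, and
    G = H(v) can be continued from small disks to larger ones as long as |v| < 1.
    Where |v(z)/z| is maximal on a closed disk, K = z v'/v is real and >= 1, while
    arctan w = K arctan v; since the image of each disk under arctan is starlike, a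
    maximum above 1 would give |w| >= |v| > |z|. Hence |v(z)| <= |z|.

    Rigidity: if |G'(0)| = 1 then |v'(0)| = 1, and the mean value property of v(z)/z
    makes v a rotation. The lift v has a continuous derivative because
    v' = G'/H'(v), so no Cauchy theory is needed.

    Covering: |f - w0| attains its minimum on |z| <= rho. A nonzero minimum lies on the
    boundary and makes w0 = f (1 + mu p) with mu >= 0 and p = z f'/f of positive real
    part, so |w0| >= |f| there. *)
Require Import Defs.
From Stdlib Require Import Reals Lra Psatz Lia Classical ClassicalEpsilon.
From Coquelicot Require Import Coquelicot.
Open Scope R_scope.

(** * Complex differentiability *)

(** Analytic means differentiable at each point, so continuity of a derivative, path independence
    and extremum principles all have to be earned. The function [k] = G' is arctan(w(z))/z,
    completed by w'(0) at 0, and is continuous for that reason; [Cint0 k] integrates it along rays.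
    That [Cint0 k] has derivative [k] comes from exp G = f(z)/z (uniqueness for a linear equation
    along each ray) followed by a lift through exp; for H it comes from a second-order estimate of
    arctan, uniform along the ray. Extremum arguments rest on first-order conditions for |phi| on a
    closed disk. Two numbers carry the geometry: Re 1/(1+u) >= 1/2 for |u| < 1, which bounds Re H'
    below, and |Re arctan| < pi/4 <= 1, which gives Re z f'/f > 0, keeps f zero-free off 0 and makes
    the covering radius increase with r. All equality cases pass through |k(0)| = 1: equality at z
    makes a monotone function on the ray to z constant, and its slope at 0 compares k(0) with H'(0)
    = 1. *)

Definition ccont (f : C -> C) (z : C) : Prop :=
  forall eps, 0 < eps -> exists delta, 0 < delta /\
    forall w, Cmod (w - z) < delta -> Cmod (f w - f z) < eps.

(* Carathéodory's criterion: the slope function is continuous at z. The calculus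
   rules then reduce to those of continuity; see [cderiv_iff]. *)
Definition cderiv (f : C -> C) (z l : C) : Prop :=
  exists E : C -> C, ccont E z /\ E z = l /\
    forall w, f w = (f z + E w * (w - z))%C.

Lemma Cmod_minus_sym (a b : C) : Cmod (a - b) = Cmod (b - a).
Proof. rewrite <- Cmod_opp; f_equal; ring. Qed.

Lemma Cmod_tri_minus (a b c : C) : Cmod (a - c) <= Cmod (a - b) + Cmod (b - c).
Proof. replace (a - c)%C with ((a - b) + (b - c))%C by ring; apply Cmod_triangle. Qed.

Lemma Cmod_tri_le (a b : C) : Cmod a <= Cmod b + Cmod (a - b).
Proof. replace a with (b + (a - b))%C at 1 by ring; apply Cmod_triangle. Qed.

Lemma ccont_const (c z : C) : ccont (fun _ => c) z.
Proof.
intros eps He; exists 1; split; [lra|intros w _].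
replace (c - c)%C with (RtoC 0) by ring; rewrite Cmod_0; exact He.
Qed.

Lemma ccont_id (z : C) : ccont (fun w => w) z.
Proof. intros eps He; exists eps; split; auto. Qed.

Lemma ccont_plus f g z : ccont f z -> ccont g z -> ccont (fun w => f w + g w)%C z.
Proof.
intros Hf Hg eps He.
destruct (Hf (eps/2)) as [d1 [D1 H1]]; [lra|].
destruct (Hg (eps/2)) as [d2 [D2 H2]]; [lra|].
exists (Rmin d1 d2); split; [apply Rmin_pos; auto|intros w Hw].
specialize (H1 w (Rlt_le_trans _ _ _ Hw (Rmin_l _ _))).
specialize (H2 w (Rlt_le_trans _ _ _ Hw (Rmin_r _ _))).
replace (f w + g w - (f z + g z))%C with ((f w - f z) + (g w - g z))%C by ring.
eapply Rle_lt_trans; [apply Cmod_triangle|lra].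
Qed.

Lemma Cmult_close (a b : C) eps : 0 < eps -> exists e, 0 < e /\
  forall x y, Cmod (x - a) < e -> Cmod (y - b) < e -> Cmod (x * y - a * b) < eps.
Proof.
intros He.
pose proof (Cmod_ge_0 a) as Pf; pose proof (Cmod_ge_0 b) as Pg.
set (M := Cmod a + Cmod b + 1).
assert (HM : 0 < M) by (unfold M; lra).
assert (Hdiv : 0 < eps / (2 * M)) by (apply Rdiv_lt_0_compat; lra).
set (e := Rmin 1 (eps / (2 * M))).
assert (He' : 0 < e) by (apply Rmin_pos; lra).
assert (He1 : e <= 1) by apply Rmin_l.
assert (He2 : e * M <= eps / 2).
{ apply Rle_trans with (eps / (2 * M) * M); [apply Rmult_le_compat_r; [lra|apply Rmin_r]|].
  right; field; lra. }
exists e; split; auto; intros x y H1 H2.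
replace (x * y - a * b)%C
  with ((x - a) * (y - b) + ((x - a) * b + a * (y - b)))%C by ring.
eapply Rle_lt_trans; [apply Cmod_triangle|].
eapply Rle_lt_trans; [apply Rplus_le_compat_l, Cmod_triangle|].
rewrite !Cmod_mult.
pose proof (Cmod_ge_0 (x - a)); pose proof (Cmod_ge_0 (y - b)).
unfold M in He2; nra.
Qed.

Lemma ccont_mult f g z : ccont f z -> ccont g z -> ccont (fun w => f w * g w)%C z.
Proof.
intros Hf Hg eps He; destruct (Cmult_close (f z) (g z) eps He) as [e [He' H]].
destruct (Hf e He') as [d1 [D1 H1]]; destruct (Hg e He') as [d2 [D2 H2]].
exists (Rmin d1 d2); split; [apply Rmin_pos; auto|intros w Hw; apply H].
- apply H1; eapply Rlt_le_trans; [exact Hw|apply Rmin_l].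
- apply H2; eapply Rlt_le_trans; [exact Hw|apply Rmin_r].
Qed.

Lemma ccont_inv f z : ccont f z -> f z <> 0%C -> ccont (fun w => / f w)%C z.
Proof.
intros Hf Hn eps He.
assert (Hm : 0 < Cmod (f z)) by (now apply Cmod_gt_0).
set (m := Cmod (f z)) in *.
destruct (Hf (Rmin (m/2) (eps * (m * m / 2)))) as [d [D H]].
{ apply Rmin_pos; [lra|]. apply Rmult_lt_0_compat; nra. }
exists d; split; auto; intros w Hw; specialize (H w Hw).
assert (H1 : Cmod (f w - f z) < m/2) by (eapply Rlt_le_trans; [exact H|apply Rmin_l]).
assert (H2 : Cmod (f w - f z) < eps * (m*m/2)) by (eapply Rlt_le_trans; [exact H|apply Rmin_r]).
assert (H3 : m / 2 < Cmod (f w)).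
{ pose proof (Cmod_tri_le (f z) (f w)) as T; rewrite Cmod_minus_sym in T; fold m in T; lra. }
assert (Hw0 : f w <> 0%C) by (apply Cmod_gt_0; lra).
replace (/ f w - / f z)%C with ((f z - f w) / (f w * f z))%C by (field; auto).
rewrite Cmod_div by (apply Cmult_neq_0; auto).
rewrite Cmod_minus_sym, Cmod_mult; fold m.
apply Rmult_lt_reg_r with (Cmod (f w) * m); [nra|].
unfold Rdiv; rewrite Rmult_assoc, Rinv_l, Rmult_1_r by nra.
eapply Rlt_trans; [exact H2|]. apply Rmult_lt_compat_l; nra.
Qed.

Lemma ccont_comp f g z : ccont g z -> ccont f (g z) -> ccont (fun w => f (g w)) z.
Proof.
intros Hg Hf eps He; destruct (Hf eps He) as [d [D H]]; destruct (Hg d D) as [d' [D' H']].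
exists d'; split; auto.
Qed.

Lemma ccont_ext_loc f g z (d : R) : 0 < d ->
  (forall w, Cmod (w - z) < d -> f w = g w) -> ccont f z -> ccont g z.
Proof.
intros Hd He Hf eps Heps; destruct (Hf eps Heps) as [d' [D' H']].
exists (Rmin d d'); split; [apply Rmin_pos; auto|intros w Hw].
rewrite <- !He.
- apply H'; eapply Rlt_le_trans; [exact Hw|apply Rmin_r].
- replace (z - z)%C with (RtoC 0) by ring; rewrite Cmod_0; auto.
- eapply Rlt_le_trans; [exact Hw|apply Rmin_l].
Qed.

Lemma ccont_ext f g z : (forall w, f w = g w) -> ccont f z -> ccont g z.
Proof. intros H; apply (ccont_ext_loc f g z 1); [lra|auto]. Qed.

Lemma cderiv_cont f z l : cderiv f z l -> ccont f z.
Proof.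
intros [E [H1 [H2 H3]]].
apply ccont_ext with (fun w => f z + E w * (w - z))%C; [intros; now rewrite <- H3|].
apply ccont_plus; [apply ccont_const|apply ccont_mult; auto].
apply ccont_plus; [apply ccont_id|apply ccont_const].
Qed.

(** The slope function in [cderiv] is tied to [f] at every point of the plane; this form only looks
    near [z], which is what [cderiv_ext_loc] and explicit estimates need. For the converse the
    difference quotient is the slope, completed by [l] at [z]. *)
Lemma cderiv_quot f z l : cderiv f z l <->
  (forall eps, 0 < eps -> exists delta, 0 < delta /\ forall w, Cmod (w - z) < delta ->
     Cmod (f w - f z - l * (w - z)) <= eps * Cmod (w - z)).
Proof.
split.
- intros [E [H1 [H2 H3]]] eps He; destruct (H1 eps He) as [d [D H]].
  exists d; split; auto; intros w Hw; rewrite (H3 w).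
  replace (f z + E w * (w - z) - f z - l * (w - z))%C with ((E w - E z) * (w - z))%C
    by (rewrite H2; ring).
  rewrite Cmod_mult; apply Rmult_le_compat_r; [apply Cmod_ge_0|left; auto].
- intros H.
  exists (fun w => if Ceq_dec w z then l else ((f w - f z) / (w - z))%C); repeat split.
  + intros eps He; destruct (H (eps/2)) as [d [D H']]; [lra|].
    exists d; split; auto; intros w Hw.
    destruct (Ceq_dec z z) as [_|n]; [|now destruct n].
    destruct (Ceq_dec w z) as [->|n].
    * replace (l - l)%C with (RtoC 0) by ring; now rewrite Cmod_0.
    * assert (Hn := Cminus_eq_contra _ _ n).
      replace ((f w - f z) / (w - z) - l)%C with ((f w - f z - l * (w - z)) / (w - z))%C
        by (field; auto).
      rewrite Cmod_div by auto.
      assert (P : 0 < Cmod (w - z)) by (now apply Cmod_gt_0).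
      specialize (H' w Hw).
      apply Rle_lt_trans with (eps/2); [|lra].
      apply Rmult_le_reg_r with (Cmod (w - z)); auto.
      unfold Rdiv at 1; rewrite Rmult_assoc, Rinv_l by lra; lra.
  + destruct (Ceq_dec z z) as [_|n]; [auto|now destruct n].
  + intros w; destruct (Ceq_dec w z) as [->|n]; [ring|].
    field; now apply Cminus_eq_contra.
Qed.

Lemma cderiv_ext_loc f g z l (d : R) : 0 < d ->
  (forall w, Cmod (w - z) < d -> f w = g w) -> cderiv f z l -> cderiv g z l.
Proof.
intros Hd He; rewrite !cderiv_quot; intros Hf eps Heps.
destruct (Hf eps Heps) as [d' [D' H']].
exists (Rmin d d'); split; [apply Rmin_pos; auto|intros w Hw].
rewrite <- !He.
- apply H'; eapply Rlt_le_trans; [exact Hw|apply Rmin_r].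
- replace (z - z)%C with (RtoC 0) by ring; rewrite Cmod_0; auto.
- eapply Rlt_le_trans; [exact Hw|apply Rmin_l].
Qed.

Lemma cderiv_const (c z : C) : cderiv (fun _ => c) z 0%C.
Proof. exists (fun _ => 0%C); repeat split; [apply ccont_const|intros; ring]. Qed.

Lemma cderiv_id (z : C) : cderiv (fun w => w) z 1%C.
Proof. exists (fun _ => 1%C); repeat split; [apply ccont_const|intros; ring]. Qed.

Lemma cderiv_plus f g z l m :
  cderiv f z l -> cderiv g z m -> cderiv (fun w => f w + g w)%C z (l + m)%C.
Proof.
intros [E [H1 [H2 H3]]] [F [K1 [K2 K3]]].
exists (fun w => E w + F w)%C; repeat split; [now apply ccont_plus|now rewrite H2, K2|].
intros w; rewrite (H3 w), (K3 w); ring.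
Qed.

Lemma cderiv_mult f g z l m :
  cderiv f z l -> cderiv g z m -> cderiv (fun w => f w * g w)%C z (l * g z + f z * m)%C.
Proof.
intros Hf Hg; assert (Cg := cderiv_cont _ _ _ Hg).
destruct Hf as [E [H1 [H2 H3]]], Hg as [F [K1 [K2 K3]]].
exists (fun w => E w * g w + f z * F w)%C; repeat split.
- apply ccont_plus; apply ccont_mult; auto; apply ccont_const.
- now rewrite H2, K2.
- intros w; rewrite (H3 w); replace (g w) with (g z + F w * (w - z))%C by auto; ring.
Qed.

Lemma cderiv_comp f g z l m :
  cderiv g z m -> cderiv f (g z) l -> cderiv (fun w => f (g w)) z (l * m)%C.
Proof.
intros Hg Hf; assert (Cg := cderiv_cont _ _ _ Hg).
destruct Hf as [E [H1 [H2 H3]]], Hg as [F [K1 [K2 K3]]].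
exists (fun w => E (g w) * F w)%C; repeat split.
- apply ccont_mult; auto; now apply ccont_comp.
- now rewrite H2, K2.
- intros w; rewrite (H3 (g w)); replace (g w - g z)%C with (F w * (w - z))%C; [ring|].
  rewrite (K3 w); ring.
Qed.

Lemma cderiv_eq f z l m : l = m -> cderiv f z l -> cderiv f z m.
Proof. now intros ->. Qed.

Lemma cderiv_inv f z l :
  cderiv f z l -> f z <> 0%C -> cderiv (fun w => / f w)%C z (- l / (f z * f z))%C.
Proof.
intros Hf Hn; assert (Cf := cderiv_cont _ _ _ Hf).
destruct (Cf (Cmod (f z))) as [d [D Hd]]; [now apply Cmod_gt_0|].
assert (Hnz : forall w, Cmod (w - z) < d -> f w <> 0%C).
{ intros w Hw E; specialize (Hd w Hw); rewrite E in Hd.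
  replace (0 - f z)%C with (- f z)%C in Hd by ring; rewrite Cmod_opp in Hd; lra. }
destruct Hf as [E [H1 [H2 H3]]].
(* The slope identity for 1/f holds only where [f] does not vanish, so it is proved near [z] and
   transported by locality. *)
apply (cderiv_ext_loc (fun w => / f z + (- E w / (f w * f z)) * (w - z))%C _ z _ d D).
- intros w Hw; specialize (Hnz w Hw).
  replace (- E w / (f w * f z) * (w - z))%C with (- (E w * (w - z)) / (f w * f z))%C
    by (field; auto).
  replace (E w * (w - z))%C with (f w - f z)%C by (rewrite (H3 w); ring).
  field; auto.
- exists (fun w => - E w / (f w * f z))%C; repeat split.
  + apply ccont_mult; [|apply ccont_inv].
    * apply ccont_ext with (fun w => (-1) * E w)%C; [intros; ring|].
      apply ccont_mult; auto; apply ccont_const.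
    * apply ccont_mult; auto; apply ccont_const.
    * now apply Cmult_neq_0.
  + now rewrite H2.
  + intros w; ring.
Qed.

Lemma cderiv_scal c f z l : cderiv f z l -> cderiv (fun w => c * f w)%C z (c * l)%C.
Proof.
intros H; apply cderiv_eq with (0 * f z + c * l)%C; [ring|].
apply cderiv_mult; auto; apply cderiv_const.
Qed.

Lemma cderiv_div f g z l m : cderiv f z l -> cderiv g z m -> g z <> 0%C ->
  cderiv (fun w => f w / g w)%C z ((l * g z - f z * m) / (g z * g z))%C.
Proof.
intros Hf Hg Hn.
apply cderiv_eq with (l * / g z + f z * (- m / (g z * g z)))%C; [field; auto|].
apply (cderiv_mult f (fun w => / g w)%C); auto; now apply cderiv_inv.
Qed.

Lemma cderiv_minus f g z l m :
  cderiv f z l -> cderiv g z m -> cderiv (fun w => f w - g w)%C z (l - m)%C.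
Proof.
intros Hf Hg; apply cderiv_plus; auto.
apply (cderiv_ext_loc (fun w => (-1) * g w)%C _ z _ 1); [lra|intros; ring|].
apply cderiv_eq with ((-1) * m)%C; [ring|now apply cderiv_scal].
Qed.

Lemma cderiv_unique f z l m : cderiv f z l -> cderiv f z m -> l = m.
Proof.
intros Hf Hg.
destruct (Ceq_dec l m) as [|n]; auto; exfalso.
assert (P : 0 < Cmod (l - m)) by (apply Cmod_gt_0; now apply Cminus_eq_contra).
rewrite cderiv_quot in Hf, Hg.
destruct (Hf (Cmod (l - m) / 4)) as [d1 [D1 H1]]; [lra|].
destruct (Hg (Cmod (l - m) / 4)) as [d2 [D2 H2]]; [lra|].
assert (Hd : 0 < Rmin d1 d2) by (apply Rmin_pos; auto).
set (t := Rmin d1 d2 / 2); assert (Ht : 0 < t) by (unfold t; lra).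
assert (Hwz : Cmod ((z + RtoC t) - z) = t).
{ replace (z + t - z)%C with (RtoC t) by ring; rewrite Cmod_R; apply Rabs_right; lra. }
specialize (H1 (z + t)%C); specialize (H2 (z + t)%C); rewrite Hwz in H1, H2.
pose proof (Rmin_l d1 d2); pose proof (Rmin_r d1 d2).
assert (L1 : t < d1) by (unfold t in *; lra).
assert (L2 : t < d2) by (unfold t in *; lra).
specialize (H1 L1); specialize (H2 L2).
assert (Q : Cmod ((l - m) * t) <= Cmod (l - m) / 4 * t + Cmod (l - m) / 4 * t).
{ replace ((l - m) * t)%C with
   ((f (z + t) - f z - m * (z + t - z)) - (f (z + t) - f z - l * (z + t - z)))%C by ring.
  eapply Rle_trans; [apply Cmod_triangle|]; rewrite Cmod_opp; lra. }
rewrite Cmod_mult, Cmod_R, Rabs_right in Q by lra; nra.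
Qed.

(** Divide the slope of [Phi (y w)] by that of [Phi] at [y w]: continuity of [y] keeps the divisor
    away from 0. This inverse function argument yields the derivatives of the logarithm, of G
    through exp, and of the lift v through H. *)
Lemma cderiv_lift (Phi y : C -> C) z l m :
  cderiv (fun w => Phi (y w)) z m -> ccont y z -> cderiv Phi (y z) l -> l <> 0%C -> cderiv y z (m / l)%C.
Proof.
intros H0 Cy HP Hl.
destruct H0 as [F [K1 [K2 K3]]], HP as [E [H1 [H2 H3]]].
assert (CE : ccont (fun w => E (y w)) z) by (apply ccont_comp; auto).
destruct (CE (Cmod l)) as [e [He Hen]]; [now apply Cmod_gt_0|].
assert (Hnz : forall w, Cmod (w - z) < e -> E (y w) <> 0%C).
{ intros w Hw E0; specialize (Hen w Hw); rewrite E0, H2 in Hen.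
  replace (0 - l)%C with (- l)%C in Hen by ring; rewrite Cmod_opp in Hen; lra. }
apply (cderiv_ext_loc (fun w => y z + (F w / E (y w)) * (w - z))%C _ z _ e He).
- intros w Hw; specialize (Hnz w Hw).
  replace (F w / E (y w) * (w - z))%C with ((F w * (w - z)) / E (y w))%C by (field; auto).
  replace (F w * (w - z))%C with (Phi (y w) - Phi (y z))%C by (rewrite (K3 w); ring).
  rewrite (H3 (y w)); field; auto.
- exists (fun w => F w / E (y w))%C; repeat split.
  + apply ccont_mult; auto; apply ccont_inv; auto; now rewrite H2.
  + now rewrite K2, H2.
  + intros w; ring.
Qed.

Lemma cderiv_iff f z l :
  is_derive (K := C_AbsRing) (V := C_NormedModule) f z l <-> cderiv f z l.
Proof.
rewrite cderiv_quot; split.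
- intros [_ H] eps He.
  specialize (H z (fun P HP => HP) (mkposreal eps He)).
  destruct H as [d Hd]; exists d; split; [apply cond_pos|].
  intros w Hw; specialize (Hd w Hw); simpl in Hd.
  change (norm (minus w z)) with (Cmod (w - z)) in Hd.
  change (norm (minus (minus (f w) (f z)) (scal (minus w z) l)))
    with (Cmod (f w - f z - (w - z) * l)) in Hd.
  now rewrite (Cmult_comm l).
- intros H; split; [apply is_linear_scal_l|].
  intros x Hx; assert (x = z) as -> .
  { symmetry; apply (is_filter_lim_locally_unique (V := AbsRing_NormedModule C_AbsRing)).
    exact Hx. }
  intros eps; destruct (H eps (cond_pos eps)) as [d [D Hd]].
  exists (mkposreal d D); intros w Hw.
  change (norm (minus w z)) with (Cmod (w - z)).
  change (norm (minus (minus (f w) (f z)) (scal (minus w z) l)))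
    with (Cmod (f w - f z - (w - z) * l)).
  rewrite (Cmult_comm _ l); apply Hd; exact Hw.
Qed.

(** * Complex-valued functions of a real variable *)

Definition rcont (g : R -> C) (s : R) : Prop :=
  forall eps, 0 < eps -> exists delta, 0 < delta /\
    forall t, Rabs (t - s) < delta -> Cmod (g t - g s) < eps.

Definition rderiv (g : R -> C) (s : R) (m : C) : Prop :=
  exists E : R -> C, rcont E s /\ E s = m /\
    forall t, g t = (g s + E t * RtoC (t - s))%C.

Lemma rcont_const c s : rcont (fun _ => c) s.
Proof.
intros eps He; exists 1; split; [lra|intros t _].
replace (c - c)%C with (RtoC 0) by ring; now rewrite Cmod_0.
Qed.

Lemma rcont_mult f g s : rcont f s -> rcont g s -> rcont (fun t => f t * g t)%C s.
Proof.
intros Hf Hg eps He; destruct (Cmult_close (f s) (g s) eps He) as [e [He' H]].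
destruct (Hf e He') as [d1 [D1 H1]]; destruct (Hg e He') as [d2 [D2 H2]].
exists (Rmin d1 d2); split; [apply Rmin_pos; auto|intros w Hw; apply H].
- apply H1; eapply Rlt_le_trans; [exact Hw|apply Rmin_l].
- apply H2; eapply Rlt_le_trans; [exact Hw|apply Rmin_r].
Qed.

Lemma rcont_plus f g s : rcont f s -> rcont g s -> rcont (fun t => f t + g t)%C s.
Proof.
intros Hf Hg eps He.
destruct (Hf (eps/2)) as [d1 [D1 H1]]; [lra|].
destruct (Hg (eps/2)) as [d2 [D2 H2]]; [lra|].
exists (Rmin d1 d2); split; [apply Rmin_pos; auto|intros w Hw].
specialize (H1 w (Rlt_le_trans _ _ _ Hw (Rmin_l _ _))).
specialize (H2 w (Rlt_le_trans _ _ _ Hw (Rmin_r _ _))).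
replace (f w + g w - (f s + g s))%C with ((f w - f s) + (g w - g s))%C by ring.
eapply Rle_lt_trans; [apply Cmod_triangle|lra].
Qed.

Lemma rcont_comp f g s : rcont g s -> ccont f (g s) -> rcont (fun t => f (g t)) s.
Proof.
intros Hg Hf eps He; destruct (Hf eps He) as [d [D H]]; destruct (Hg d D) as [d' [D' H']].
exists d'; split; auto.
Qed.

Lemma rderiv_affine (a b : C) (s : R) : rderiv (fun t => a + RtoC t * b)%C s b.
Proof.
exists (fun _ => b); repeat split; [apply rcont_const|].
intros t; rewrite RtoC_minus; ring.
Qed.

Lemma rderiv_cont g s m : rderiv g s m -> rcont g s.
Proof.
intros [E [H1 [H2 H3]]] eps He.
assert (Hid : rcont (fun t => RtoC (t - s)) s).
{ intros e He'; exists e; split; auto; intros t Ht.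
  rewrite <- RtoC_minus, Cmod_R; now replace (t - s - (s - s)) with (t - s) by ring. }
destruct (rcont_mult _ _ _ H1 Hid eps He) as [d [D H]]; exists d; split; auto.
intros t Ht; specialize (H t Ht); rewrite (H3 t).
replace (g s + E t * RtoC (t - s) - g s)%C with (E t * RtoC (t - s) - E s * RtoC (s - s))%C; auto.
replace (s - s) with 0 by ring; ring.
Qed.

Lemma rderiv_comp f g s l m :
  rderiv g s m -> cderiv f (g s) l -> rderiv (fun t => f (g t)) s (l * m)%C.
Proof.
intros Hg [E [H1 [H2 H3]]]; assert (Cg := rderiv_cont _ _ _ Hg).
destruct Hg as [F [K1 [K2 K3]]].
exists (fun t => E (g t) * F t)%C; repeat split.
- apply rcont_mult; auto; now apply rcont_comp.
- now rewrite H2, K2.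
- intros t; rewrite (H3 (g t)); replace (g t - g s)%C with (F t * RtoC (t - s))%C; [ring|].
  rewrite (K3 t); ring.
Qed.

Lemma rderiv_mult f g s l m : rderiv f s l -> rderiv g s m ->
  rderiv (fun t => f t * g t)%C s (l * g s + f s * m)%C.
Proof.
intros Hf Hg; assert (Cg := rderiv_cont _ _ _ Hg).
destruct Hf as [E [H1 [H2 H3]]], Hg as [F [K1 [K2 K3]]].
exists (fun t => E t * g t + f s * F t)%C; repeat split.
- apply rcont_plus; apply rcont_mult; auto; apply rcont_const.
- now rewrite H2, K2.
- intros w; rewrite (H3 w); replace (g w) with (g s + F w * RtoC (w - s))%C by auto; ring.
Qed.

Lemma re_minus (a b : C) : Re (a - b) = Re a - Re b.
Proof. reflexivity. Qed.

Lemma im_minus (a b : C) : Im (a - b) = Im a - Im b.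
Proof. reflexivity. Qed.

Lemma Im_eq_Re (z : C) : Im z = Re (- Ci * z)%C.
Proof. destruct z; simpl; ring. Qed.

Lemma rderiv_scal c g s m : rderiv g s m -> rderiv (fun t => c * g t)%C s (c * m)%C.
Proof.
intros H; apply (rderiv_comp (fun z => c * z)%C); auto.
pose proof (cderiv_scal c _ _ _ (cderiv_id (g s))) as Q.
now rewrite Cmult_1_r in Q.
Qed.

Lemma rderiv_Re g s m : rderiv g s m -> is_derive (fun t => Re (g t)) s (Re m).
Proof.
intros [E [H1 [H2 H3]]]; apply is_derive_Reals; intros eps He.
destruct (H1 eps He) as [d [D H]]; exists (mkposreal d D); intros h Hh Hd; simpl in Hd.
replace ((Re (g (s + h)) - Re (g s)) / h - Re m) with (Re (E (s + h) - E s)).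
- eapply Rle_lt_trans; [apply re_le_Cmod|].
  apply H; now replace (s + h - s) with h by ring.
- rewrite (H3 (s + h)), re_plus, re_scal_r, re_minus, H2; field; auto.
Qed.

Lemma rderiv_Im g s m : rderiv g s m -> is_derive (fun t => Im (g t)) s (Im m).
Proof.
intros H; rewrite (Im_eq_Re m).
apply is_derive_ext with (fun t => Re (- Ci * g t)%C); [intros; now rewrite <- Im_eq_Re|].
now apply rderiv_Re, rderiv_scal.
Qed.

Lemma im_le_Cmod (c : C) : Rabs (Im c) <= Cmod c.
Proof.
rewrite Im_eq_Re; eapply Rle_trans; [apply re_le_Cmod|].
rewrite Cmod_mult, Cmod_opp, Cmod_Ci; lra.
Qed.

Lemma Cmod_le_Re_Im (c : C) : Cmod c <= Rabs (Re c) + Rabs (Im c).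
Proof.
replace c with (RtoC (Re c) + Ci * RtoC (Im c))%C at 1
  by (destruct c; unfold RtoC, Ci, Cplus, Cmult; simpl; f_equal; ring).
eapply Rle_trans; [apply Cmod_triangle|].
rewrite Cmod_mult, Cmod_Ci, !Cmod_R; lra.
Qed.

(** * Extrema on closed disks *)

(** Continuity relative to the disk, because 1/(M - F) in the proof of [ball_max] is controlled only
    there. *)
Definition cont_on_ball (F : C -> R) (r : R) : Prop :=
  forall z, Cmod z <= r -> forall eps, 0 < eps -> exists delta, 0 < delta /\
    forall w, Cmod w <= r -> Cmod (w - z) < delta -> Rabs (F w - F z) < eps.

(** Compactness of a square with a gauge: at a point of the disk the radius d is so small that F <=
    1/d nearby, at a point outside so small that the disk is avoided. A uniform lower bound on the
    gauge is then an upper bound on [F]. *)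
Lemma cont_on_ball_bounded F r : cont_on_ball F r ->
  exists B, 0 < B /\ forall z, Cmod z <= r -> F z <= B.
Proof.
intros HF.
assert (Hd : forall p : R * R, exists d : posreal, forall x y : R,
   Cmod (x, y) <= r -> Rabs (x - fst p) < d -> Rabs (y - snd p) < d -> F (x, y) <= / d).
{ intros [u v]; simpl.
  destruct (Rle_lt_dec (Cmod (u, v)) r) as [Hin|Hout].
  - destruct (HF _ Hin 1) as [d [D H]]; [lra|].
    pose proof (Rabs_pos (F (u, v))) as P.
    assert (Hp : 0 < Rmin (d/2) (/ (Rabs (F (u, v)) + 1))).
    { apply Rmin_pos; [lra|apply Rinv_0_lt_compat; lra]. }
    exists (mkposreal _ Hp); simpl; intros x y Hxy Hx Hy.
    assert (Q : Cmod ((x, y) - (u, v)) < d).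
    { eapply Rle_lt_trans; [apply Cmod_le_Re_Im|]; simpl.
      pose proof (Rmin_l (d/2) (/ (Rabs (F (u, v)) + 1))).
      unfold Rminus in *; lra. }
    specialize (H _ Hxy Q).
    apply Rle_trans with (Rabs (F (u, v)) + 1).
    + apply Rabs_def2 in H; pose proof (Rle_abs (F (u, v))); lra.
    + rewrite <- (Rinv_inv (Rabs (F (u, v)) + 1)) at 1.
      apply Rinv_le_contravar; auto; apply Rmin_r.
  - assert (Hp : 0 < (Cmod (u, v) - r) / 2) by lra.
    exists (mkposreal _ Hp); simpl; intros x y Hxy Hx Hy; exfalso.
    pose proof (Cmod_tri_le (u, v) (x, y)) as T.
    pose proof (Cmod_le_Re_Im ((u, v) - (x, y))) as T2; simpl in T2.
    rewrite Rabs_minus_sym in Hx, Hy; unfold Rminus in *; lra. }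
set (delta := fun u v : R =>
  proj1_sig (constructive_indefinite_description _ (Hd (u, v)))).
destruct (compactness_value_2d (- r) r (- r) r delta) as [d H].
exists (/ d); split; [apply Rinv_0_lt_compat, cond_pos|].
intros [x y] Hz.
apply Rnot_lt_le; intros HB.
assert (Hx : Rabs x <= r) by (eapply Rle_trans; [apply (re_le_Cmod (x, y))|auto]).
assert (Hy : Rabs y <= r) by (eapply Rle_trans; [apply (im_le_Cmod (x, y))|auto]).
apply Rabs_le_between in Hx; apply Rabs_le_between in Hy.
apply (H x y Hx Hy); intros [u [v [_ [_ [H1 [H2 H3]]]]]].
pose proof (proj2_sig (constructive_indefinite_description _ (Hd (u, v))) x y Hz H1 H2) as Q.
fold (delta u v) in Q.
pose proof (Rinv_le_contravar _ _ (cond_pos d) H3) as Q2.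
apply (Rlt_irrefl (F (x, y))), (Rle_lt_trans _ _ _ Q), (Rle_lt_trans _ _ _ Q2), HB.
Qed.

(** If the supremum M were not attained, 1/(M - F) would be continuous on the disk, hence bounded by
    some K, and M - 1/K would be a smaller upper bound. *)
Lemma ball_max F r : 0 <= r -> cont_on_ball F r ->
  exists z, Cmod z <= r /\ forall w, Cmod w <= r -> F w <= F z.
Proof.
intros Hr HF.
destruct (cont_on_ball_bounded F r HF) as [B [_ HB]].
destruct (completeness (fun x => exists z, Cmod z <= r /\ F z = x)) as [M [HM1 HM2]].
- exists B; intros x [z [Hz <-]]; auto.
- exists (F 0%C), 0%C; rewrite Cmod_0; auto.
- apply NNPP; intros Hno.
  assert (Hlt : forall w, Cmod w <= r -> F w < M).
  { intros w Hw; destruct (HM1 (F w)) as [|E]; [now exists w|auto|].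
    exfalso; apply Hno; exists w; split; auto; intros w' Hw'; rewrite E; apply HM1; now exists w'. }
  destruct (cont_on_ball_bounded (fun z => / (M - F z)) r) as [K [HK0 HK]].
  + intros z Hz eps He; specialize (Hlt z Hz) as Hz'.
    set (m := M - F z); assert (Hm : 0 < m) by (unfold m; lra).
    destruct (HF z Hz (Rmin (m/2) (eps * (m * m / 2)))) as [d [D H]].
    { apply Rmin_pos; [lra|]; apply Rmult_lt_0_compat; nra. }
    exists d; split; auto; intros w Hw Hwz; specialize (H w Hw Hwz).
    assert (H1 := Rlt_le_trans _ _ _ H (Rmin_l _ _)).
    assert (H2 := Rlt_le_trans _ _ _ H (Rmin_r _ _)).
    fold m; assert (Hmw : m / 2 < M - F w) by (apply Rabs_def2 in H1; unfold m in *; lra).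
    replace (/ (M - F w) - / m) with ((F w - F z) / ((M - F w) * m)) by (unfold m in *; field; lra).
    unfold Rdiv; rewrite Rabs_mult, Rabs_inv, (Rabs_right ((M - F w) * m)) by nra.
    apply Rmult_lt_reg_r with ((M - F w) * m); [nra|].
    rewrite Rmult_assoc, Rinv_l, Rmult_1_r by nra.
    eapply Rlt_trans; [exact H2|]; apply Rmult_lt_compat_l; nra.
  + assert (Q : M <= M - / K).
    { apply HM2; intros x [z [Hz <-]]; specialize (Hlt z Hz); specialize (HK z Hz).
      apply Rinv_le_contravar in HK; [|apply Rinv_0_lt_compat; lra].
      rewrite Rinv_inv in HK; lra. }
    pose proof (Rinv_0_lt_compat K HK0); lra.
Qed.

Lemma ccont_cont_on_ball f r : (forall z, Cmod z <= r -> ccont f z) ->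
  cont_on_ball (fun z => Cmod (f z)) r.
Proof.
intros H z Hz eps He; destruct (H z Hz eps He) as [d [D Hd]].
exists d; split; auto; intros w _ Hw; specialize (Hd w Hw).
pose proof (Cmod_tri_le (f w) (f z)); pose proof (Cmod_tri_le (f z) (f w)) as T.
rewrite Cmod_minus_sym in T.
apply Rabs_def1; lra.
Qed.

Lemma ball_min_Cmod f r : 0 <= r -> (forall z, Cmod z <= r -> ccont f z) ->
  exists z, Cmod z <= r /\ forall w, Cmod w <= r -> Cmod (f z) <= Cmod (f w).
Proof.
intros Hr H.
destruct (ball_max (fun z => - Cmod (f z)) r Hr) as [z [Hz Hm]].
- intros z Hz eps He; destruct (ccont_cont_on_ball f r H z Hz eps He) as [d [D Hd]].
  exists d; split; auto; intros w Hw Hwz; specialize (Hd w Hw Hwz).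
  now replace (- Cmod (f w) - - Cmod (f z)) with (- (Cmod (f w) - Cmod (f z))) by ring;
    rewrite Rabs_Ropp.
- exists z; split; auto; intros w Hw; specialize (Hm w Hw); lra.
Qed.

(** The derivative of |f|^2 at [z] in the direction [e] is twice the real part in the hypothesis. *)
Lemma Cmod_decrease f z l e :
  cderiv f z l -> Re (Cconj (f z) * l * e) < 0 ->
  exists delta, 0 < delta /\ forall t, 0 < t < delta ->
    Cmod (f (z + RtoC t * e)%C) < Cmod (f z).
Proof.
intros Hf Hn.
set (N := fun t : R => Re (Cconj (f z) * f (z + RtoC t * e)%C)).
assert (rd : rderiv (fun t => f (z + RtoC t * e)%C) 0 (l * e)%C).
{ apply rderiv_comp; [apply rderiv_affine|]. now replace (z + RtoC 0 * e)%C with z by ring. }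
destruct rd as [E [H1 [H2 H3]]].
set (a := - Re (Cconj (f z) * l * e)); assert (Ha : 0 < a) by (unfold a; lra).
set (K := Cmod (f z)).
pose proof (Cmod_ge_0 (f z)) as PK; fold K in PK.
pose proof (Cmod_ge_0 (l * e)) as PL.
destruct (H1 (Rmin 1 (a / (2 * (K + 1))))) as [d [D H]].
{ apply Rmin_pos; [lra|apply Rdiv_lt_0_compat; lra]. }
set (L := Cmod (l * e) + 1).
(* With t L^2 < a the quadratic term t^2 |E|^2 stays below t a, while the linear term is below -t
   a. *)
exists (Rmin d (a / (L * L))); split.
{ apply Rmin_pos; auto; apply Rdiv_lt_0_compat; auto; unfold L; nra. }
intros t [Ht0 Ht].
assert (Ht1 := Rlt_le_trans _ _ _ Ht (Rmin_l _ _)).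
assert (Ht2 := Rlt_le_trans _ _ _ Ht (Rmin_r _ _)).
specialize (H t); replace (t - 0) with t in H by ring.
rewrite Rabs_right in H by lra; specialize (H Ht1).
assert (Hq1 := Rlt_le_trans _ _ _ H (Rmin_l _ _)).
assert (Hq2 := Rlt_le_trans _ _ _ H (Rmin_r _ _)).
assert (H3t := H3 t); cbv beta in H3t.
replace (z + RtoC 0 * e)%C with z in H3t by ring.
replace (t - 0) with t in H3t by ring.
set (w := f (z + RtoC t * e)%C) in *.
assert (HE : Cmod (E t) < L).
{ pose proof (Cmod_tri_le (E t) (E 0)); rewrite H2 in *; unfold L; lra. }
assert (Hw : Cmod w ^ 2 = K ^ 2 + 2 * t * Re (Cconj (f z) * E t) + t ^ 2 * Cmod (E t) ^ 2).
{ rewrite H3t; unfold K; rewrite !Cmod2_alt.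
  destruct (f z) as [x y], (E t) as [u v]; simpl; ring. }
assert (HR : Re (Cconj (f z) * E t) < - a / 2).
{ replace (Cconj (f z) * E t)%C with (Cconj (f z) * l * e + Cconj (f z) * (E t - E 0))%C
    by (rewrite H2; ring).
  rewrite re_plus; fold a.
  pose proof (Rle_trans _ _ _ (Rle_abs _) (re_le_Cmod (Cconj (f z) * (E t - E 0)))) as Q.
  rewrite Cmod_mult, Cmod_conj in Q; fold K in Q.
  assert (K * Cmod (E t - E 0) <= K * (a / (2 * (K + 1)))) by (apply Rmult_le_compat_l; lra).
  assert (K * (a / (2 * (K + 1))) < a / 2).
  { apply Rmult_lt_reg_r with (2 * (K + 1)); [lra|].
    replace (K * (a / (2 * (K + 1))) * (2 * (K + 1))) with (K * a) by (field; lra). nra. }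
  unfold a in *; lra. }
assert (HL : t * (L * L) < a).
{ apply Rmult_lt_reg_r with (/ (L * L)); [apply Rinv_0_lt_compat; unfold L; nra|].
  rewrite Rmult_assoc, Rinv_r by (unfold L; nra); unfold Rdiv in Ht2; lra. }
apply Rsqr_incrst_0; [|apply Cmod_ge_0|auto].
unfold Rsqr; fold K; pose proof (Cmod_ge_0 (E t)) as PE.
assert (t * Cmod (E t) ^ 2 <= t * (L * L)) by (apply Rmult_le_compat_l; nra).
nra.
Qed.

Lemma C_eq (a b : C) : Re a = Re b -> Im a = Im b -> a = b.
Proof. destruct a, b; simpl; now intros -> ->. Qed.

(** * Exponential, logarithm and arctangent *)

Lemma Cexp_0 : Cexp 0 = 1%C.
Proof. apply C_eq; simpl; rewrite exp_0, cos_0, ?sin_0; ring. Qed.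

Lemma Cexp_plus (a b : C) : Cexp (a + b) = (Cexp a * Cexp b)%C.
Proof.
destruct a as [x y], b as [u v]; apply C_eq; simpl;
rewrite exp_plus, ?cos_plus, ?sin_plus; ring.
Qed.

Lemma Cexp_neg (a : C) : (Cexp a * Cexp (- a))%C = 1%C.
Proof. rewrite <- Cexp_plus; replace (a + - a)%C with (RtoC 0) by ring; apply Cexp_0. Qed.

Lemma Cexp_neq_0 (a : C) : Cexp a <> 0%C.
Proof.
intros E; pose proof (Cexp_neg a) as H; rewrite E, Cmult_0_l in H.
now apply C1_nz.
Qed.

Lemma Cmod_Cexp (a : C) : Cmod (Cexp a) = exp (Re a).
Proof.
unfold Cexp; rewrite Cmod_mult, Cmod_R, Rabs_right by (left; apply exp_pos).
replace (Cmod (cos (Im a), sin (Im a))) with 1; [ring|].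
unfold Cmod; simpl; pose proof (sin2_cos2 (Im a)) as H; unfold Rsqr in H.
transitivity (sqrt 1); [now rewrite sqrt_1|f_equal; lra].
Qed.

Lemma Cexp_polar (a : C) : Cexp a = (RtoC (Cmod (Cexp a)) * Cexp (Ci * RtoC (Im a)))%C.
Proof.
rewrite Cmod_Cexp; apply C_eq; simpl;
replace (0 * Im a - 1 * 0) with 0 by ring; replace (0 * 0 + 1 * Im a) with (Im a) by ring;
rewrite exp_0; ring.
Qed.

Lemma is_derive_0_eps (f : R -> R) (l : R) : is_derive f 0 l ->
  forall eps, 0 < eps -> exists delta, 0 < delta /\
    forall h, Rabs h < delta -> Rabs (f h - f 0 - l * h) <= eps * Rabs h.
Proof.
intros H eps He; apply is_derive_Reals in H; destruct (H eps He) as [d Hd].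
exists d; split; [apply cond_pos|]; intros h Hh.
destruct (Req_dec h 0) as [->|n].
- replace (f 0 - f 0 - l * 0) with 0 by ring; rewrite Rabs_R0; lra.
- specialize (Hd h n Hh); rewrite Rplus_0_l in Hd.
  replace (f h - f 0 - l * h) with (((f h - f 0) / h - l) * h) by (field; auto).
  rewrite Rabs_mult; apply Rmult_le_compat_r; [apply Rabs_pos|lra].
Qed.

Lemma cderiv_Cexp_0 : cderiv Cexp 0 1.
Proof.
apply cderiv_quot; intros eps He.
(* The errors add up to 8 e |w|: 3 e |w| from the real part and 5 e |w| from the imaginary part. *)
set (e := Rmin 1 (eps / 8)).
assert (He1 : e <= 1) by apply Rmin_l.
assert (He2 : e <= eps / 8) by apply Rmin_r.
assert (He0 : 0 < e) by (apply Rmin_pos; lra).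
assert (I1 : is_derive exp 0 1) by (auto_derive; auto; rewrite exp_0; ring).
destruct (is_derive_0_eps exp 1 I1 e He0) as [d1 [D1 H1]].
assert (I2 : is_derive cos 0 0) by (auto_derive; auto; rewrite sin_0; ring).
destruct (is_derive_0_eps cos 0 I2 e He0) as [d2 [D2 H2]].
assert (I3 : is_derive sin 0 1) by (auto_derive; auto; rewrite cos_0; ring).
destruct (is_derive_0_eps sin 1 I3 e He0) as [d3 [D3 H3]].
exists (Rmin (Rmin d1 d2) (Rmin d3 e)); split; [repeat apply Rmin_pos; auto; lra|].
intros w Hw; replace (w - 0)%C with w in * by ring.
rewrite Cexp_0.
destruct w as [x y].
pose proof (re_le_Cmod (x, y)) as Ax; pose proof (im_le_Cmod (x, y)) as Ay; simpl in Ax, Ay.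
set (r := Cmod (x, y)) in *.
pose proof (Rmin_l (Rmin d1 d2) (Rmin d3 e)) as M1.
pose proof (Rmin_r (Rmin d1 d2) (Rmin d3 e)) as M2.
pose proof (Rmin_l d1 d2) as M3; pose proof (Rmin_r d1 d2) as M4.
pose proof (Rmin_l d3 e) as M5; pose proof (Rmin_r d3 e) as M6.
assert (B1 : Rabs x < d1) by lra; assert (B2 : Rabs y < d2) by lra;
assert (B3 : Rabs y < d3) by lra; assert (B4 : Rabs x < e) by lra.
specialize (H1 x B1); specialize (H2 y B2); specialize (H3 y B3).
rewrite exp_0 in H1; rewrite cos_0 in H2; rewrite sin_0 in H3.
eapply Rle_trans; [apply Cmod_le_Re_Im|].
replace (Re (Cexp (x, y) - 1 - 1 * (x, y)))
  with ((exp x - 1 - 1 * x) * cos y + (1 + x) * (cos y - 1 - 0 * y)) by (simpl; ring).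
replace (Im (Cexp (x, y) - 1 - 1 * (x, y)))
  with (exp x * (sin y - 0 - 1 * y) + (exp x - 1) * y) by (simpl; ring).
pose proof (COS_bound y) as Cb.
assert (Hc : Rabs (cos y) <= 1) by (apply Rabs_le; lra).
assert (Hx : Rabs (1 + x) <= 2).
{ eapply Rle_trans; [apply Rabs_triang|]; rewrite Rabs_R1; lra. }
pose proof (Rabs_pos x) as Px; pose proof (Rabs_pos y) as Py.
assert (Hex : Rabs (exp x - 1) <= 2 * Rabs x).
{ replace (exp x - 1) with ((exp x - 1 - 1 * x) + x) by ring.
  eapply Rle_trans; [apply Rabs_triang|]; nra. }
assert (Hex3 : Rabs (exp x) <= 3).
{ replace (exp x) with ((exp x - 1) + 1) by ring.
  eapply Rle_trans; [apply Rabs_triang|]; rewrite Rabs_R1; lra. }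
assert (T1 : Rabs ((exp x - 1 - 1 * x) * cos y + (1 + x) * (cos y - 1 - 0 * y)) <= e * r + 2 * (e * r)).
{ eapply Rle_trans; [apply Rabs_triang|]; rewrite !Rabs_mult.
  pose proof (Rabs_pos (exp x - 1 - 1 * x)); pose proof (Rabs_pos (cos y - 1 - 0 * y)).
  pose proof (Rabs_pos (cos y)); pose proof (Rabs_pos (1 + x)).
  apply Rplus_le_compat.
  - apply Rle_trans with (e * Rabs x * 1); [apply Rmult_le_compat; auto|nra].
  - apply Rle_trans with (2 * (e * Rabs y)); [apply Rmult_le_compat; auto|nra]. }
assert (T2 : Rabs (exp x * (sin y - 0 - 1 * y) + (exp x - 1) * y) <= 3 * (e * r) + 2 * e * r).
{ eapply Rle_trans; [apply Rabs_triang|]; rewrite !Rabs_mult.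
  pose proof (Rabs_pos (exp x)); pose proof (Rabs_pos (sin y - 0 - 1 * y)).
  pose proof (Rabs_pos (exp x - 1)).
  apply Rplus_le_compat.
  - apply Rle_trans with (3 * (e * Rabs y)); [apply Rmult_le_compat; auto|nra].
  - apply Rmult_le_compat; auto; lra. }
assert (0 <= r) by lra. nra.
Qed.

Lemma cderiv_Cexp (z : C) : cderiv Cexp z (Cexp z).
Proof.
apply cderiv_ext_loc with (fun w => Cexp z * Cexp (w - z))%C 1; [lra| |].
- intros w _; rewrite <- Cexp_plus; f_equal; ring.
- apply cderiv_eq with (Cexp z * (1 * (1 - 0)))%C; [ring|].
  apply cderiv_scal, (cderiv_comp Cexp (fun w => w - z)%C).
  + apply cderiv_minus; [apply cderiv_id|apply cderiv_const].
  + replace (z - z)%C with (RtoC 0) by ring; apply cderiv_Cexp_0.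
Qed.

Lemma ccont_lipschitz (f : C -> C) z :
  (forall w, Cmod (f w - f z) <= Cmod (w - z)) -> ccont f z.
Proof.
intros H eps He; exists eps; split; auto; intros w Hw; eapply Rle_lt_trans; eauto.
Qed.

Lemma ccont_Re z : ccont (fun w => RtoC (Re w)) z.
Proof.
apply ccont_lipschitz; intros w; rewrite <- RtoC_minus, Cmod_R, <- re_minus; apply re_le_Cmod.
Qed.

Lemma ccont_Im z : ccont (fun w => RtoC (Im w)) z.
Proof.
apply ccont_lipschitz; intros w; rewrite <- RtoC_minus, Cmod_R, <- im_minus; apply im_le_Cmod.
Qed.

Lemma ccont_Cmod z : ccont (fun w => RtoC (Cmod w)) z.
Proof.
apply ccont_lipschitz; intros w; rewrite <- RtoC_minus, Cmod_R.
pose proof (Cmod_tri_le w z); pose proof (Cmod_tri_le z w) as T; rewrite Cmod_minus_sym in T.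
apply Rabs_le; lra.
Qed.

Lemma ccont_real_comp (phi : R -> R) (F : C -> R) z :
  ccont (fun w => RtoC (F w)) z -> continuity_pt phi (F z) ->
  ccont (fun w => RtoC (phi (F w))) z.
Proof.
intros HF Hp eps He; pose proof (proj1 (continuity_pt_locally phi (F z)) Hp) as Hp'; clear Hp; rename Hp' into Hp.
destruct (Hp (mkposreal eps He)) as [d Hd]; simpl in Hd.
destruct (HF d (cond_pos d)) as [d' [D' H]].
exists d'; split; auto; intros w Hw; specialize (H w Hw).
rewrite <- RtoC_minus, Cmod_R in *; apply Hd; exact H.
Qed.

Lemma Cmod_pos_re (z : C) : 0 < Re z -> 0 < Cmod z.
Proof.
intros H; eapply Rlt_le_trans; [exact H|].
eapply Rle_trans; [apply Rle_abs|apply re_le_Cmod].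
Qed.

Lemma Carg_bound (z : C) : 0 < Re z -> Rabs (Carg z) < PI / 2.
Proof.
intros H; unfold Carg; pose proof (Cmod_pos_re z H) as P.
set (t := Im z / (Cmod z + Re z)).
assert (Ht : Rabs t < 1).
{ unfold t, Rdiv; rewrite Rabs_mult, Rabs_inv, (Rabs_right (Cmod z + Re z)) by lra.
  apply Rmult_lt_reg_r with (Cmod z + Re z); [lra|].
  rewrite Rmult_assoc, Rinv_l by lra; pose proof (im_le_Cmod z); lra. }
apply Rabs_def2 in Ht.
pose proof (atan_increasing t 1 (proj1 Ht)) as A1.
assert (A2 : atan (- (1)) < atan t) by (apply atan_increasing; lra).
rewrite atan_opp in A2; rewrite atan_1 in A1, A2.
apply Rabs_def1; lra.
Qed.

(** The quotient t = Im z / (|z| + Re z) is the tangent of half the argument. The double-angle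
    formulas make cosine and sine rational in t, and 1 + t^2 = 2|z| / (|z| + Re z) turns them into
    Re z / |z| and Im z / |z|. *)
Lemma Cexp_Clog (z : C) : 0 < Cmod z + Re z -> 0 < Cmod z -> Cexp (Clog z) = z.
Proof.
intros Q P; unfold Clog, Cexp, Carg; simpl; rewrite exp_ln by auto.
set (t := Im z / (Cmod z + Re z)).
rewrite cos_2a, sin_2a.
pose proof (cos_atan t) as Hc; pose proof (sin_atan t) as Hs.
assert (S0 : 0 < 1 + t²) by (unfold Rsqr; nra).
assert (Sq : sqrt (1 + t²) * sqrt (1 + t²) = 1 + t²) by (apply sqrt_sqrt; lra).
assert (Sp : 0 < sqrt (1 + t²)) by (apply sqrt_lt_R0; auto).
rewrite Hc, Hs.
set (q := sqrt (1 + t²)) in *; clearbody q.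
assert (E1 : 1 / q * (1 / q) = / (1 + t²)) by (rewrite <- Sq; field; lra).
assert (E2 : t / q * (t / q) = t² / (1 + t²)) by (rewrite <- Sq; unfold Rsqr; field; lra).
assert (E3 : t / q * (1 / q) = t / (1 + t²)) by (rewrite <- Sq; field; lra).
replace (2 * (t / q) * (1 / q)) with (2 * (t / q * (1 / q))) by ring.
rewrite E1, E2, E3.
pose proof (Cmod2_alt z) as M.
assert (T : 1 + t² = 2 * Cmod z / (Cmod z + Re z)).
{ assert (Hy : Im z * Im z = (Cmod z - Re z) * (Cmod z + Re z)) by (simpl in M; nra).
  unfold t, Rsqr; replace (Im z / (Cmod z + Re z) * (Im z / (Cmod z + Re z)))
    with (Im z * Im z / ((Cmod z + Re z) * (Cmod z + Re z))) by (field; lra).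
  rewrite Hy; field; lra. }
rewrite T.
apply C_eq; simpl.
- replace (t²) with (2 * Cmod z / (Cmod z + Re z) - 1) by lra.
  change (fst z) with (Re z). field; lra.
- change (snd z) with (Im z). unfold t; field; lra.
Qed.

Lemma Clog_alt z : Clog z = (RtoC (ln (Cmod z)) + Ci * RtoC (Carg z))%C.
Proof. unfold Clog; apply C_eq; simpl; ring. Qed.

Lemma ccont_Clog (z : C) : 0 < Re z -> ccont Clog z.
Proof.
intros H; pose proof (Cmod_pos_re z H) as P.
apply ccont_ext with (fun z => RtoC (ln (Cmod z)) + Ci * RtoC (Carg z))%C.
{ intros w; now rewrite Clog_alt. }
apply ccont_plus; [|apply ccont_mult; [apply ccont_const|]].
- apply ccont_real_comp; [apply ccont_Cmod|].
  apply derivable_continuous_pt; exists (/ Cmod z); now apply derivable_pt_lim_ln.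
- unfold Carg.
  apply (ccont_real_comp (fun x => 2 * atan x) (fun w => Im w / (Cmod w + Re w))).
  + apply ccont_ext_loc with (fun w => RtoC (Im w) * / (RtoC (Cmod w) + RtoC (Re w)))%C (Re z); auto.
    * intros w Hw.
      assert (0 < Re w).
      { pose proof (re_le_Cmod (w - z)) as Q; rewrite re_minus in Q.
        assert (Q2 := Rle_lt_trans _ _ _ Q Hw); apply Rabs_def2 in Q2; lra. }
      pose proof (Cmod_pos_re w H0).
      rewrite <- RtoC_plus, <- RtoC_inv by lra; now rewrite <- RtoC_mult.
    * apply ccont_mult; [apply ccont_Im|apply ccont_inv].
      -- apply ccont_plus; [apply ccont_Cmod|apply ccont_Re].
      -- rewrite <- RtoC_plus; intros E; apply RtoC_inj in E; lra.
  + apply continuity_pt_mult; [apply continuity_pt_const; now intros ? ?|].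
    apply derivable_continuous_pt, derivable_pt_atan.
Qed.

Lemma ball_re_pos z w : Cmod (w - z) < Re z -> 0 < Re w.
Proof.
intros Hw; pose proof (re_le_Cmod (w - z)) as Q; rewrite re_minus in Q.
assert (Q2 := Rle_lt_trans _ _ _ Q Hw); apply Rabs_def2 in Q2; lra.
Qed.

Lemma cderiv_Clog (z : C) : 0 < Re z -> cderiv Clog z (/ z)%C.
Proof.
intros H; pose proof (Cmod_pos_re z H) as P.
assert (Hz : Cexp (Clog z) = z) by (apply Cexp_Clog; lra).
assert (z <> 0%C) by (now apply Cmod_gt_0).
apply cderiv_eq with (1 / z)%C; [field; auto|].
apply (cderiv_lift Cexp).
- apply cderiv_ext_loc with (fun w => w) (Re z); auto; [|apply cderiv_id].
  intros w Hw; apply ball_re_pos in Hw; pose proof (Cmod_pos_re w Hw).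
  symmetry; apply Cexp_Clog; lra.
- now apply ccont_Clog.
- rewrite <- Hz at 2; apply cderiv_Cexp.
- auto.
Qed.

Lemma re_1_iz z : Cmod z < 1 -> 0 < Re (1 + Ci * z) /\ 0 < Re (1 - Ci * z).
Proof.
intros H; pose proof (im_le_Cmod z) as Q; assert (Q2 := Rle_lt_trans _ _ _ Q H).
apply Rabs_def2 in Q2; destruct z as [x y]; simpl in *; lra.
Qed.

Lemma C_nz_re z : 0 < Re z -> z <> 0%C.
Proof. intros H ->; simpl in H; lra. Qed.

Lemma Ci2 : (Ci * Ci)%C = (-1)%C.
Proof. apply C_eq; simpl; ring. Qed.

Lemma C2_nz : RtoC 2 <> 0%C.
Proof. intros E; apply RtoC_inj in E; lra. Qed.

Lemma sq1_nz z : Cmod z < 1 -> (1 + z * z)%C <> 0%C.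
Proof.
intros H E; assert (Q : (z * z)%C = (-1)%C) by (replace (z * z)%C with (1 + z * z - 1)%C by ring; rewrite E; ring).
assert (Q2 : Cmod (z * z) = 1) by (rewrite Q, Cmod_R, Rabs_left; lra).
rewrite Cmod_mult in Q2; pose proof (Cmod_ge_0 z); nra.
Qed.

Lemma cderiv_Carctan z : Cmod z < 1 -> cderiv Carctan z (/ (1 + z * z))%C.
Proof.
intros H; destruct (re_1_iz z H) as [H1 H2].
pose proof (C_nz_re _ H1) as N1; pose proof (C_nz_re _ H2) as N2.
pose proof (sq1_nz z H) as N3.
assert (HI : cderiv (fun w => Ci * w)%C z Ci).
{ apply cderiv_eq with (Ci * 1)%C; [ring|apply cderiv_scal, cderiv_id]. }
assert (D1 : cderiv (fun w => Clog (1 + Ci * w)) z (/ (1 + Ci * z) * (0 + Ci))%C).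
{ apply (cderiv_comp Clog (fun w => 1 + Ci * w)%C); [|now apply cderiv_Clog].
  apply cderiv_plus; [apply cderiv_const|auto]. }
assert (D2 : cderiv (fun w => Clog (1 - Ci * w)) z (/ (1 - Ci * z) * (0 - Ci))%C).
{ apply (cderiv_comp Clog (fun w => 1 - Ci * w)%C); [|now apply cderiv_Clog].
  apply cderiv_minus; [apply cderiv_const|auto]. }
apply (cderiv_ext_loc (fun w => / (2 * Ci) * (Clog (1 + Ci * w) - Clog (1 - Ci * w)))%C _ _ _ 1);
  [lra|intros; unfold Carctan, Cdiv; ring|].
eapply cderiv_eq; [|apply cderiv_scal, cderiv_minus; [exact D1|exact D2]].
pose proof Ci_nz; pose proof C2_nz.
assert (E : ((1 + Ci * z) * (1 - Ci * z))%C = (1 + z * z)%C).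
{ replace ((1 + Ci * z) * (1 - Ci * z))%C with (1 - (Ci * Ci) * (z * z))%C by ring.
  rewrite Ci2; ring. }
rewrite <- E; field; repeat split; auto.
Qed.

Lemma Carctan_0 : Carctan 0 = 0%C.
Proof.
unfold Carctan; replace (1 + Ci * 0)%C with (RtoC 1) by ring.
replace (1 - Ci * 0)%C with (RtoC 1) by ring.
replace (Clog 1 - Clog 1)%C with (RtoC 0) by ring; unfold Cdiv; ring.
Qed.

Lemma Carctan_opp z : Carctan (- z) = (- Carctan z)%C.
Proof.
unfold Carctan; replace (1 + Ci * - z)%C with (1 - Ci * z)%C by ring.
replace (1 - Ci * - z)%C with (1 + Ci * z)%C by ring.
unfold Cdiv; ring.
Qed.

Lemma Carctan_re_im z : Re (Carctan z) = (Carg (1 + Ci * z) - Carg (1 - Ci * z)) / 2 /\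
  Im (Carctan z) = - (ln (Cmod (1 + Ci * z)) - ln (Cmod (1 - Ci * z))) / 2.
Proof.
unfold Carctan.
set (a := Clog (1 + Ci * z)); set (b := Clog (1 - Ci * z)).
replace ((a - b) / (2 * Ci))%C with (RtoC (/ 2) * (- Ci * (a - b)))%C.
- rewrite re_scal_l, im_scal_l; unfold a, b, Clog; simpl; split; field.
- rewrite RtoC_inv by lra. unfold Cdiv.
  assert (Q : (/ (2 * Ci) = / 2 * - Ci)%C).
  { rewrite <- Ci_inv; field; apply Ci_nz. }
  rewrite Q; ring.
Qed.

(** * Level curves and extremal directions of the arctangent *)

Lemma Cexp_2i_Carctan z : Cmod z < 1 ->
  Cexp (2 * Ci * Carctan z) = ((1 + Ci * z) / (1 - Ci * z))%C.
Proof.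
intros H; destruct (re_1_iz z H) as [H1 H2].
pose proof (Cmod_pos_re _ H1) as P1; pose proof (Cmod_pos_re _ H2) as P2.
pose proof (C_nz_re _ H1) as N1; pose proof (C_nz_re _ H2) as N2.
assert (E : (2 * Ci * Carctan z + Clog (1 - Ci * z))%C = Clog (1 + Ci * z)).
{ unfold Carctan; field; apply Ci_nz. }
assert (F : (Cexp (2 * Ci * Carctan z) * (1 - Ci * z) = 1 + Ci * z)%C).
{ rewrite <- (Cexp_Clog (1 - Ci * z)) by lra; rewrite <- Cexp_plus, E; apply Cexp_Clog; lra. }
rewrite <- F; field; auto.
Qed.

(** With W = exp(2i arctan z) = (1 + iz)/(1 - iz) one has iz (1 + W) = W - 1. Take squared moduli,
    use |W| = exp(-2 Im arctan z) and the argument 2 Re arctan z of W, and divide by 2|W|. *)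
Lemma Carctan_level z : Cmod z < 1 ->
  cosh (2 * Im (Carctan z)) * (1 - Cmod z ^ 2) = cos (2 * Re (Carctan z)) * (1 + Cmod z ^ 2).
Proof.
intros H; pose proof (Cexp_2i_Carctan z H) as E.
destruct (re_1_iz z H) as [H1 H2].
pose proof (C_nz_re _ H1) as N1; pose proof (C_nz_re _ H2) as N2.
set (W := Cexp (2 * Ci * Carctan z)) in *.
set (a := Re (Carctan z)); set (b := Im (Carctan z)).
assert (WR : Re W = exp (- (2 * b)) * cos (2 * a) /\ Im W = exp (- (2 * b)) * sin (2 * a)).
{ unfold W, Cexp.
  replace (Re (2 * Ci * Carctan z)) with (- (2 * b)) by (unfold a, b; simpl; ring).
  replace (Im (2 * Ci * Carctan z)) with (2 * a) by (unfold a, b; simpl; ring).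
  rewrite re_scal_l, im_scal_l; simpl; auto. }
assert (F : (z * (Ci * (1 + W)))%C = (W - 1)%C) by (rewrite E; field; auto).
assert (F2 : Cmod z ^ 2 * Cmod (1 + W) ^ 2 = Cmod (W - 1) ^ 2).
{ rewrite <- F, !Cmod_mult, Cmod_Ci; ring. }
rewrite (Cmod2_alt (1 + W)), (Cmod2_alt (W - 1)), re_plus, im_plus, re_minus, im_minus in F2.
destruct WR as [W1 W2]; rewrite W1, W2 in F2; simpl in F2.
unfold cosh.
pose proof (exp_pos (- (2 * b))) as P.
assert (Q : exp (2 * b) * exp (- (2 * b)) = 1) by (rewrite <- exp_plus, Rplus_opp_r; apply exp_0).
pose proof (sin2_cos2 (2 * a)) as SC; unfold Rsqr in SC.
set (A := exp (- (2 * b))) in *; set (c := cos (2 * a)) in *; set (s := sin (2 * a)) in *.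
set (m := Cmod z) in *.
apply Rmult_eq_reg_r with (2 * A); [|lra].
replace ((exp (2 * b) + A) / 2 * (1 - m ^ 2) * (2 * A))
  with ((exp (2 * b) * A + A * A) * (1 - m ^ 2)) by field.
rewrite Q.
assert (S2 : s * s = 1 - c * c) by lra.
assert (F3 : m ^ 2 * (1 + 2 * A * c + A * A * (s * s + c * c)) = 1 - 2 * A * c + A * A * (s * s + c * c))
  by (simpl; nra).
rewrite SC in F3; simpl in *; nra.
Qed.

Lemma cosh_pos x : 0 < cosh x.
Proof. unfold cosh; pose proof (exp_pos x); pose proof (exp_pos (- x)); lra. Qed.

Lemma cosh_Rabs x : cosh (Rabs x) = cosh x.
Proof.
unfold Rabs; destruct (Rcase_abs x); auto; unfold cosh; rewrite Ropp_involutive; lra.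
Qed.

Lemma cosh_lt x y : Rabs x < Rabs y -> cosh x < cosh y.
Proof.
rewrite <- (cosh_Rabs x), <- (cosh_Rabs y); pose proof (Rabs_pos x) as P.
generalize dependent (Rabs x); generalize (Rabs y); clear x y; intros y x P H.
unfold cosh; pose proof (exp_pos x); pose proof (exp_pos (- x)); pose proof (exp_pos y);
pose proof (exp_pos (- y)).
assert (E1 : exp x < exp y) by (now apply exp_increasing).
assert (E2 : exp x * exp (- x) = 1) by (rewrite <- exp_plus, Rplus_opp_r; apply exp_0).
assert (E3 : exp y * exp (- y) = 1) by (rewrite <- exp_plus, Rplus_opp_r; apply exp_0).
assert (E4 : 1 <= exp x) by (rewrite <- exp_0; destruct P as [P| <-]; [left; now apply exp_increasing|lra]).
(* Factorization of 2 (cosh y - cosh x); both factors are positive for 0 <= x < y. *)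
assert (exp y - exp x + exp (- y) - exp (- x) = (exp y - exp x) * (1 - exp (- x) * exp (- y))).
{ replace ((exp y - exp x) * (1 - exp (- x) * exp (- y))) with
   (exp y - exp x - exp (- x) * (exp y * exp (- y)) + (exp x * exp (- x)) * exp (- y)) by ring.
  rewrite E2, E3; ring. }
assert (exp (- x) * exp (- y) < 1).
{ assert (exp (- x) <= 1) by nra. assert (exp (- y) < 1) by nra. nra. }
nra.
Qed.

Lemma cosh_le x y : Rabs x <= Rabs y -> cosh x <= cosh y.
Proof.
intros [H|H]; [left; now apply cosh_lt|].
rewrite <- (cosh_Rabs x), <- (cosh_Rabs y), H; lra.
Qed.

Lemma cosh_ge_1 x : 1 <= cosh x.
Proof.
replace 1 with (cosh 0) by (unfold cosh; rewrite Ropp_0, exp_0; lra).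
apply cosh_le; rewrite Rabs_R0; apply Rabs_pos.
Qed.

Lemma cos_Rabs x : cos (Rabs x) = cos x.
Proof. unfold Rabs; destruct (Rcase_abs x); auto; apply cos_neg. Qed.

(** The bounds on the two arguments only give |2 Re arctan z| < pi. For |z| < 1 the level identity
    makes the cosine of 2 Re arctan z positive, which cuts this down to pi/2. *)
Lemma Carctan_strip z : Cmod z < 1 -> Rabs (Re (Carctan z)) < PI / 4.
Proof.
intros H; destruct (re_1_iz z H) as [H1 H2].
pose proof (Carg_bound _ H1) as B1; pose proof (Carg_bound _ H2) as B2.
apply Rabs_def2 in B1; apply Rabs_def2 in B2.
pose proof (Carctan_level z H) as L; pose proof (proj1 (Carctan_re_im z)) as E.
assert (B : Rabs (2 * Re (Carctan z)) < PI) by (apply Rabs_def1; lra).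
apply Rnot_le_lt; intros HB.
assert (HB2 : PI / 2 <= Rabs (2 * Re (Carctan z))).
{ rewrite Rabs_mult, (Rabs_right 2) by lra; lra. }
rewrite <- (cos_Rabs (2 * Re (Carctan z))) in L.
assert (cos (Rabs (2 * Re (Carctan z))) <= 0).
{ apply cos_le_0; lra. }
pose proof (cosh_pos (2 * Im (Carctan z))); pose proof (Cmod_ge_0 z).
assert (0 < 1 - Cmod z ^ 2) by nra. nra.
Qed.

Lemma level_mono x y : 0 <= x < 1 -> 0 <= y < 1 ->
  (1 - x ^ 2) * (1 + y ^ 2) <= (1 - y ^ 2) * (1 + x ^ 2) -> y <= x.
Proof. intros; apply Rnot_lt_le; intros Hl; nra. Qed.

(** Multiplication by k >= 1 increases cosh(2 Im) and decreases cos(2 Re), the latter because k |Re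
    arctan v| = |Re arctan w| is still below pi/4. Hence (1 - |w|^2)/(1 + |w|^2), the quotient of
    the two, is at most the same ratio for [v]. *)
Lemma Carctan_starlike w v k : Cmod w < 1 -> Cmod v < 1 -> 1 <= k ->
  Carctan w = (RtoC k * Carctan v)%C -> Cmod v <= Cmod w.
Proof.
intros Hw Hv Hk E.
pose proof (Carctan_level w Hw) as Lw; pose proof (Carctan_level v Hv) as Lv.
pose proof (Carctan_strip w Hw) as Sw.
rewrite E, re_scal_l, im_scal_l in *; rewrite <- ?Rmult_assoc in *.
set (a := Re (Carctan v)) in *; set (b := Im (Carctan v)) in *.
assert (C1 : cosh (2 * b) <= cosh (2 * (k * b))).
{ apply cosh_le; rewrite !Rabs_mult, (Rabs_right k) by lra.
  pose proof (Rabs_pos b); rewrite (Rabs_right 2) by lra; nra. }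
assert (C2 : cos (2 * (k * a)) <= cos (2 * a)).
{ rewrite <- (cos_Rabs (2 * a)), <- (cos_Rabs (2 * (k * a))).
  rewrite !Rabs_mult in *; rewrite (Rabs_right 2), (Rabs_right k) in * by lra.
  pose proof (Rabs_pos a); apply cos_decr_1; nra. }
pose proof (Cmod_ge_0 w); pose proof (Cmod_ge_0 v).
pose proof (cosh_pos (2 * b)).
apply level_mono; auto.
set (x := Cmod w) in *; set (y := Cmod v) in *.
assert (Px : 0 < 1 - x ^ 2) by nra; assert (Py : 0 < 1 - y ^ 2) by nra.
assert (cosh (2 * b) * (1 - x ^ 2) <= cos (2 * a) * (1 + x ^ 2)).
{ apply Rle_trans with (cosh (2 * (k * b)) * (1 - x ^ 2)); [nra|].
  replace (2 * (k * b)) with (2 * k * b) by ring; rewrite Lw.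
  replace (2 * k * a) with (2 * (k * a)) by ring; nra. }
apply Rmult_le_reg_l with (cosh (2 * b)); auto.
replace (cosh (2 * b) * ((1 - y ^ 2) * (1 + x ^ 2))) with (cosh (2 * b) * (1 - y ^ 2) * (1 + x ^ 2)) by ring.
rewrite Lv; nra.
Qed.

Lemma Carctan_real_im (x : R) : Im (Carctan x) = 0 /\ (0 <= x -> 0 <= Re (Carctan x)).
Proof.
destruct (Carctan_re_im x) as [E1 E2]; rewrite E1, E2.
assert (Q : Cmod (1 - Ci * x) = Cmod (1 + Ci * x)).
{ rewrite <- (Cmod_conj (1 - Ci * x)); f_equal; apply C_eq; simpl; ring. }
split; [rewrite Q; lra|intros Hx].
unfold Carg; rewrite Q.
replace (Im (1 - Ci * x)) with (- x) by (simpl; ring).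
replace (Im (1 + Ci * x)) with x by (simpl; ring).
replace (Re (1 - Ci * x)) with 1 by (simpl; ring).
replace (Re (1 + Ci * x)) with 1 by (simpl; ring).
rewrite Rdiv_opp_l, atan_opp.
assert (0 <= x / (Cmod (1 + Ci * x) + 1)).
{ apply Rdiv_le_0_compat; auto; pose proof (Cmod_ge_0 (1 + Ci * x)); lra. }
assert (0 <= atan (x / (Cmod (1 + Ci * x) + 1))).
{ rewrite <- atan_0; destruct H as [H|H]; [left; now apply atan_increasing|rewrite <- H; lra]. }
lra.
Qed.

Lemma Carctan_imag_re (x : R) : 0 <= x < 1 -> Re (Carctan (Ci * x)) = 0 /\ 0 <= Im (Carctan (Ci * x)).
Proof.
intros Hx; destruct (Carctan_re_im (Ci * x)) as [E1 E2]; rewrite E1, E2.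
replace (1 + Ci * (Ci * x))%C with (RtoC (1 - x)) by (apply C_eq; simpl; ring).
replace (1 - Ci * (Ci * x))%C with (RtoC (1 + x)) by (apply C_eq; simpl; ring).
unfold Carg; simpl; rewrite !Cmod_R, !Rabs_right by lra; split.
- unfold Rdiv; rewrite !Rmult_0_l, atan_0; ring.
- assert (ln (1 - x) <= ln (1 + x)); [|lra].
  destruct (Req_dec x 0) as [->|]; [rewrite Rminus_0_r, Rplus_0_r; lra|].
  left; apply ln_increasing; lra.
Qed.

(** Since cosh >= 1, the level identity gives cos(2 Re arctan z) >= (1 - |z|^2)/(1 + |z|^2), with
    equality on the real axis, and this ratio decreases in |z|. *)
Lemma Carctan_re_le z r : Cmod z <= r -> r < 1 -> Rabs (Re (Carctan z)) <= Re (Carctan r).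
Proof.
intros Hz Hr; pose proof (Cmod_ge_0 z) as P.
assert (Hz1 : Cmod z < 1) by lra.
assert (Hr1 : Cmod r < 1) by (rewrite Cmod_R, Rabs_right; lra).
destruct (Carctan_real_im r) as [I0 R0]; specialize (R0 ltac:(lra)).
pose proof (Carctan_level z Hz1) as Lz; pose proof (Carctan_level r Hr1) as Lr.
pose proof (Carctan_strip z Hz1) as Sz.
rewrite I0, Rmult_0_r, Cmod_R, Rabs_right in Lr by lra.
replace (cosh 0) with 1 in Lr by (unfold cosh; rewrite Ropp_0, exp_0; lra).
apply Rnot_lt_le; intros Hlt.
assert (Hc : cos (2 * Rabs (Re (Carctan z))) < cos (2 * Re (Carctan r))).
{ apply cos_decreasing_1; lra. }
replace (2 * Rabs (Re (Carctan z))) with (Rabs (2 * Re (Carctan z))) in Hc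
  by (rewrite Rabs_mult, (Rabs_right 2); lra).
rewrite cos_Rabs in Hc.
pose proof (cosh_ge_1 (2 * Im (Carctan z))) as Hch.
set (c := cos (2 * Re (Carctan z))) in *; set (d := cos (2 * Re (Carctan r))) in *.
set (m := Cmod z) in *.
assert (m ^ 2 <= r ^ 2) by nra.
assert (0 <= m ^ 2) by nra.
assert (r ^ 2 < 1) by nra.
assert (1 - m ^ 2 <= c * (1 + m ^ 2)) by nra.
set (M := m ^ 2) in *; set (S := r ^ 2) in *; clearbody c d M S.
assert ((1 - M) * (1 + S) <= c * (1 + M) * (1 + S)) by (apply Rmult_le_compat_r; lra).
assert (c * ((1 + M) * (1 + S)) < d * ((1 + M) * (1 + S))) by (apply Rmult_lt_compat_r; nra).
nra.
Qed.

(** The counterpart with cos <= 1: cosh(2 Im arctan z) <= (1 + |z|^2)/(1 - |z|^2), with equality on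
    the imaginary axis. *)
Lemma Carctan_im_le z r : Cmod z <= r -> r < 1 -> Rabs (Im (Carctan z)) <= Im (Carctan (Ci * r)).
Proof.
intros Hz Hr; pose proof (Cmod_ge_0 z) as P.
assert (Hz1 : Cmod z < 1) by lra.
assert (Hr0 : Cmod (Ci * r) = r) by (rewrite Cmod_mult, Cmod_Ci, Cmod_R, Rabs_right; lra).
assert (Hr1 : Cmod (Ci * r) < 1) by lra.
destruct (Carctan_imag_re r) as [R0 I0]; [lra|].
pose proof (Carctan_level z Hz1) as Lz; pose proof (Carctan_level _ Hr1) as Lr.
rewrite R0, Rmult_0_r, cos_0, Hr0 in Lr.
apply Rnot_lt_le; intros Hlt.
assert (Hc : cosh (2 * Im (Carctan (Ci * r))) < cosh (2 * Im (Carctan z))).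
{ apply cosh_lt; rewrite !Rabs_mult, (Rabs_right 2), (Rabs_right (Im (Carctan (Ci * r)))) by lra; lra. }
pose proof (COS_bound (2 * Re (Carctan z))) as [_ Hb].
set (c := cos (2 * Re (Carctan z))) in *.
set (A := cosh (2 * Im (Carctan z))) in *; set (B := cosh (2 * Im (Carctan (Ci * r)))) in *.
set (m := Cmod z) in *.
assert (m ^ 2 <= r ^ 2) by nra.
assert (A * (1 - m ^ 2) <= 1 + m ^ 2) by nra.
assert (0 < 1 - r ^ 2) by nra.
assert (0 < A) by apply cosh_pos. nra.
Qed.

(** Re(conj e a) runs through Re a, -Re a, Im a, -Im a: upper growth, lower growth, and the two
    signs of the argument. *)
Definition axis (e : C) : Prop := e = 1%C \/ e = (-1)%C \/ e = Ci \/ e = (- Ci)%C.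

Lemma Carctan_extremal e z r : axis e -> Cmod z <= r -> r < 1 ->
  Re (Cconj e * Carctan z) <= Re (Cconj e * Carctan (e * r)).
Proof.
intros He Hz Hr.
pose proof (Carctan_re_le z r Hz Hr) as A; pose proof (Carctan_im_le z r Hz Hr) as B.
apply Rabs_le_between in A; apply Rabs_le_between in B.
destruct He as [->|[->|[->| ->]]].
- rewrite Cmult_1_l; simpl; simpl in *; lra.
- replace (-1 * r)%C with (- (RtoC r))%C by (apply C_eq; simpl; ring).
  rewrite Carctan_opp; simpl in *; lra.
- simpl in *; lra.
- replace (- Ci * r)%C with (- (Ci * r))%C by ring.
  rewrite Carctan_opp; simpl in *; lra.
Qed.

(** * Derivatives and integrals along segments and rays *)

Lemma norm_C_R (x : C) : norm (V := C_R_NormedModule) x = Cmod x.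
Proof. symmetry; apply Cmod_norm. Qed.

Lemma rderiv_is_derive (g : R -> C) (s : R) (m : C) :
  rderiv g s m -> is_derive (V := C_R_NormedModule) g s m.
Proof.
intros [E [H1 [H2 H3]]]; split; [apply is_linear_scal_l|].
intros x Hx; assert (x = s) as -> .
{ symmetry; apply (is_filter_lim_locally_unique (V := AbsRing_NormedModule R_AbsRing)). exact Hx. }
intros eps; destruct (H1 eps (cond_pos eps)) as [d [D H]].
exists (mkposreal d D); intros t Ht.
change (Rabs (t - s) < d) in Ht.
change (norm (minus t s)) with (Rabs (t - s)).
change (norm (minus (minus (g t) (g s)) (scal (minus t s) m)))
  with (norm (V := C_R_NormedModule) (g t - g s - scal (V := C_R_NormedModule) (t - s)%R m)%C).
rewrite norm_C_R.
rewrite scal_R_Cmult, (H3 t).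
replace (g s + E t * RtoC (t - s) - g s - RtoC (t - s) * m)%C with ((E t - E s) * RtoC (t - s))%C
  by (rewrite H2; ring).
rewrite Cmod_mult, Cmod_R; apply Rmult_le_compat_r; [apply Rabs_pos|left; auto].
Qed.

Lemma is_derive_rderiv (g : R -> C) (s : R) (m : C) :
  is_derive (V := C_R_NormedModule) g s m -> rderiv g s m.
Proof.
intros [_ H]; specialize (H s (fun P HP => HP)).
exists (fun t => if Req_EM_T t s then m else (/ RtoC (t - s) * (g t - g s))%C).
destruct (Req_EM_T s s) as [_|n]; [|now destruct n]. repeat split.
- intros eps He; destruct (H (mkposreal (eps/2) ltac:(lra))) as [d Hd]; simpl in Hd.
  exists d; split; [apply cond_pos|]; intros t Ht.
  destruct (Req_EM_T s s) as [_|n]; [|now destruct n].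
  destruct (Req_EM_T t s) as [->|n].
  { replace (m - m)%C with (RtoC 0) by ring; now rewrite Cmod_0. }
  specialize (Hd t Ht).
  change (norm (minus t s)) with (Rabs (t - s)) in Hd.
  change (norm (minus (minus (g t) (g s)) (scal (minus t s) m)))
    with (norm (V := C_R_NormedModule) (g t - g s - scal (V := C_R_NormedModule) (t - s)%R m)%C) in Hd.
  rewrite norm_C_R in Hd.
  rewrite scal_R_Cmult in Hd.
  assert (P : 0 < Rabs (t - s)) by (apply Rabs_pos_lt; lra).
  assert (N : RtoC (t - s) <> 0%C) by (intros E; apply RtoC_inj in E; lra).
  replace (/ RtoC (t - s) * (g t - g s) - m)%C with
    ((g t - g s - RtoC (t - s) * m) / RtoC (t - s))%C by (field; auto).
  rewrite Cmod_div, Cmod_R by auto.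
  apply Rle_lt_trans with (eps / 2); [|lra].
  apply Rmult_le_reg_r with (Rabs (t - s)); auto.
  unfold Rdiv at 1; rewrite Rmult_assoc, Rinv_l by lra; lra.
- intros t; destruct (Req_EM_T t s) as [->|n].
  + replace (s - s) with 0 by ring; ring.
  + field; intros E; apply RtoC_inj in E; lra.
Qed.

Lemma rcont_continuous (g : R -> C) (s : R) : rcont g s -> continuous (U := C_R_NormedModule) g s.
Proof.
intros H P [e He]; destruct (H e (cond_pos e)) as [d [D Hd]].
exists (mkposreal d D); intros t Ht; apply He.
apply C_NormedModule_mixin_compat1, Hd, Ht.
Qed.

Lemma rcont_ray k z s : ccont k (RtoC s * z)%C -> rcont (fun t => k (RtoC t * z)%C) s.
Proof.
intros H; apply (rcont_comp k (fun t => RtoC t * z)%C); auto.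
apply rderiv_cont with z.
destruct (rderiv_affine 0 z s) as [E [H1 [H2 H3]]]; exists E; repeat split; auto.
intros t; specialize (H3 t); now rewrite !Cplus_0_l in H3.
Qed.

Lemma in_disk_ray z s : in_disk z -> 0 <= s <= 1 -> in_disk (RtoC s * z)%C.
Proof.
unfold in_disk; intros H Hs; rewrite Cmod_mult, Cmod_R, Rabs_right by lra.
pose proof (Cmod_ge_0 z); nra.
Qed.

Definition cont_on_disk (k : C -> C) : Prop := forall z, in_disk z -> ccont k z.

Lemma rcont_ray_disk k z s : cont_on_disk k -> in_disk (RtoC s * z)%C ->
  rcont (fun t => z * k (RtoC t * z))%C s.
Proof.
intros Hk Hz; apply rcont_mult; [apply rcont_const|].
apply rcont_ray; auto.
Qed.

Lemma is_RInt_Cint0 k z : cont_on_disk k -> in_disk z ->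
  is_RInt (V := C_R_NormedModule) (fun s => z * k (RtoC s * z))%C 0 1 (Cint0 k z).
Proof.
intros Hk Hz; apply (RInt_correct (V := C_R_CompleteNormedModule)).
apply (ex_RInt_continuous (V := C_R_CompleteNormedModule)); intros s Hs.
rewrite Rmin_left, Rmax_right in Hs by lra.
apply rcont_continuous, rcont_ray_disk; auto; now apply in_disk_ray.
Qed.

Lemma Cmod_RInt_le (phi : R -> C) I M :
  (forall s, 0 <= s <= 1 -> Cmod (phi s) <= M) ->
  is_RInt (V := C_R_NormedModule) phi 0 1 I -> Cmod I <= M.
Proof.
intros HM HI.
replace M with ((1 - 0) * M) by ring; rewrite <- norm_C_R.
refine (norm_RInt_le_const (V := C_R_NormedModule) phi 0 1 I M _ _ HI); [lra|intros s Hs; rewrite norm_C_R; auto].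
Qed.

(** The real mean value theorem is applied to real and imaginary parts separately, at different
    points, whence the factor 2. *)
Lemma cderiv_mvt_le (f df : C -> C) a b B :
  (forall t, 0 <= t <= 1 -> cderiv f (a + RtoC t * (b - a))%C (df (a + RtoC t * (b - a))%C)) ->
  (forall t, 0 <= t <= 1 -> Cmod (df (a + RtoC t * (b - a))%C) <= B) ->
  Cmod (f b - f a) <= 2 * B * Cmod (b - a).
Proof.
intros Hd HB.
set (g := fun t : R => f (a + RtoC t * (b - a))%C).
assert (Hg : forall t, 0 <= t <= 1 -> rderiv g t (df (a + RtoC t * (b - a)) * (b - a))%C).
{ intros t Ht; apply rderiv_comp; [apply rderiv_affine|auto]. }
assert (G0 : g 0 = f a) by (unfold g; f_equal; ring).
assert (G1 : g 1 = f b) by (unfold g; f_equal; ring).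
assert (Hbd : forall t, 0 <= t <= 1 -> Cmod (df (a + RtoC t * (b - a)) * (b - a))%C <= B * Cmod (b - a)).
{ intros t Ht; rewrite Cmod_mult; apply Rmult_le_compat_r; [apply Cmod_ge_0|auto]. }
destruct (MVT_gen (fun t => Re (g t)) 0 1 (fun t => Re (df (a + RtoC t * (b - a))%C * (b - a)))) as [c [Hc E1]].
{ intros x Hx; rewrite Rmin_left, Rmax_right in Hx by lra; apply rderiv_Re, Hg; lra. }
{ intros x Hx; rewrite Rmin_left, Rmax_right in Hx by lra.
  apply continuity_pt_filterlim, (ex_derive_continuous (K := R_AbsRing) (V := R_NormedModule)).
  eexists; apply rderiv_Re, Hg; lra. }
destruct (MVT_gen (fun t => Im (g t)) 0 1 (fun t => Im (df (a + RtoC t * (b - a))%C * (b - a)))) as [c' [Hc' E2]].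
{ intros x Hx; rewrite Rmin_left, Rmax_right in Hx by lra; apply rderiv_Im, Hg; lra. }
{ intros x Hx; rewrite Rmin_left, Rmax_right in Hx by lra.
  apply continuity_pt_filterlim, (ex_derive_continuous (K := R_AbsRing) (V := R_NormedModule)).
  eexists; apply rderiv_Im, Hg; lra. }
rewrite Rmin_left, Rmax_right in Hc, Hc' by lra.
rewrite <- G0, <- G1.
eapply Rle_trans; [apply Cmod_le_Re_Im|].
rewrite re_minus, im_minus, E1, E2.
replace (1 - 0) with 1 by ring; rewrite !Rmult_1_r.
pose proof (Rle_trans _ _ _ (re_le_Cmod _) (Hbd c Hc)).
pose proof (Rle_trans _ _ _ (im_le_Cmod _) (Hbd c' Hc')).
lra.
Qed.

(** For one real projection the mean value theorem loses nothing. With c = conj(b - a) it turns a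
    lower bound on the real part of the derivative into one on the increment. *)
Lemma re_increment_ge (f df : C -> C) a b (m : R) c :
  (forall t, 0 <= t <= 1 -> cderiv f (a + RtoC t * (b - a))%C (df (a + RtoC t * (b - a))%C)) ->
  (forall t, 0 <= t <= 1 -> m <= Re (c * (df (a + RtoC t * (b - a)) * (b - a)))%C) ->
  m <= Re (c * (f b - f a)).
Proof.
intros Hd HB.
set (g := fun t : R => (c * f (a + RtoC t * (b - a)))%C).
assert (Hg : forall t, 0 <= t <= 1 -> rderiv g t (c * (df (a + RtoC t * (b - a)) * (b - a)))%C).
{ intros t Ht; apply rderiv_scal, rderiv_comp; [apply rderiv_affine|auto]. }
assert (G : (c * (f b - f a) = g 1 - g 0)%C).
{ unfold g; replace (a + RtoC 1 * (b - a))%C with b by ring.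
  replace (a + RtoC 0 * (b - a))%C with a by ring; ring. }
destruct (MVT_gen (fun t => Re (g t)) 0 1 (fun t => Re (c * (df (a + RtoC t * (b - a))%C * (b - a))))) as [x [Hx E1]].
{ intros x Hx; rewrite Rmin_left, Rmax_right in Hx by lra; apply rderiv_Re, Hg; lra. }
{ intros x Hx; rewrite Rmin_left, Rmax_right in Hx by lra.
  apply continuity_pt_filterlim, (ex_derive_continuous (K := R_AbsRing) (V := R_NormedModule)).
  eexists; apply rderiv_Re, Hg; lra. }
rewrite Rmin_left, Rmax_right in Hx by lra.
rewrite G, re_minus, E1; specialize (HB x Hx); lra.
Qed.

(** * The function log (tau z / z) *)

(** With l = 1 this is [quot_id f] by conversion, so its lemmas cover f(z)/z and arctan(z)/z; other
    values of [l] serve arctan(w(z))/z and v(z)/z. *)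
Definition slope0 (f : C -> C) (l z : C) : C := if Ceq_dec z 0 then l else (f z / z)%C.

Lemma slope0_0 (f : C -> C) (l : C) : slope0 f l 0 = l.
Proof. unfold slope0; destruct (Ceq_dec 0 0) as [|n]; [auto|now destruct n]. Qed.

Lemma slope0_mul (f : C -> C) (l z : C) : f 0%C = 0%C -> (z * slope0 f l z)%C = f z.
Proof.
intros H; unfold slope0; destruct (Ceq_dec z 0) as [->|n]; [rewrite H; ring|field; auto].
Qed.

(** At 0 the slope function supplied by [cderiv] is the quotient itself; elsewhere it is an ordinary
    quotient. *)
Lemma slope0_ccont (f : C -> C) (l z : C) : f 0%C = 0%C -> cderiv f 0 l -> ccont f z ->
  ccont (slope0 f l) z.
Proof.
intros H0 Hd Hc; destruct (Ceq_dec z 0) as [->|n].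
- destruct Hd as [E [H1 [H2 H3]]].
  apply ccont_ext with E; auto; intros w; unfold slope0.
  destruct (Ceq_dec w 0) as [->|m]; auto.
  rewrite (H3 w), H0; field; auto.
- apply ccont_ext_loc with (fun w => f w * / w)%C (Cmod z); [now apply Cmod_gt_0| |].
  + intros w Hw; unfold slope0; destruct (Ceq_dec w 0) as [->|m]; [|reflexivity].
    replace (0 - z)%C with (- z)%C in Hw by ring; rewrite Cmod_opp in Hw; lra.
  + apply ccont_mult; [auto|apply ccont_inv; auto; apply ccont_id].
Qed.

Lemma slope0_cont (f : C -> C) (l : C) : f 0%C = 0%C -> cderiv f 0 l -> cont_on_disk f ->
  cont_on_disk (slope0 f l).
Proof. intros H0 Hd Hc z Hz; now apply slope0_ccont, Hc. Qed.

Definition arctanq : C -> C := quot_id Carctan.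

Lemma arctanq_mul z : (z * arctanq z)%C = Carctan z.
Proof. apply slope0_mul, Carctan_0. Qed.

Lemma in_disk_0 : in_disk 0.
Proof. unfold in_disk; rewrite Cmod_0; lra. Qed.

Lemma arctanq_0 : arctanq 0 = 1%C.
Proof. apply slope0_0. Qed.

Lemma arctanq_cont : cont_on_disk arctanq.
Proof.
apply slope0_cont; [apply Carctan_0| |].
- apply cderiv_eq with (/ (1 + 0 * 0))%C; [|apply cderiv_Carctan, in_disk_0].
  replace (1 + 0 * 0)%C with (RtoC 1) by ring; field; apply C1_nz.
- intros z Hz; eapply cderiv_cont, cderiv_Carctan, Hz.
Qed.

(** From |1 + u|^2 = 1 + 2 Re u + |u|^2 < 2 (1 + Re u). This is the origin of the bound 1/2 on Re
    H'. *)
Lemma re_inv_1_plus u : Cmod u < 1 -> / 2 <= Re (/ (1 + u)).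
Proof.
intros H; destruct u as [x y].
pose proof (Cmod2_alt (x, y)) as Q; simpl in Q.
pose proof (Cmod_ge_0 (x, y)) as P.
pose proof (re_le_Cmod (x, y)) as T; simpl in T.
assert (x * (x * 1) + y * (y * 1) < 1) by nra.
assert (Rabs x < 1) by lra; apply Rabs_def2 in H1.
simpl. replace (0 + y) with y by ring.
set (d := (1 + x) * ((1 + x) * 1) + y * (y * 1)).
assert (Hd : 0 < d) by (unfold d; nra).
apply Rmult_le_reg_r with (2 * d); [lra|].
replace ((1 + x) / d * (2 * d)) with (2 * (1 + x)) by (field; lra).
replace (/ 2 * (2 * d)) with d by field.
unfold d; nra.
Qed.

Lemma Cconj_mul_self z : (Cconj z * z)%C = RtoC (Cmod z ^ 2).
Proof. rewrite Cmod2_conj; ring. Qed.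

(** arctan(z)/z is the mean of 1/(1 + t^2 z^2) over 0 <= t <= 1, each value of which has real part
    at least 1/2; c = conj z in [re_increment_ge] produces the common factor |z|^2. *)
Lemma arctanq_re z : in_disk z -> / 2 <= Re (arctanq z).
Proof.
intros Hz; destruct (Ceq_dec z 0) as [->|n]; [rewrite arctanq_0; simpl; lra|].
assert (P : 0 < Cmod z) by (now apply Cmod_gt_0).
assert (Q : / 2 * Cmod z ^ 2 <= Re (Cconj z * (Carctan z - Carctan 0))).
{ apply re_increment_ge with (fun w => / (1 + w * w))%C.
  - intros t Ht; apply cderiv_Carctan.
    replace (0 + RtoC t * (z - 0))%C with (RtoC t * z)%C by ring; now apply in_disk_ray.
  - intros t Ht.
    replace (0 + RtoC t * (z - 0))%C with (RtoC t * z)%C by ring.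
    set (u := (RtoC t * z * (RtoC t * z))%C).
    replace (Cconj z * (/ (1 + u) * (z - 0)))%C with (RtoC (Cmod z ^ 2) * / (1 + u))%C
      by (rewrite <- Cconj_mul_self; ring).
    rewrite re_scal_l.
    assert (/ 2 <= Re (/ (1 + u))); [|nra].
    apply re_inv_1_plus; unfold u; rewrite Cmod_mult.
    pose proof (in_disk_ray z t Hz Ht) as Q; unfold in_disk in Q.
    pose proof (Cmod_ge_0 (RtoC t * z)); nra. }
rewrite Carctan_0, <- (arctanq_mul z) in Q.
replace (Cconj z * (z * arctanq z - 0))%C with (RtoC (Cmod z ^ 2) * arctanq z)%C in Q
  by (rewrite <- Cconj_mul_self; ring).
rewrite re_scal_l in Q.
apply Rmult_le_reg_l with (Cmod z ^ 2); [nra|lra].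
Qed.

Lemma arctanq_nz z : in_disk z -> arctanq z <> 0%C.
Proof. intros Hz; apply C_nz_re; pose proof (arctanq_re z Hz); lra. Qed.

Definition logtau : C -> C := Cint0 arctanq.

Lemma segment_disk a b t rho : Cmod a <= rho -> Cmod b <= rho -> 0 <= t <= 1 ->
  Cmod (a + RtoC t * (b - a)) <= rho.
Proof.
intros Ha Hb Ht.
replace (a + RtoC t * (b - a))%C with (RtoC (1 - t) * a + RtoC t * b)%C by (rewrite RtoC_minus; ring).
eapply Rle_trans; [apply Cmod_triangle|].
rewrite !Cmod_mult, !Cmod_R, !Rabs_right by lra; nra.
Qed.

Lemma Cmod_1_plus_sq z rho : Cmod z <= rho -> rho < 1 -> 1 - rho ^ 2 <= Cmod (1 + z * z).
Proof.
intros Hz Hr; pose proof (Cmod_tri_le 1 (1 + z * z)) as T.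
replace (1 - (1 + z * z))%C with (- (z * z))%C in T by ring.
rewrite Cmod_opp, Cmod_mult, Cmod_1 in T; pose proof (Cmod_ge_0 z); nra.
Qed.

(** Subtract the tangent at [a] and apply [cderiv_mvt_le]: what remains of the derivative is (a -
    w)(a + w)/((1 + w^2)(1 + a^2)). The 4 is the factor 2 of that lemma times |a + w| <= 2, and each
    denominator is at least 1 - rho^2. Uniformity in [a] and [b] is what [cderiv_logtau] uses. *)
Lemma Carctan_taylor a b rho : Cmod a <= rho -> Cmod b <= rho -> rho < 1 ->
  Cmod (Carctan b - Carctan a - (b - a) / (1 + a * a)) <=
    4 / (1 - rho ^ 2) ^ 2 * Cmod (b - a) ^ 2.
Proof.
intros Ha Hb Hr.
pose proof (Cmod_ge_0 a) as Pa; pose proof (Cmod_ge_0 (b - a)) as Pba.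
set (m := 1 - rho ^ 2); assert (Hm : 0 < m) by (unfold m; nra).
assert (Na : (1 + a * a)%C <> 0%C) by (apply sq1_nz; lra).
set (f := fun w => (Carctan w - / (1 + a * a) * w)%C).
assert (Q : Cmod (f b - f a) <= 2 * (2 / m ^ 2 * Cmod (b - a)) * Cmod (b - a)).
{ apply cderiv_mvt_le with (fun w => / (1 + w * w) - / (1 + a * a) * 1)%C.
  - intros t Ht; apply cderiv_minus; [|apply cderiv_scal, cderiv_id].
    apply cderiv_Carctan; pose proof (segment_disk a b t rho Ha Hb Ht); lra.
  - intros t Ht; pose proof (segment_disk a b t rho Ha Hb Ht) as Hw.
    set (w := (a + RtoC t * (b - a))%C) in *.
    assert (Nw : (1 + w * w)%C <> 0%C) by (apply sq1_nz; lra).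
    replace (/ (1 + w * w) - / (1 + a * a) * 1)%C with
      (- (RtoC t * (b - a)) * (a + w) / ((1 + w * w) * (1 + a * a)))%C
      by (replace (RtoC t * (b - a))%C with (w - a)%C by (unfold w; ring); field; auto).
    rewrite Cmod_div by (now apply Cmult_neq_0).
    rewrite !Cmod_mult, Cmod_opp, Cmod_mult, Cmod_R, Rabs_right by lra.
    pose proof (Cmod_1_plus_sq a rho Ha Hr) as Ba; pose proof (Cmod_1_plus_sq w rho Hw Hr) as Bw.
    fold m in Ba, Bw.
    pose proof (Cmod_triangle a w) as T; pose proof (Cmod_ge_0 (a + w)).
    apply Rmult_le_reg_r with (Cmod (1 + w * w) * Cmod (1 + a * a)); [nra|].
    unfold Rdiv at 1; rewrite Rmult_assoc, Rinv_l, Rmult_1_r by nra.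
    apply Rle_trans with (2 * Cmod (b - a)).
    + apply Rle_trans with (Cmod (b - a) * 2); [apply Rmult_le_compat; nra|lra].
    + apply Rle_trans with (2 / m ^ 2 * Cmod (b - a) * (m * m)).
      * right; field; lra.
      * apply Rmult_le_compat_l; [|nra].
        apply Rmult_le_pos; auto; apply Rdiv_le_0_compat; [lra|nra]. }
replace (Carctan b - Carctan a - (b - a) / (1 + a * a))%C with (f b - f a)%C
  by (unfold f; field; auto).
eapply Rle_trans; [exact Q|right]; field; lra.
Qed.

(** The integrand of [logtau] is arctan(s z)/s for s > 0, and 1/(1 + s^2 z^2) is its derivative in
    z: this evaluates the formal derivative under the integral sign. *)
Lemma logtau_kernel_int z h : in_disk z ->
  is_RInt (V := C_R_NormedModule) (fun s => h * / (1 + (RtoC s * z) * (RtoC s * z)))%C 0 1 (h * arctanq z)%C.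
Proof.
intros Hz.
(* Antiderivative in s; at z = 0 the kernel is the constant [h]. *)
set (F := fun s : R => (h * (if Ceq_dec z 0 then RtoC s else Carctan (RtoC s * z) / z))%C).
assert (E : minus (G := C_R_NormedModule) (F 1) (F 0) = (h * arctanq z)%C).
{ change (F 1 - F 0 = h * arctanq z)%C; unfold F, arctanq, quot_id; destruct (Ceq_dec z 0) as [_|n]; [ring|].
  replace (1 * z)%C with z by ring. replace (0 * z)%C with (RtoC 0) by ring.
  rewrite Carctan_0; field; auto. }
rewrite <- E.
apply (is_RInt_derive (V := C_R_CompleteNormedModule)); intros s Hs;
rewrite Rmin_left, Rmax_right in Hs by lra; pose proof (in_disk_ray z s Hz Hs) as Hd.
- apply rderiv_is_derive; unfold F; destruct (Ceq_dec z 0) as [->|n].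
  + replace (h * / (1 + RtoC s * 0 * (RtoC s * 0)))%C with (h * 1)%C
      by (replace (1 + RtoC s * 0 * (RtoC s * 0))%C with (RtoC 1) by ring; field; apply C1_nz).
    apply rderiv_scal.
    destruct (rderiv_affine 0 1 s) as [E' [H1 [H2 H3]]]; exists E'; repeat split; auto.
    intros t; specialize (H3 t); now rewrite !Cplus_0_l, !Cmult_1_r in H3.
  + apply rderiv_scal.
    replace (/ (1 + RtoC s * z * (RtoC s * z)))%C with
      (/ z * (/ (1 + RtoC s * z * (RtoC s * z)) * z))%C by (field; split; [now apply sq1_nz|auto]).
    assert (Q : rderiv (fun t => / z * Carctan (0 + RtoC t * z))%C s
       (/ z * (/ (1 + RtoC s * z * (RtoC s * z)) * z))%C).
    { apply rderiv_scal, rderiv_comp; [apply rderiv_affine|].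
      rewrite Cplus_0_l; now apply cderiv_Carctan. }
    destruct Q as [E' [H1 [H2 H3]]]; exists E'; repeat split; auto.
    intros t; specialize (H3 t); rewrite !Cplus_0_l in H3; unfold Cdiv.
    now rewrite !(Cmult_comm _ (/ z)).
- apply rcont_continuous, rcont_mult; [apply rcont_const|].
  apply (rcont_ray (fun w => / (1 + w * w))%C).
  apply ccont_inv; [|now apply sq1_nz].
  apply ccont_plus; [apply ccont_const|apply ccont_mult; apply ccont_id].
Qed.

(** Differentiation under the integral sign by hand: [Carctan_taylor] at s z and s w, divided by s,
    bounds the second-order error of the integrand by s K |w - z|^2, and s <= 1. *)
Lemma cderiv_logtau z : in_disk z -> cderiv logtau z (arctanq z).
Proof.
intros Hz; unfold in_disk in Hz; pose proof (Cmod_ge_0 z) as Pz.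
set (rho := (1 + Cmod z) / 2).
assert (Hr : rho < 1) by (unfold rho; lra); assert (Hzr : Cmod z < rho) by (unfold rho; lra).
set (K := 4 / (1 - rho ^ 2) ^ 2).
assert (Hr0 : 0 < rho) by (unfold rho; lra).
assert (HK : 0 < K) by (apply Rdiv_lt_0_compat; [lra|apply pow_lt; nra]).
assert (Key : forall w, Cmod w <= rho -> Cmod (logtau w - logtau z - arctanq z * (w - z)) <= K * Cmod (w - z) ^ 2).
{ intros w Hw.
  assert (Hw1 : in_disk w) by (unfold in_disk; lra).
  pose proof (is_RInt_Cint0 arctanq w arctanq_cont Hw1) as I1.
  pose proof (is_RInt_Cint0 arctanq z arctanq_cont Hz) as I2.
  pose proof (logtau_kernel_int z (w - z)%C Hz) as I3.
  pose proof (is_RInt_minus _ _ _ _ _ _ (is_RInt_minus _ _ _ _ _ _ I1 I2) I3) as I.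
  rewrite (Cmult_comm (arctanq z)).
  refine (Cmod_RInt_le _ _ _ _ I).
  intros s Hs.
  change (Cmod (w * arctanq (RtoC s * w) - z * arctanq (RtoC s * z)
     - (w - z) * / (1 + (RtoC s * z) * (RtoC s * z))) <= K * Cmod (w - z) ^ 2).
  (* The estimate divides by s; at s = 0 the integrand is linear in the point and the error is 0. *)
  destruct (Req_dec s 0) as [->|n].
  - replace (0 * w)%C with (RtoC 0) by ring. replace (0 * z)%C with (RtoC 0) by ring.
    rewrite arctanq_0. replace (w * 1 - z * 1 - (w - z) * / (1 + 0 * 0))%C with (RtoC 0).
    + rewrite Cmod_0; apply Rmult_le_pos; [lra|]. apply pow2_ge_0.
    + replace (1 + 0 * 0)%C with (RtoC 1) by ring; field; apply C1_nz.
  - assert (Hs0 : 0 < s) by lra.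
    assert (Ns : RtoC s <> 0%C) by (intros E; apply RtoC_inj in E; lra).
    assert (A : forall x, Cmod x <= rho -> Cmod (RtoC s * x) <= rho).
    { intros x Hx; rewrite Cmod_mult, Cmod_R, Rabs_right by lra; pose proof (Cmod_ge_0 x); nra. }
    pose proof (Carctan_taylor (RtoC s * z) (RtoC s * w) rho (A z ltac:(lra)) (A w Hw) Hr) as T.
    fold K in T; rewrite <- !arctanq_mul in T.
    assert (Nz : (1 + RtoC s * z * (RtoC s * z))%C <> 0%C) by (apply sq1_nz; pose proof (A z ltac:(lra)); lra).
    replace (RtoC s * w * arctanq (RtoC s * w) - RtoC s * z * arctanq (RtoC s * z) -
       (RtoC s * w - RtoC s * z) / (1 + RtoC s * z * (RtoC s * z)))%C
     with (RtoC s * (w * arctanq (RtoC s * w) - z * arctanq (RtoC s * z)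
     - (w - z) * / (1 + (RtoC s * z) * (RtoC s * z))))%C in T by (field; auto).
    replace (RtoC s * w - RtoC s * z)%C with (RtoC s * (w - z))%C in T by ring.
    rewrite !Cmod_mult, Cmod_R, Rabs_right in T by lra.
    set (X := Cmod (w * arctanq (RtoC s * w) - z * arctanq (RtoC s * z)
     - (w - z) * / (1 + (RtoC s * z) * (RtoC s * z)))) in *.
    apply Rmult_le_reg_l with s; auto.
    eapply Rle_trans; [exact T|].
    replace (K * (s * Cmod (w - z)) ^ 2) with (s * (s * (K * Cmod (w - z) ^ 2))) by ring.
    apply Rmult_le_compat_l; [lra|].
    assert (0 <= K * Cmod (w - z) ^ 2) by (apply Rmult_le_pos; [lra|apply pow2_ge_0]). nra. }
apply cderiv_quot; intros eps He.
exists (Rmin (rho - Cmod z) (eps / K)); split.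
{ apply Rmin_pos; [lra|apply Rdiv_lt_0_compat; lra]. }
intros w Hw.
assert (H1 := Rlt_le_trans _ _ _ Hw (Rmin_l _ _)).
assert (H2 := Rlt_le_trans _ _ _ Hw (Rmin_r _ _)).
eapply Rle_trans; [apply Key|].
- pose proof (Cmod_tri_le w z); lra.
- pose proof (Cmod_ge_0 (w - z)).
  assert (K * Cmod (w - z) <= eps).
  { apply Rmult_le_reg_r with (/ K); [now apply Rinv_0_lt_compat|].
    replace (K * Cmod (w - z) * / K) with (Cmod (w - z)) by (field; lra); unfold Rdiv in H2; lra. }
  simpl; nra.
Qed.

(** Quantitative Noshiro-Warschawski: the disk is convex, so Re H' >= 1/2 integrates along the
    segment from [a] to [b]. *)
Lemma logtau_expand a b : in_disk a -> in_disk b -> / 2 * Cmod (b - a) <= Cmod (logtau b - logtau a).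
Proof.
intros Ha Hb.
destruct (Ceq_dec b a) as [->|n].
{ replace (a - a)%C with (RtoC 0) by ring; rewrite Cmod_0; pose proof (Cmod_ge_0 (logtau a - logtau a)); lra. }
assert (P : 0 < Cmod (b - a)) by (apply Cmod_gt_0; now apply Cminus_eq_contra).
assert (S : forall t, 0 <= t <= 1 -> in_disk (a + RtoC t * (b - a))%C).
{ intros t Ht; unfold in_disk in *.
  pose proof (segment_disk a b t _ (Rmax_l (Cmod a) (Cmod b)) (Rmax_r (Cmod a) (Cmod b)) Ht).
  eapply Rle_lt_trans; [exact H|now apply Rmax_lub_lt]. }
assert (Q : / 2 * Cmod (b - a) ^ 2 <= Re (Cconj (b - a) * (logtau b - logtau a))).
{ apply re_increment_ge with arctanq.
  - intros t Ht; apply cderiv_logtau; auto.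
  - intros t Ht; specialize (S t Ht); set (w := (a + RtoC t * (b - a))%C) in *.
    replace (Cconj (b - a) * (arctanq w * (b - a)))%C with (RtoC (Cmod (b - a) ^ 2) * arctanq w)%C
      by (rewrite <- Cconj_mul_self; ring).
    rewrite re_scal_l; pose proof (arctanq_re w S); nra. }
pose proof (Rle_trans _ _ _ (Rle_abs _) (re_le_Cmod (Cconj (b - a) * (logtau b - logtau a)))) as T.
rewrite Cmod_mult, Cmod_conj in T.
apply Rmult_le_reg_l with (Cmod (b - a)); auto.
set (x := Cmod (b - a)) in *; nra.
Qed.

Lemma Cint0_0 k : Cint0 k 0 = 0%C.
Proof.
unfold Cint0; rewrite (RInt_ext (V := C_R_CompleteNormedModule) _ (fun _ => RtoC 0)).
- rewrite (RInt_const (V := C_R_CompleteNormedModule)).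
  apply (scal_zero_r (V := C_R_CompleteNormedModule)).
- intros; apply Cmult_0_l.
Qed.

(** * The function log (f z / z) *)

(** Tube argument: the gauge at s controls the parameter and [w] together, and [0, 1] is compact.
    Both terms of the difference are compared with one gauge centre, each within eps/2. *)
Lemma uniform_ray k z eps : cont_on_disk k -> in_disk z -> 0 < eps ->
  exists delta, 0 < delta /\ forall w, Cmod (w - z) < delta ->
    forall s, 0 <= s <= 1 -> Cmod (k (RtoC s * w)%C - k (RtoC s * z)%C) < eps.
Proof.
intros Hk Hz He.
pose proof (Cmod_ge_0 z) as Pz.
assert (Hd : forall s, exists d : posreal, 0 <= s <= 1 -> forall s' w,
   Rabs (s' - s) < d -> Cmod (w - z) < d -> Cmod (k (RtoC s' * w)%C - k (RtoC s * z)%C) < eps / 2).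
{ intros s; destruct (classic (0 <= s <= 1)) as [Hs|Hs].
  2: { exists (mkposreal 1 Rlt_0_1); intros; contradiction. }
  destruct (Hk _ (in_disk_ray z s Hz Hs) (eps/2)) as [d [D H]]; [lra|].
  (* |z| + 2 is the sum of |z| + 1, which bounds |w|, and 1, which bounds s. *)
  assert (Hp : 0 < Rmin 1 (d / (Cmod z + 2))) by (apply Rmin_pos; [lra|apply Rdiv_lt_0_compat; lra]).
  exists (mkposreal _ Hp); simpl; intros _ s' w H1 H2; apply H.
  pose proof (Rmin_l 1 (d / (Cmod z + 2))); pose proof (Rmin_r 1 (d / (Cmod z + 2))).
  set (m := Rmin 1 (d / (Cmod z + 2))) in *.
  replace (RtoC s' * w - RtoC s * z)%C with (RtoC (s' - s) * w + RtoC s * (w - z))%C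
    by (rewrite RtoC_minus; ring).
  eapply Rle_lt_trans; [apply Cmod_triangle|].
  rewrite !Cmod_mult, !Cmod_R, (Rabs_right s) by lra.
  assert (Hw : Cmod w <= Cmod z + 1) by (pose proof (Cmod_tri_le w z); lra).
  pose proof (Rabs_pos (s' - s)); pose proof (Cmod_ge_0 w); pose proof (Cmod_ge_0 (w - z)).
  apply Rlt_le_trans with (m * (Cmod z + 2)).
  - assert (Rabs (s' - s) * Cmod w <= m * (Cmod z + 1)) by (apply Rmult_le_compat; lra).
    assert (s * Cmod (w - z) <= 1 * Cmod (w - z)) by (apply Rmult_le_compat_r; lra). lra.
  - apply Rle_trans with (d / (Cmod z + 2) * (Cmod z + 2)); [apply Rmult_le_compat_r; lra|].
    right; field; lra. }
set (delta := fun s => proj1_sig (constructive_indefinite_description _ (Hd s))).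
destruct (compactness_value_1d 0 1 delta) as [d H].
exists d; split; [apply cond_pos|]; intros w Hw s Hs.
apply Rnot_le_lt; intros Hc; apply (H s Hs); intros [t [Ht [H1 H2]]].
pose proof (proj2_sig (constructive_indefinite_description _ (Hd t)) Ht) as Q.
fold (delta t) in Q.
pose proof (Q s w H1 (Rlt_le_trans _ _ _ Hw H2)) as Q1.
assert (Q2 : Cmod (k (RtoC s * z)%C - k (RtoC t * z)%C) < eps / 2).
{ apply Q; auto; replace (z - z)%C with (RtoC 0) by ring; rewrite Cmod_0; apply cond_pos. }
rewrite Cmod_minus_sym in Q2.
pose proof (Cmod_tri_minus (k (RtoC s * w)%C) (k (RtoC t * z)%C) (k (RtoC s * z)%C)); lra.
Qed.

Lemma Cint0_diff_le k z w M : cont_on_disk k -> in_disk z -> in_disk w ->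
  (forall s, 0 <= s <= 1 -> Cmod (w * k (RtoC s * w) - z * k (RtoC s * z))%C <= M) ->
  Cmod (Cint0 k w - Cint0 k z) <= M.
Proof.
intros Hk Hz Hw HM.
pose proof (is_RInt_minus _ _ _ _ _ _ (is_RInt_Cint0 k w Hk Hw) (is_RInt_Cint0 k z Hk Hz)) as I.
refine (Cmod_RInt_le _ _ _ _ I); exact HM.
Qed.

Lemma Cint0_cont k : cont_on_disk k -> cont_on_disk (Cint0 k).
Proof.
intros Hk z Hz eps He; unfold in_disk in Hz; pose proof (Cmod_ge_0 z) as Pz.
destruct (uniform_ray k z (eps/4) Hk Hz) as [d [D H]]; [lra|].
destruct (cont_on_ball_bounded (fun z => Cmod (k z)) (Cmod z)) as [B [HB0 HB]].
{ apply ccont_cont_on_ball; intros u Hu; apply Hk; unfold in_disk; lra. }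
exists (Rmin (Rmin d (1 - Cmod z)) (eps / (4 * B))); split.
{ repeat apply Rmin_pos; auto; [lra|apply Rdiv_lt_0_compat; lra]. }
intros w Hw.
assert (H1 := Rlt_le_trans _ _ _ Hw (Rmin_l _ _)).
assert (H2 := Rlt_le_trans _ _ _ Hw (Rmin_r _ _)).
assert (H3 := Rlt_le_trans _ _ _ H1 (Rmin_l _ _)).
assert (H4 := Rlt_le_trans _ _ _ H1 (Rmin_r _ _)).
assert (Hw1 : Cmod w < 1) by (pose proof (Cmod_tri_le w z); lra).
apply Rle_lt_trans with (eps / 2); [|lra].
apply Cint0_diff_le; auto; intros s Hs.
replace (w * k (RtoC s * w) - z * k (RtoC s * z))%C with
  (w * (k (RtoC s * w) - k (RtoC s * z)) + (w - z) * k (RtoC s * z))%C by ring.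
eapply Rle_trans; [apply Cmod_triangle|]; rewrite !Cmod_mult.
specialize (H w H3 s Hs).
assert (Hb : Cmod (k (RtoC s * z)%C) <= B).
{ apply HB; rewrite Cmod_mult, Cmod_R, Rabs_right by lra; nra. }
pose proof (Cmod_ge_0 w); pose proof (Cmod_ge_0 (k (RtoC s * w)%C - k (RtoC s * z)%C)).
pose proof (Cmod_ge_0 (w - z)); pose proof (Cmod_ge_0 (k (RtoC s * z)%C)).
assert (Cmod w * Cmod (k (RtoC s * w)%C - k (RtoC s * z)%C) <= 1 * (eps / 4)) by (apply Rmult_le_compat; lra).
assert (Cmod (w - z) * Cmod (k (RtoC s * z)%C) <= eps / (4 * B) * B) by (apply Rmult_le_compat; lra).
replace (eps / (4 * B) * B) with (eps / 4) in * by (field; lra). lra.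
Qed.

(** Every point near 0 is reached by its own ray, so continuity of [k] suffices: the error is the
    mean of (k(s w) - k(0)) w. *)
Lemma cderiv_Cint0_0 k : cont_on_disk k -> cderiv (Cint0 k) 0 (k 0%C).
Proof.
intros Hk; apply cderiv_quot; intros eps He.
destruct (Hk 0%C in_disk_0 eps He) as [d [D H]].
exists (Rmin d 1); split; [apply Rmin_pos; lra|]; intros w Hw.
assert (H1 := Rlt_le_trans _ _ _ Hw (Rmin_l _ _)).
assert (H2 := Rlt_le_trans _ _ _ Hw (Rmin_r _ _)).
rewrite Cint0_0; replace (w - 0)%C with w in * by ring.
replace (Cint0 k w - 0 - k 0%C * w)%C with (Cint0 k w - w * k 0%C)%C by ring.
assert (I0 : is_RInt (V := C_R_NormedModule) (fun _ => w * k 0%C)%C 0 1 (w * k 0%C)%C).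
{ pose proof (is_RInt_const (V := C_R_NormedModule) 0 1 (w * k 0%C)%C) as Q.
  rewrite Rminus_0_r in Q.
  change (scal (V := C_R_NormedModule) 1 (w * k 0%C)%C)
    with (scal (V := C_R_ModuleSpace) 1 (w * k 0%C)%C) in Q.
  now rewrite scal_R_Cmult, Cmult_1_l in Q. }
pose proof (is_RInt_minus _ _ _ _ _ _ (is_RInt_Cint0 k w Hk H2) I0) as I.
refine (Cmod_RInt_le _ _ _ _ I); intros s Hs.
change (Cmod (w * k (RtoC s * w) - w * k 0%C)%C <= eps * Cmod w).
replace (w * k (RtoC s * w) - w * k 0%C)%C with ((k (RtoC s * w) - k 0%C) * w)%C by ring.
rewrite Cmod_mult; apply Rmult_le_compat_r; [apply Cmod_ge_0|].
left; apply H; replace (RtoC s * w - 0)%C with (RtoC s * w)%C by ring.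
rewrite Cmod_mult, Cmod_R, Rabs_right by lra; pose proof (Cmod_ge_0 w); nra.
Qed.

Lemma rcont_continuity_Re g s : rcont g s -> continuity_pt (fun t => Re (g t)) s.
Proof.
intros H; apply continuity_pt_locally; intros eps; destruct (H eps (cond_pos eps)) as [d [D Hd]].
exists (mkposreal d D); intros t Ht; rewrite <- re_minus.
eapply Rle_lt_trans; [apply re_le_Cmod|apply Hd, Ht].
Qed.

Lemma rcont_continuity_Im g s : rcont g s -> continuity_pt (fun t => Im (g t)) s.
Proof.
intros H; apply continuity_pt_locally; intros eps; destruct (H eps (cond_pos eps)) as [d [D Hd]].
exists (mkposreal d D); intros t Ht; rewrite <- im_minus.
eapply Rle_lt_trans; [apply im_le_Cmod|apply Hd, Ht].
Qed.

Lemma rderiv_zero_const g a b : a < b -> (forall s, a <= s <= b -> rcont g s) ->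
  (forall s, a < s < b -> rderiv g s 0%C) -> g b = g a.
Proof.
intros Hab Hc Hd.
destruct (MVT_gen (fun t => Re (g t)) a b (fun _ => 0)) as [c [_ E1]].
{ intros x Hx; rewrite Rmin_left, Rmax_right in Hx by lra; apply (rderiv_Re g x 0%C), Hd; lra. }
{ intros x Hx; rewrite Rmin_left, Rmax_right in Hx by lra; apply rcont_continuity_Re, Hc; lra. }
destruct (MVT_gen (fun t => Im (g t)) a b (fun _ => 0)) as [c' [_ E2]].
{ intros x Hx; rewrite Rmin_left, Rmax_right in Hx by lra; apply (rderiv_Im g x 0%C), Hd; lra. }
{ intros x Hx; rewrite Rmin_left, Rmax_right in Hx by lra; apply rcont_continuity_Im, Hc; lra. }
apply C_eq; lra.
Qed.

Lemma rderiv_ext f g s m : (forall t, f t = g t) -> rderiv f s m -> rderiv g s m.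
Proof. intros E [F [H1 [H2 H3]]]; exists F; repeat split; auto; intros; rewrite <- !E; auto. Qed.

Lemma rderiv_eq f s l m : l = m -> rderiv f s l -> rderiv f s m.
Proof. now intros ->. Qed.

Lemma rderiv_ray f z s l : cderiv f (RtoC s * z)%C l ->
  rderiv (fun t => f (RtoC t * z)%C) s (l * z)%C.
Proof.
intros H; apply rderiv_ext with (fun t => f (0 + RtoC t * z)%C).
- intros t; now rewrite Cplus_0_l.
- apply rderiv_comp; [apply rderiv_affine|now rewrite Cplus_0_l].
Qed.

Lemma partial_integral_rderiv k z s : cont_on_disk k -> in_disk z -> 0 <= s <= 1 ->
  rderiv (fun b => RInt (V := C_R_CompleteNormedModule) (fun t => z * k (RtoC t * z))%C 0 b) s
    (z * k (RtoC s * z))%C.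
Proof.
intros Hk Hz Hs; pose proof (Cmod_ge_0 z) as Pz; unfold in_disk in Hz.
(* Two-sided derivatives at the ends of [0, 1] need room beyond it; |t| < 2 - |z| is enough since (2
   - |z|) |z| < 1. *)
assert (Hin : forall t, Rabs t < 2 - Cmod z -> in_disk (RtoC t * z)%C).
{ intros t Ht; unfold in_disk; rewrite Cmod_mult, Cmod_R; pose proof (Rabs_pos t); nra. }
assert (Hct : forall t, Rabs t < 2 - Cmod z ->
   continuous (U := C_R_NormedModule) (fun t => z * k (RtoC t * z))%C t).
{ intros t Ht; apply rcont_continuous, rcont_ray_disk; auto. }
apply is_derive_rderiv.
apply (is_derive_RInt (V := C_R_NormedModule) (fun t => z * k (RtoC t * z))%C _ 0).
- assert (D : 0 < 1 - Cmod z) by lra.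
  exists (mkposreal _ D); intros b Hb; change (Rabs (b - s) < 1 - Cmod z) in Hb.
  apply Rabs_def2 in Hb.
  apply (RInt_correct (V := C_R_CompleteNormedModule)).
  apply (ex_RInt_continuous (V := C_R_CompleteNormedModule)); intros t Ht.
  apply Hct.
  unfold Rmin, Rmax in Ht; destruct (Rle_dec 0 b); apply Rabs_def1; lra.
- apply Hct; rewrite Rabs_right; lra.
Qed.

(** Uniqueness for g' = k g along each ray: g(s z) exp(-Gam s) has derivative 0 for 0 < s < 1 and
    equals 1 at s = 0. At the origin continuity stands in for the equation, since f(z)/z is defined
    there by cases. *)
Lemma Cexp_Cint0 k g : cont_on_disk k -> ccont g 0 -> g 0%C = 1%C ->
  (forall z, in_disk z -> z <> 0%C -> cderiv g z (k z * g z)%C) ->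
  forall z, in_disk z -> Cexp (Cint0 k z) = g z.
Proof.
intros Hk Hg0 G0 Hg z Hz.
destruct (Ceq_dec z 0) as [->|n]; [now rewrite Cint0_0, Cexp_0, G0|].
set (Gam := fun b => RInt (V := C_R_CompleteNormedModule) (fun t => z * k (RtoC t * z))%C 0 b : C).
assert (HGam : forall s, 0 <= s <= 1 -> rderiv Gam s (z * k (RtoC s * z))%C)
  by (intros; now apply partial_integral_rderiv).
assert (HE : forall s, 0 <= s <= 1 ->
  rderiv (fun t => Cexp (- (1) * Gam t)) s (Cexp (- (1) * Gam s) * (- (1) * (z * k (RtoC s * z))))%C).
{ intros s Hs; apply (rderiv_comp Cexp (fun t => - (1) * Gam t)%C); [|apply cderiv_Cexp].
  now apply rderiv_scal, HGam. }
set (Phi := fun t => (g (RtoC t * z) * Cexp (- (1) * Gam t))%C).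
assert (E : Phi 1 = Phi 0).
{ apply rderiv_zero_const; [lra| |].
  - intros s Hs; apply rcont_mult; [|eapply rderiv_cont, HE; auto].
    apply rcont_ray.
    destruct (Ceq_dec (RtoC s * z)%C 0) as [->|m]; auto.
    eapply cderiv_cont, Hg; auto; now apply in_disk_ray.
  - intros s Hs.
    assert (Hd : in_disk (RtoC s * z)%C) by (apply in_disk_ray; auto; lra).
    assert (Hm : (RtoC s * z)%C <> 0%C).
    { apply Cmult_neq_0; auto; intros Q; apply RtoC_inj in Q; lra. }
    eapply rderiv_eq; [|apply rderiv_mult; [apply rderiv_ray, Hg; auto|apply HE; lra]].
    cbv beta; ring. }
unfold Phi in E.
replace (1 * z)%C with z in E by ring; replace (0 * z)%C with (RtoC 0) in E by ring.
assert (Z0 : Gam 0 = 0%C) by (unfold Gam; apply (RInt_point (V := C_R_CompleteNormedModule))).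
rewrite Z0, G0 in E; replace (- (1) * 0)%C with (RtoC 0) in E by ring; rewrite Cexp_0 in E.
replace (Cint0 k z) with (Gam 1) by reflexivity.
replace (- (1) * Gam 1)%C with (- Gam 1)%C in E by ring.
rewrite <- (Cmult_1_l (Cexp (Gam 1))).
replace (RtoC 1) with (g z * Cexp (- Gam 1))%C by (rewrite E; ring).
transitivity (g z * (Cexp (Gam 1) * Cexp (- Gam 1)))%C; [ring|].
rewrite Cexp_neg; ring.
Qed.

Lemma in_disk_near z w : in_disk z -> Cmod (w - z) < 1 - Cmod z -> in_disk w.
Proof. unfold in_disk; intros Hz Hw; pose proof (Cmod_tri_le w z); lra. Qed.

Lemma in_disk_open z : in_disk z -> 0 < 1 - Cmod z.
Proof. unfold in_disk; lra. Qed.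

(** The integral along rays of a merely continuous function need not be a primitive. Here its
    exponential is [g], differentiable and zero-free off 0, and [cderiv_lift] carries this back
    through exp; the origin is [cderiv_Cint0_0]. *)
Lemma cderiv_Cint0 k g : cont_on_disk k -> ccont g 0 -> g 0%C = 1%C ->
  (forall z, in_disk z -> z <> 0%C -> cderiv g z (k z * g z)%C) ->
  forall z, in_disk z -> cderiv (Cint0 k) z (k z).
Proof.
intros Hk Hg0 G0 Hg z Hz.
pose proof (Cexp_Cint0 k g Hk Hg0 G0 Hg) as HE.
destruct (Ceq_dec z 0) as [->|n]; [now apply cderiv_Cint0_0|].
apply cderiv_eq with ((k z * g z) / g z)%C.
- field; rewrite <- HE by auto; apply Cexp_neq_0.
- apply (cderiv_lift Cexp).
  + apply cderiv_ext_loc with g (1 - Cmod z); [now apply in_disk_open| |auto].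
    intros w Hw; symmetry; apply HE; eapply in_disk_near; eauto.
  + now apply Cint0_cont.
  + rewrite <- (HE z Hz) at 1; apply cderiv_Cexp.
  + rewrite <- HE by auto; apply Cexp_neq_0.
Qed.

(** * The class: behaviour at the origin and the logarithm of f(z)/z *)

Lemma Cmod_pow_n (z : C) n : Cmod (pow_n (K := C_Ring) z n) = Cmod z ^ n.
Proof.
induction n as [|n IH]; [apply Cmod_1|].
change (pow_n (K := C_Ring) z (S n)) with (z * pow_n (K := C_Ring) z n)%C.
now rewrite Cmod_mult, IH.
Qed.

Lemma bounded_of_eventually (u : nat -> R) N B :
  (forall n, (N <= n)%nat -> u n <= B) -> exists M, forall n, u n <= M.
Proof.
revert B; induction N as [|N IH]; intros B H.
- exists B; intros n; apply H; lia.
- apply (IH (Rmax B (u N))); intros n Hn.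
  destruct (Nat.eq_dec n N) as [->|]; [apply Rmax_r|].
  eapply Rle_trans; [apply H; lia|apply Rmax_l].
Qed.

Lemma is_series_C_lim (u : nat -> C) l : is_series (K := C_AbsRing) (V := C_NormedModule) u l ->
  forall eps, 0 < eps -> exists N, forall n, (N <= n)%nat -> Cmod (sum_n (G := C_AbelianGroup) u n - l)%C < eps.
Proof.
intros H eps He.
pose proof (proj1 (filterlim_locally_ball_norm (K := C_AbsRing) (U := C_NormedModule) _ _) H (mkposreal eps He)) as [N HN].
exists N; intros n Hn; exact (HN n Hn).
Qed.

Lemma series_terms_bounded (u : nat -> C) l :
  is_series (K := C_AbsRing) (V := C_NormedModule) u l -> exists M, forall n, Cmod (u n) <= M.
Proof.
intros H; destruct (is_series_C_lim u l H 1) as [N HN]; [lra|].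
apply (bounded_of_eventually (fun n => Cmod (u n)) (S N) 2); intros n Hn.
destruct n as [|n]; [lia|].
pose proof (HN (S n) ltac:(lia)) as H1; pose proof (HN n ltac:(lia)) as H2.
rewrite sum_Sn in H1.
change (plus (sum_n (G := C_AbelianGroup) u n) (u (S n))) with (sum_n (G := C_AbelianGroup) u n + u (S n))%C in H1.
set (S0 := sum_n (G := C_AbelianGroup) u n) in *.
replace (u (S n)) with ((S0 + u (S n) - l) - (S0 - l))%C by ring.
eapply Rle_trans; [apply Cmod_triangle|]; rewrite Cmod_opp; lra.
Qed.

(** Convergence at 1/2 bounds the terms there, so |a_n| <= M 2^n. For |z| <= 1/4 the tail from n = 2
    is at most M |2z|^2 (1 + 1/2 + ...) = 8 M |z|^2. This yields f(0) = 0 and f'(0) = 1 through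
    [cderiv_quadratic]. *)
Lemma pseries_remainder (a : nat -> C) (f : C -> C) : a 0%nat = 0%C -> a 1%nat = 1%C ->
  (forall z, in_disk z -> is_pseries (K := C_AbsRing) (V := C_NormedModule) a z (f z)) ->
  exists B, 0 < B /\ forall z, Cmod z <= / 4 -> Cmod (f z - z) <= B * Cmod z ^ 2.
Proof.
intros A0 A1 Hs.
assert (Hh : in_disk (RtoC (/ 2))) by (unfold in_disk; rewrite Cmod_R, Rabs_right; lra).
destruct (series_terms_bounded _ _ (Hs _ Hh)) as [M HM].
assert (Ha : forall n, Cmod (a n) * (/ 2) ^ n <= M).
{ intros n; specialize (HM n).
  change (scal (pow_n (K := C_Ring) (RtoC (/ 2)) n) (a n)) with (pow_n (K := C_Ring) (RtoC (/ 2)) n * a n)%C in HM.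
  rewrite Cmod_mult, Cmod_pow_n, Cmod_R, Rabs_right in HM by lra; lra. }
assert (M0 : 0 <= M) by (specialize (Ha 0%nat); simpl in Ha; pose proof (Cmod_ge_0 (a 0%nat)); lra).
(* The extra 1 keeps the constant positive when M = 0. *)
exists (8 * M + 1); split; [lra|]; intros z Hz.
pose proof (Cmod_ge_0 z) as Pz.
assert (Hz1 : in_disk z) by (unfold in_disk; lra).
set (u := fun n => scal (V := C_NormedModule) (pow_n (K := C_Ring) z n) (a n)).
assert (Hu : forall n, Cmod (u n) <= M * (2 * Cmod z) ^ n).
{ intros n; unfold u.
  change (scal (pow_n (K := C_Ring) z n) (a n)) with (pow_n (K := C_Ring) z n * a n)%C.
  rewrite Cmod_mult, Cmod_pow_n.
  replace (Cmod z ^ n * Cmod (a n)) with ((Cmod (a n) * (/ 2) ^ n) * (2 * Cmod z) ^ n).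
  - apply Rmult_le_compat_r; [apply pow_le; lra|apply Ha].
  - rewrite Rpow_mult_distr, pow_inv; field; apply pow_nonzero; lra. }
(* The induction starts at the partial sum a_0 + a_1 z, which is exactly z; the factor 1 - (1/2)^n
   is the finite geometric sum. *)
assert (HS : forall n, Cmod (sum_n (G := C_AbelianGroup) u (S n) - z)%C <=
   8 * M * Cmod z ^ 2 * (1 - (/ 2) ^ n)).
{ induction n as [|n IH].
  - rewrite sum_Sn, sum_O.
    change (plus (u 0%nat) (u 1%nat)) with (1 * a 0%nat + (z * 1) * a 1%nat)%C.
    rewrite A0, A1; replace (1 * 0 + z * 1 * 1 - z)%C with (RtoC 0) by ring.
    rewrite Cmod_0; simpl; lra.
  - rewrite sum_Sn.
    change (plus (sum_n (G := C_AbelianGroup) u (S n)) (u (S (S n))))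
      with (sum_n (G := C_AbelianGroup) u (S n) + u (S (S n)))%C.
    set (S0 := sum_n (G := C_AbelianGroup) u (S n)) in *.
    replace (S0 + u (S (S n)) - z)%C with ((S0 - z) + u (S (S n)))%C by ring.
    eapply Rle_trans; [apply Cmod_triangle|].
    assert (Hn : (2 * Cmod z) ^ n <= (/ 2) ^ n) by (apply pow_incr; lra).
    specialize (Hu (S (S n))).
    replace ((2 * Cmod z) ^ S (S n)) with (4 * Cmod z ^ 2 * (2 * Cmod z) ^ n) in Hu by (simpl; ring).
    assert (M * (4 * Cmod z ^ 2 * (2 * Cmod z) ^ n) <= M * (4 * Cmod z ^ 2 * (/ 2) ^ n)).
    { apply Rmult_le_compat_l; auto; apply Rmult_le_compat_l; auto; pose proof (pow2_ge_0 (Cmod z)); lra. }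
    replace ((/ 2) ^ S n) with (/ 2 * (/ 2) ^ n) by reflexivity. lra. }
apply Rnot_lt_le; intros Hlt.
set (Bz := (8 * M + 1) * Cmod z ^ 2) in *.
destruct (is_series_C_lim u (f z) (Hs z Hz1) (Cmod (f z - z) - Bz)) as [N HN]; [lra|].
specialize (HN (S N) ltac:(lia)); specialize (HS N).
rewrite Cmod_minus_sym in HN.
set (S0 := sum_n (G := C_AbelianGroup) u (S N)) in *.
pose proof (Cmod_tri_minus (f z) S0 z) as T.
assert (8 * M * Cmod z ^ 2 * (1 - (/ 2) ^ N) <= Bz); [|lra].
assert (0 <= (/ 2) ^ N) by (apply pow_le; lra).
pose proof (pow2_ge_0 (Cmod z)).
assert (0 <= M * Cmod z ^ 2) by (apply Rmult_le_pos; auto).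
unfold Bz; nra.
Qed.

Lemma cderiv_quadratic (f : C -> C) B r : 0 < B -> 0 < r ->
  (forall z, Cmod z <= r -> Cmod (f z - z) <= B * Cmod z ^ 2) -> f 0%C = 0%C /\ cderiv f 0 1.
Proof.
intros HB Hr H.
assert (F0 : f 0%C = 0%C).
{ specialize (H 0%C); rewrite Cmod_0 in H; specialize (H ltac:(lra)).
  apply Cmod_eq_0; replace (f 0%C - 0)%C with (f 0%C) in H by ring.
  pose proof (Cmod_ge_0 (f 0%C)); simpl in H; lra. }
split; auto; apply cderiv_quot; intros eps He.
exists (Rmin r (eps / B)); split; [apply Rmin_pos; auto; now apply Rdiv_lt_0_compat|].
intros w Hw; replace (w - 0)%C with w in * by ring.
assert (H1 := Rlt_le_trans _ _ _ Hw (Rmin_l _ _)).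
assert (H2 := Rlt_le_trans _ _ _ Hw (Rmin_r _ _)).
rewrite F0; replace (f w - 0 - 1 * w)%C with (f w - w)%C by ring.
eapply Rle_trans; [apply H; lra|].
pose proof (Cmod_ge_0 w).
assert (B * Cmod w <= eps).
{ apply Rle_trans with (B * (eps / B)); [apply Rmult_le_compat_l; lra|right; field; lra]. }
simpl; nra.
Qed.

Lemma Cinv_0 : (/ 0)%C = 0%C.
Proof. unfold Cinv; apply C_eq; simpl; unfold Rdiv; ring. Qed.

Lemma schwarz_slope_0 w l : cderiv w 0 l -> w 0%C = 0%C ->
  (forall z, in_disk z -> Cmod (w z) <= Cmod z) -> Cmod l <= 1.
Proof.
intros Hd W0 Hw; apply Rnot_lt_le; intros Hl.
destruct (proj1 (cderiv_quot _ _ _) Hd ((Cmod l - 1) / 2)) as [d [D H]]; [lra|].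
assert (Hm : 0 < Rmin d 1) by (apply Rmin_pos; lra).
set (t := Rmin d 1 / 2); pose proof (Rmin_l d 1); pose proof (Rmin_r d 1).
assert (Ct : Cmod (RtoC t) = t) by (rewrite Cmod_R, Rabs_right; unfold t; lra).
specialize (H (RtoC t)); specialize (Hw (RtoC t)).
replace (RtoC t - 0)%C with (RtoC t) in H by ring.
unfold in_disk in Hw; rewrite Ct in *.
specialize (H ltac:(unfold t; lra)); specialize (Hw ltac:(unfold t; lra)).
rewrite W0 in H.
pose proof (Cmod_tri_le (l * RtoC t) (w (RtoC t))) as T.
rewrite Cmod_mult, Ct in T.
replace (l * RtoC t - w (RtoC t))%C with (- (w (RtoC t) - 0 - l * RtoC t))%C in T by ring.
rewrite Cmod_opp in T.
assert (0 < t) by (unfold t; lra). nra.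
Qed.

(* For f in the class, G = Cint0 k is log (f z / z) and z G'(z) = arctan (w z). *)
Definition dominated (k w : C -> C) : Prop :=
  (forall z, in_disk z -> Cmod (w z) <= Cmod z) /\
  cont_on_disk k /\ (forall z, (z * k z)%C = Carctan (w z)) /\ Cmod (k 0%C) <= 1 /\
  (forall z, in_disk z -> cderiv (Cint0 k) z (k z)).

Lemma ex_derive_cderiv f z :
  ex_derive (K := C_AbsRing) (V := C_NormedModule) f z -> cderiv f z (C_derive f z).
Proof. intros H; apply cderiv_iff, C_derive_correct; auto; exact 0%C. Qed.

Lemma Stau_dominated f : class_Stau f -> exists k w, dominated k w /\
  forall z, in_disk z -> f z = (z * Cexp (Cint0 k z))%C.
Proof.
intros [[Han [a [A0 [A1 Hs]]]] [w [Wan [W0 [Win [Wle Wf]]]]]].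
destruct (pseries_remainder a f A0 A1 Hs) as [B [HB Hq]].
destruct (cderiv_quadratic f B (/ 4) HB ltac:(lra) Hq) as [F0 Fd0].
set (A := fun z => Carctan (w z)).
assert (Aan : forall z, in_disk z -> cderiv A z (/ (1 + w z * w z) * C_derive w z)%C).
{ intros z Hz; apply (cderiv_comp Carctan w); [now apply ex_derive_cderiv, Wan|].
  now apply cderiv_Carctan, Win. }
assert (A00 : A 0%C = 0%C) by (unfold A; rewrite W0; apply Carctan_0).
assert (Ad0 : cderiv A 0 (C_derive w 0)).
{ apply cderiv_eq with (/ (1 + w 0%C * w 0%C) * C_derive w 0)%C; [|apply Aan, in_disk_0].
  rewrite W0; replace (1 + 0 * 0)%C with (RtoC 1) by ring; field; apply C1_nz. }
assert (Acont : cont_on_disk A) by (intros z Hz; eapply cderiv_cont, Aan, Hz).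
assert (Fcont : cont_on_disk f) by (intros z Hz; eapply cderiv_cont, ex_derive_cderiv, Han, Hz).
set (k := slope0 A (C_derive w 0)).
assert (Hk : cont_on_disk k) by (now apply slope0_cont).
assert (Hkm : forall z, (z * k z)%C = A z) by (intros; now apply slope0_mul).
(* At a zero of [f] the total division makes the left side 0, whereas 1 + arctan w has real part
   above 1 - pi/4. *)
assert (Fnz : forall z, in_disk z -> z <> 0%C -> f z <> 0%C).
{ intros z Hz n E; specialize (Wf z Hz); unfold log_deriv_quot in Wf.
  destruct (Ceq_dec z 0) as [|_]; [contradiction|].
  rewrite E in Wf; unfold Cdiv in Wf; rewrite Cinv_0, Cmult_0_r in Wf.
  pose proof (Carctan_strip (w z) (Win z Hz)) as S; apply Rabs_def2 in S.
  assert (Q : Re 0 = Re (1 + Carctan (w z))) by (now rewrite Wf).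
  rewrite re_plus, !re_RtoC in Q; pose proof PI_4; lra. }
assert (Hg : forall z, in_disk z -> z <> 0%C -> cderiv (quot_id f) z (k z * quot_id f z)%C).
{ intros z Hz n.
  assert (Dq : (C_derive f z = f z * (1 + A z) / z)%C).
  { specialize (Wf z Hz); unfold log_deriv_quot in Wf.
    destruct (Ceq_dec z 0) as [|_]; [contradiction|].
    fold (A z) in Wf; rewrite <- Wf; field; split; auto. }
  apply cderiv_ext_loc with (fun u => f u / u)%C (Cmod z); [now apply Cmod_gt_0| |].
  - intros u Hu; unfold quot_id; destruct (Ceq_dec u 0) as [->|]; auto.
    replace (0 - z)%C with (- z)%C in Hu by ring; rewrite Cmod_opp in Hu; lra.
  - eapply cderiv_eq; [|apply cderiv_div; [apply ex_derive_cderiv, Han, Hz|apply cderiv_id|auto]].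
    unfold quot_id; destruct (Ceq_dec z 0) as [|_]; [contradiction|].
    rewrite Dq, <- Hkm; field; auto. }
assert (Hg0 : ccont (quot_id f) 0).
{ apply (slope0_cont f 1 F0 Fd0 Fcont), in_disk_0. }
assert (Q0 : quot_id f 0 = 1%C) by apply slope0_0.
exists k, w; repeat split; auto.
- unfold k; rewrite slope0_0.
  apply (schwarz_slope_0 w); auto; apply ex_derive_cderiv, Wan, in_disk_0.
- now apply (cderiv_Cint0 k (quot_id f)).
- intros z Hz; rewrite (Cexp_Cint0 k (quot_id f)) by auto.
  symmetry; apply (slope0_mul f 1); auto.
Qed.

(** * First-order conditions for minima of a modulus *)

Lemma Re_Cconj_neg (a l : C) : a <> 0%C -> l <> 0%C ->
  Re (Cconj a * l * - (a * Cconj l)) < 0.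
Proof.
intros Ha Hl.
replace (Cconj a * l * - (a * Cconj l))%C with (- ((Cconj a * a) * (Cconj l * l)))%C by ring.
rewrite !Cconj_mul_self, <- RtoC_mult, re_opp, re_RtoC.
apply Cmod_gt_0 in Ha; apply Cmod_gt_0 in Hl.
assert (0 < Cmod a ^ 2) by nra. assert (0 < Cmod l ^ 2) by nra. nra.
Qed.

(** A nonzero value would decrease in modulus along -phi(z) conj(l), the direction of steepest
    descent, and a short step stays in the disk. *)
Lemma interior_min_zero phi z l r : cderiv phi z l -> l <> 0%C -> Cmod z < r ->
  (forall w, Cmod w <= r -> Cmod (phi z) <= Cmod (phi w)) -> phi z = 0%C.
Proof.
intros Hd Hl Hz Hm; destruct (Ceq_dec (phi z) 0) as [|n]; auto; exfalso.
set (e := (- (phi z * Cconj l))%C).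
destruct (Cmod_decrease phi z l e Hd (Re_Cconj_neg _ _ n Hl)) as [d [D H]].
pose proof (Cmod_ge_0 e) as Pe.
set (t := Rmin (d / 2) ((r - Cmod z) / (Cmod e + 1))).
assert (Ht : 0 < t) by (apply Rmin_pos; [lra|apply Rdiv_lt_0_compat; lra]).
assert (Ht1 : t <= d / 2) by apply Rmin_l.
assert (Ht2 : t <= (r - Cmod z) / (Cmod e + 1)) by apply Rmin_r.
specialize (H t ltac:(lra)).
apply (Rlt_not_le _ _ H), Hm.
eapply Rle_trans; [apply Cmod_triangle|]; rewrite Cmod_mult, Cmod_R, Rabs_right by lra.
assert (t * (Cmod e + 1) <= r - Cmod z); [|nra].
apply Rle_trans with ((r - Cmod z) / (Cmod e + 1) * (Cmod e + 1)).
- apply Rmult_le_compat_r; lra.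
- right; field; lra.
Qed.

(** Along the directions -1 - is the hypothesis says that -Re L + s Im L is nonnegative for all real
    s, so its slope Im L is 0. *)
Lemma half_plane_dual (L : C) : (forall e, Re e < 0 -> 0 <= Re (L * e)) -> Im L = 0 /\ Re L <= 0.
Proof.
intros H; destruct L as [x y]; simpl.
assert (H1 : forall s, 0 <= - x + y * s).
{ intros s; specialize (H ((-1), - s)); simpl in H; specialize (H ltac:(lra)); lra. }
destruct (Req_dec y 0) as [->|n].
- split; auto; specialize (H1 0); lra.
- exfalso; specialize (H1 ((x - 1) / y)); replace (- x + y * ((x - 1) / y)) with (-1) in H1 by (field; auto); lra.
Qed.

(* First-order condition for a minimum of |phi| relative to a disk, valid also
   at boundary points: inward directions z e (Re e < 0) cannot decrease |phi|. *)
Lemma disk_min_condition phi z l r d : 0 < d -> cderiv phi z l -> z <> 0%C -> Cmod z <= r ->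
  (forall w, Cmod w <= r -> Cmod (w - z) < d -> Cmod (phi z) <= Cmod (phi w)) ->
  Im (Cconj (phi z) * l * z) = 0 /\ Re (Cconj (phi z) * l * z) <= 0.
Proof.
intros Hd0 Hd Hn Hz Hm; apply half_plane_dual; intros e He.
apply Rnot_lt_le; intros Hlt.
replace (Cconj (phi z) * l * z * e)%C with (Cconj (phi z) * l * (z * e))%C in Hlt by ring.
destruct (Cmod_decrease phi z l _ Hd Hlt) as [d' [D' H]].
pose proof (Cmod_ge_0 (z * e)) as Pe.
assert (Pz : 0 < Cmod z) by (now apply Cmod_gt_0).
assert (Ee : 0 < Cmod e ^ 2).
{ assert (0 < Cmod e); [|nra]. apply Cmod_gt_0; intros ->; simpl in He; lra. }
(* The three bounds serve the decrease of |phi|, nearness to [z], and membership in the disk through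
   |1 + t e|^2 = 1 + 2 t Re e + t^2 |e|^2 <= 1. *)
set (t := Rmin (Rmin (d' / 2) (d / 2 / (Cmod (z * e) + 1))) (- Re e / Cmod e ^ 2)).
assert (Ht : 0 < t).
{ repeat apply Rmin_pos; [lra| |]; apply Rdiv_lt_0_compat; lra. }
assert (Ht1 : t <= d' / 2) by (eapply Rle_trans; [apply Rmin_l|apply Rmin_l]).
assert (Ht2 : t <= d / 2 / (Cmod (z * e) + 1)) by (eapply Rle_trans; [apply Rmin_l|apply Rmin_r]).
assert (Ht3 : t <= - Re e / Cmod e ^ 2) by apply Rmin_r.
specialize (H t ltac:(lra)).
apply (Rlt_not_le _ _ H), Hm.
- replace (z + RtoC t * (z * e))%C with (z * (1 + RtoC t * e))%C by ring.
  rewrite Cmod_mult.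
  assert (Cmod (1 + RtoC t * e) <= 1); [|nra].
  assert (Q : Cmod (1 + RtoC t * e) ^ 2 = 1 + 2 * t * Re e + t ^ 2 * Cmod e ^ 2).
  { rewrite !Cmod2_alt; destruct e as [x y]; simpl; ring. }
  assert (t * Cmod e ^ 2 <= - Re e).
  { apply Rle_trans with (- Re e / Cmod e ^ 2 * Cmod e ^ 2); [apply Rmult_le_compat_r; lra|].
    right; unfold Rdiv; rewrite Rmult_assoc, Rinv_l by lra; ring. }
  pose proof (Cmod_ge_0 (1 + RtoC t * e)). nra.
- replace (z + RtoC t * (z * e) - z)%C with (RtoC t * (z * e))%C by ring.
  rewrite Cmod_mult, Cmod_R, Rabs_right by lra.
  assert (t * (Cmod (z * e) + 1) <= d / 2); [|nra].
  apply Rle_trans with (d / 2 / (Cmod (z * e) + 1) * (Cmod (z * e) + 1)).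
  + apply Rmult_le_compat_r; lra.
  + right; field; lra.
Qed.

Lemma logtau_cont : cont_on_disk logtau.
Proof. intros z Hz; eapply cderiv_cont, cderiv_logtau, Hz. Qed.

Lemma logtau_0 : logtau 0 = 0%C.
Proof. apply Cint0_0. Qed.

(** * Subordination of log (f z / z) to log (tau z / z) *)

Lemma logtau_inj a b : in_disk a -> in_disk b -> logtau a = logtau b -> a = b.
Proof.
intros Ha Hb E; pose proof (logtau_expand b a Hb Ha) as Q.
rewrite E in Q; replace (logtau b - logtau b)%C with (RtoC 0) in Q by ring; rewrite Cmod_0 in Q.
apply Ceq_minus, Cmod_eq_0; pose proof (Cmod_ge_0 (a - b)); lra.
Qed.

(** Minimize |H(x + u) - y| over |u| <= delta. On the rim the expansion factor 1/2 puts H at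
    distance at least delta/2 from H(x), hence farther than delta/4 from [y], while the centre is
    closer than that. So the minimum is interior, and therefore 0 as H' has no zero. *)
Lemma logtau_open x y delta : 0 < delta -> Cmod x + delta < 1 ->
  Cmod (y - logtau x) < delta / 4 -> exists z, in_disk z /\ logtau z = y.
Proof.
intros Hd Hx Hy.
set (phi := fun u => (logtau (x + u) - y)%C).
assert (Hin : forall u, Cmod u <= delta -> in_disk (x + u)%C).
{ intros u Hu; unfold in_disk; eapply Rle_lt_trans; [apply Cmod_triangle|lra]. }
assert (Hdphi : forall u, Cmod u <= delta -> cderiv phi u (arctanq (x + u))%C).
{ intros u Hu; apply cderiv_eq with (arctanq (x + u) * (0 + 1) - 0)%C; [ring|].
  apply cderiv_minus; [|apply cderiv_const].
  apply (cderiv_comp logtau (fun u => x + u)%C); [|apply cderiv_logtau; auto].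
  apply cderiv_plus; [apply cderiv_const|apply cderiv_id]. }
destruct (ball_min_Cmod phi delta ltac:(lra)) as [u [Hu Hm]].
{ intros u Hu; eapply cderiv_cont, Hdphi, Hu. }
assert (Hu1 : Cmod u < delta).
{ apply Rnot_le_lt; intros Hge.
  specialize (Hm 0%C); rewrite Cmod_0 in Hm; specialize (Hm ltac:(lra)).
  unfold phi in Hm; rewrite Cplus_0_r in Hm.
  assert (Hx0 : in_disk x) by (unfold in_disk; lra).
  pose proof (logtau_expand x (x + u) Hx0 (Hin u Hu)) as E.
  replace (x + u - x)%C with u in E by ring.
  pose proof (Cmod_tri_minus (logtau (x + u)) y (logtau x)) as T.
  rewrite (Cmod_minus_sym (logtau x)) in Hm; lra. }
exists (x + u)%C; split; auto.
assert (Z : phi u = 0%C).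
{ apply interior_min_zero with (arctanq (x + u)%C) delta; auto; apply arctanq_nz; auto. }
apply Ceq_minus; exact Z.
Qed.

(** Only pointwise values of [v] are given; its continuity comes from [logtau_expand], whose factor
    1/2 explains eps/2. *)
Lemma lift_cderiv k v r : cont_on_disk k -> r <= 1 ->
  (forall z, in_disk z -> cderiv (Cint0 k) z (k z)) ->
  (forall z, Cmod z < r -> in_disk (v z) /\ logtau (v z) = Cint0 k z) ->
  forall z, Cmod z < r -> cderiv v z (k z / arctanq (v z))%C.
Proof.
intros Hk Hr HG Hv z Hz.
assert (Hzd : in_disk z) by (unfold in_disk; lra).
assert (Hnear : forall u, Cmod (u - z) < r - Cmod z -> Cmod u < r).
{ intros u Hu; pose proof (Cmod_tri_le u z); lra. }
apply (cderiv_lift logtau).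
- apply cderiv_ext_loc with (Cint0 k) (r - Cmod z); [lra| |auto].
  intros u Hu; symmetry; apply Hv; auto.
- intros eps He; destruct (Cint0_cont k Hk z Hzd (eps/2)) as [d [D H]]; [lra|].
  exists (Rmin d (r - Cmod z)); split; [apply Rmin_pos; lra|]; intros u Hu.
  assert (H1 := Rlt_le_trans _ _ _ Hu (Rmin_l _ _)).
  assert (H2 := Rlt_le_trans _ _ _ Hu (Rmin_r _ _)).
  specialize (H u H1).
  destruct (Hv z Hz) as [V1 V2]; destruct (Hv u (Hnear u H2)) as [V3 V4].
  pose proof (logtau_expand _ _ V1 V3) as E; rewrite V2, V4 in E; lra.
- apply cderiv_logtau, Hv, Hz.
- apply arctanq_nz, Hv, Hz.
Qed.

(* Jack's lemma in disguise: at a maximum of |v(z)/z| on a disk, z v'/v is real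
   and at least 1, which is incompatible with starlikeness of arctan if the
   maximum exceeds 1. *)
Lemma lift_schwarz k w v r r' : dominated k w -> 0 <= r < r' -> r' <= 1 ->
  (forall z, Cmod z < r' -> in_disk (v z) /\ logtau (v z) = Cint0 k z) ->
  forall z, Cmod z <= r -> Cmod (v z) <= Cmod z.
Proof.
intros [Hw [Hk [Hm [H0 HG]]]] [Hr Hrr] Hr' Hv z Hz.
pose proof (lift_cderiv k v r' Hk Hr' HG Hv) as Hd.
assert (V0 : v 0%C = 0%C).
{ destruct (Hv 0%C) as [A B]; [rewrite Cmod_0; lra|].
  apply logtau_inj; auto; [apply in_disk_0|]; now rewrite B, Cint0_0, logtau_0. }
assert (Vd : cderiv v 0 (k 0%C)).
{ eapply cderiv_eq; [|apply Hd; rewrite Cmod_0; lra]; rewrite V0, arctanq_0; field; apply C1_nz. }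
set (V := slope0 v (k 0%C)).
assert (VC : forall z, Cmod z < r' -> ccont V z).
{ intros u Hu; apply slope0_ccont; auto; eapply cderiv_cont, Hd, Hu. }
destruct (ball_max (fun z => Cmod (V z)) r Hr) as [z0 [Hz0 Hmax]].
{ apply ccont_cont_on_ball; intros u Hu; apply VC; lra. }
assert (Hle : Cmod (V z0) <= 1).
{ apply Rnot_lt_le; intros Hgt.
  assert (N : z0 <> 0%C).
  { intros E; unfold V in Hgt; rewrite E, slope0_0 in Hgt; lra. }
  assert (Pz0 : 0 < Cmod z0) by (now apply Cmod_gt_0).
  assert (EV : forall u : C, u <> 0%C -> V u = (v u / u)%C).
  { intros u Hu; unfold V, slope0; destruct (Ceq_dec u 0); [contradiction|auto]. }
  assert (Vn : V z0 <> 0%C) by (apply Cmod_gt_0; lra).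
  assert (vn : v z0 <> 0%C).
  { intros E; apply Vn; rewrite EV, E by auto; unfold Cdiv; apply Cmult_0_l. }
  assert (vgt : Cmod z0 < Cmod (v z0)).
  { rewrite EV, Cmod_div in Hgt by auto.
    apply Rmult_lt_reg_r with (/ Cmod z0); [now apply Rinv_0_lt_compat|].
    rewrite Rinv_r by lra; exact Hgt. }
  destruct (Hv z0) as [A1 A2]; [lra|].
  assert (An : Carctan (v z0) <> 0%C).
  { rewrite <- arctanq_mul; apply Cmult_neq_0; auto; now apply arctanq_nz. }
  set (dv := (k z0 / arctanq (v z0))%C).
  (* Reciprocal of v(u)/u, so that the maximum becomes a minimum and [disk_min_condition] applies;
     near [z0] the value v(u) is nonzero. *)
  set (phi := fun u => (u / v u)%C).
  assert (Hdphi : cderiv phi z0 ((1 * v z0 - z0 * dv) / (v z0 * v z0))%C).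
  { apply cderiv_div; [apply cderiv_id|apply Hd; lra|auto]. }
  destruct (VC z0 ltac:(lra) (Cmod (V z0))) as [d [D Hcl]]; [lra|].
  destruct (disk_min_condition phi z0 _ r (Rmin d (Cmod z0)) (Rmin_pos _ _ D Pz0) Hdphi N Hz0) as [L1 L2].
  { intros u Hu Hud.
    assert (Hud1 := Rlt_le_trans _ _ _ Hud (Rmin_l _ _)).
    assert (Hud2 := Rlt_le_trans _ _ _ Hud (Rmin_r _ _)).
    assert (un : u <> 0%C).
    { intros ->; replace (0 - z0)%C with (- z0)%C in Hud2 by ring; rewrite Cmod_opp in Hud2; lra. }
    assert (Vu : V u <> 0%C).
    { intros E; specialize (Hcl u Hud1); rewrite E in Hcl.
      replace (0 - V z0)%C with (- V z0)%C in Hcl by ring; rewrite Cmod_opp in Hcl; lra. }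
    assert (vu : v u <> 0%C).
    { intros E; apply Vu; rewrite EV, E by auto; unfold Cdiv; apply Cmult_0_l. }
    assert (P1 : phi u = (/ V u)%C) by (unfold phi; rewrite EV by auto; field; auto).
    assert (P2 : phi z0 = (/ V z0)%C) by (unfold phi; rewrite EV by auto; field; auto).
    rewrite P1, P2, !Cmod_inv by auto.
    apply Rinv_le_contravar; [now apply Cmod_gt_0|now apply Hmax]. }
  set (q := Cmod (phi z0) ^ 2).
  assert (Hq : 0 < q).
  { assert (0 < Cmod (phi z0)); [|unfold q; nra].
    apply Cmod_gt_0; unfold phi, Cdiv; apply Cmult_neq_0; auto.
    intros E; pose proof (Cinv_r _ vn) as Q; rewrite E, Cmult_0_r in Q; symmetry in Q.
    now apply C1_nz. }
  (* This is z v'/v, because z k = arctan w and v arctanq(v) = arctan v. Since z phi'/phi = 1 - Kc,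
     the minimum condition says that Kc is real and at least 1. *)
  set (Kc := (Carctan (w z0) / Carctan (v z0))%C).
  assert (EL : (Cconj (phi z0) * ((1 * v z0 - z0 * dv) / (v z0 * v z0)) * z0)%C = (RtoC q * (1 - Kc))%C).
  { unfold q; rewrite <- Cconj_mul_self; unfold phi at 3, Kc, dv.
    rewrite <- Hm, <- (arctanq_mul (v z0)).
    set (cc := Cconj _); field; split; auto. now apply arctanq_nz. }
  rewrite EL, im_scal_l, im_minus, im_RtoC in L1; rewrite EL, re_scal_l, re_minus, re_RtoC in L2.
  assert (I0 : Im Kc = 0) by nra.
  assert (R1 : 1 <= Re Kc) by nra.
  assert (EK : Carctan (w z0) = (RtoC (Re Kc) * Carctan (v z0))%C).
  { replace (RtoC (Re Kc)) with Kc by (apply C_eq; simpl; auto).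
    unfold Kc; field; auto. }
  assert (Hz0d : in_disk z0) by (unfold in_disk; lra).
  pose proof (Hw z0 Hz0d) as Hw0.
  pose proof (Carctan_starlike (w z0) (v z0) (Re Kc) ltac:(unfold in_disk in Hz0d; lra) A1 R1 EK); lra. }
specialize (Hmax z Hz).
assert (E : (z * V z)%C = v z) by (now apply slope0_mul).
rewrite <- E, Cmod_mult; pose proof (Cmod_ge_0 z); nra.
Qed.

(** Pointwise solvability of H(y) = G(z) with the Schwarz bound built in: the bound keeps |y| <= r
    away from the unit circle, so the disk can be enlarged. *)
Definition covered (k : C -> C) (r : R) : Prop :=
  forall z, Cmod z <= r -> exists y, Cmod y <= Cmod z /\ logtau y = Cint0 k z.

(** The gain is fixed before [r], so finitely many steps suffice. On |z| <= rho the derivative of G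
    is bounded by B, a radial move of eps changes G by at most 2 B eps < delta/4, and [logtau_open]
    solves for the new value. *)
Lemma covered_step k w r1 : dominated k w -> 0 <= r1 < 1 ->
  exists eps, 0 < eps /\ forall r, 0 <= r <= r1 -> covered k r -> covered k (r + eps).
Proof.
intros HD Hr1; pose proof HD as [Hw [Hk [Hm [H0 HG]]]].
set (rho := (1 + r1) / 2); set (delta := (1 - r1) / 2).
assert (Hdl : 0 < delta) by (unfold delta; lra).
destruct (cont_on_ball_bounded (fun z => Cmod (k z)) rho) as [B [HB0 HB]].
{ apply ccont_cont_on_ball; intros u Hu; apply Hk; unfold in_disk, rho in *; lra. }
set (eps := Rmin delta (delta / (8 * (B + 1)))).
assert (He : 0 < eps) by (apply Rmin_pos; auto; apply Rdiv_lt_0_compat; lra).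
assert (He1 : eps <= delta) by apply Rmin_l.
assert (He2 : 2 * B * eps < delta / 4).
{ assert (B * eps <= B * (delta / (8 * (B + 1)))) by (apply Rmult_le_compat_l; [lra|apply Rmin_r]).
  assert (B * (delta / (8 * (B + 1))) < delta / 8); [|lra].
  apply Rmult_lt_reg_r with (8 * (B + 1)); [lra|].
  replace (B * (delta / (8 * (B + 1))) * (8 * (B + 1))) with (B * delta) by (field; lra). nra. }
(* Solutions exist on the open disk of radius r + eps; [lift_schwarz] bounds them on a closed disk
   strictly inside, hence half the gain. *)
exists (eps / 2); split; [lra|]; intros r Hr Hc.
assert (Hex : forall z, Cmod z < r + eps -> exists y, in_disk y /\ logtau y = Cint0 k z).
{ intros z Hz; destruct (Rle_lt_dec (Cmod z) r) as [Hle|Hlt].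
  - destruct (Hc z Hle) as [y [Y1 Y2]]; exists y; split; auto; unfold in_disk; lra.
  (* Radial projection to the circle of radius [r], where a solution is already known. *)
  - set (z' := (RtoC (r / Cmod z) * z)%C).
    assert (Hz' : Cmod z' = r).
    { unfold z'; rewrite Cmod_mult, Cmod_R, Rabs_right; [field; lra|].
      apply Rle_ge, Rdiv_le_0_compat; lra. }
    assert (Hzz : Cmod (z - z') = Cmod z - r).
    { replace (z - z')%C with (RtoC (1 - r / Cmod z) * z)%C by (unfold z'; rewrite RtoC_minus; ring).
      rewrite Cmod_mult, Cmod_R, Rabs_right; [field; lra|].
      assert (r / Cmod z <= 1); [|lra]. apply Rmult_le_reg_r with (Cmod z); [lra|].
      unfold Rdiv; rewrite Rmult_assoc, Rinv_l by lra; lra. }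
    destruct (Hc z') as [y [Y1 Y2]]; [lra|].
    apply (logtau_open y _ delta); auto; [unfold delta; lra|].
    rewrite Y2.
    apply Rle_lt_trans with (2 * B * Cmod (z - z')).
    + assert (S : forall t, 0 <= t <= 1 -> Cmod (z' + RtoC t * (z - z')) <= rho).
      { intros t Ht; apply segment_disk; auto; unfold rho, delta in *; lra. }
      apply cderiv_mvt_le with k; intros t Ht; specialize (S t Ht); auto.
      apply HG; unfold in_disk, rho in *; lra.
    + rewrite Hzz; assert (2 * B * (Cmod z - r) <= 2 * B * eps) by (apply Rmult_le_compat_l; lra). lra. }
set (v := fun z => match Rlt_dec (Cmod z) (r + eps) with
  | left H => proj1_sig (constructive_indefinite_description _ (Hex z H))
  | right _ => 0%C end).
assert (Hv : forall z, Cmod z < r + eps -> in_disk (v z) /\ logtau (v z) = Cint0 k z).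
{ intros z Hz; unfold v; destruct (Rlt_dec (Cmod z) (r + eps)) as [H|H]; [|contradiction].
  exact (proj2_sig (constructive_indefinite_description _ (Hex z H))). }
intros z Hz; exists (v z); split.
- apply (lift_schwarz k w v (r + eps / 2) (r + eps) HD); auto; unfold delta in *; lra.
- apply Hv; lra.
Qed.

Lemma covered_all k w r : dominated k w -> 0 <= r < 1 -> covered k r.
Proof.
intros HD Hr; destruct (covered_step k w r HD Hr) as [eps [He Hstep]].
assert (H0 : covered k 0).
{ intros z Hz; assert (z = 0%C) as -> by (apply Cmod_eq_0; pose proof (Cmod_ge_0 z); lra).
  exists 0%C; split; [lra|]; now rewrite Cint0_0, logtau_0. }
(* Capping at [r] keeps every radius within the range where [covered_step] gives the same gain. *)
assert (Hn : forall n, covered k (Rmin (INR n * eps) r)).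
{ induction n as [|n IH].
  - simpl; rewrite Rmult_0_l, Rmin_left by lra; auto.
  - intros z Hz; apply (Hstep (Rmin (INR n * eps) r)); auto.
    + split; [apply Rmin_glb; [apply Rmult_le_pos; [apply pos_INR|lra]|lra]|apply Rmin_r].
    + eapply Rle_trans; [exact Hz|]; rewrite S_INR.
      unfold Rmin; destruct (Rle_dec _ _), (Rle_dec _ _); lra. }
destruct (archimed_cor1 (eps / (r + 1))) as [n [Hn1 Hn2]]; [apply Rdiv_lt_0_compat; lra|].
specialize (Hn n); rewrite Rmin_right in Hn; auto.
assert (Pn : 0 < INR n) by (apply lt_0_INR; auto).
apply Rmult_lt_compat_r with (r := INR n * (r + 1)) in Hn1; [|nra].
replace (/ INR n * (INR n * (r + 1))) with (r + 1) in Hn1 by (field; lra).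
replace (eps / (r + 1) * (INR n * (r + 1))) with (INR n * eps) in Hn1 by (field; lra).
lra.
Qed.

Lemma schwarz_lift k w : dominated k w -> exists v : C -> C,
  forall z, in_disk z -> in_disk (v z) /\ Cmod (v z) <= Cmod z /\ logtau (v z) = Cint0 k z /\
    cderiv v z (k z / arctanq (v z))%C.
Proof.
intros HD; pose proof HD as [Hw [Hk [Hm [H0 HG]]]].
assert (Hex : forall z, exists y, in_disk z -> Cmod y <= Cmod z /\ logtau y = Cint0 k z).
{ intros z; destruct (classic (in_disk z)) as [Hz|Hz]; [|exists 0%C; intros; contradiction].
  destruct (covered_all k w (Cmod z) HD) with (z := z) as [y Hy]; [split; [apply Cmod_ge_0|auto]|lra|].
  now exists y. }
set (v := fun z => proj1_sig (constructive_indefinite_description _ (Hex z))).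
assert (Hv : forall z, in_disk z -> Cmod (v z) <= Cmod z /\ logtau (v z) = Cint0 k z)
  by (intros z; exact (proj2_sig (constructive_indefinite_description _ (Hex z)))).
assert (Hv2 : forall z, Cmod z < 1 -> in_disk (v z) /\ logtau (v z) = Cint0 k z).
{ intros z Hz; destruct (Hv z Hz); split; auto; unfold in_disk; lra. }
exists v; intros z Hz; destruct (Hv z Hz); repeat split; auto; [apply Hv2, Hz|].
apply (lift_cderiv k v 1); auto; lra.
Qed.

(** * Rigidity of the Schwarz function *)

Lemma Cexp_surj (z : C) : z <> 0%C -> exists y, Cexp y = z.
Proof.
intros n; assert (P : 0 < Cmod z) by (now apply Cmod_gt_0).
destruct (Rlt_le_dec 0 (Cmod z + Re z)) as [H|H]; [exists (Clog z); now apply Cexp_Clog|].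
pose proof (Cmod2_alt z) as Q; pose proof (re_le_Cmod z) as T.
apply Rabs_le_between in T.
assert (R0 : Re z = - Cmod z) by lra.
assert (I0 : Im z = 0) by (rewrite R0 in Q; nra).
(* On the negative real axis, where [Cexp_Clog] does not apply, the angle is pi. *)
exists (ln (Cmod z), PI); apply C_eq; simpl; rewrite exp_ln, cos_PI, ?sin_PI by auto.
- change (fst z) with (Re z); lra.
- change (snd z) with (Im z); lra.
Qed.

Lemma Cexp_period (x t : R) : Cexp (x, t + 2 * PI) = Cexp (x, t).
Proof. unfold Cexp; simpl; now rewrite cos_plus, sin_plus, cos_2PI, sin_2PI, !Rmult_0_r, !Rmult_1_r, Rminus_0_r, Rplus_0_r. Qed.

Lemma rderiv_horizontal (x t : R) : rderiv (fun u => (u, t) : C) x 1%C.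
Proof.
apply rderiv_ext with (fun u => ((0, t) : C) + RtoC u * 1)%C; [|apply rderiv_affine].
intros u; apply C_eq; simpl; ring.
Qed.

Lemma rderiv_vertical (x t : R) : rderiv (fun u => (x, u) : C) t Ci.
Proof.
apply rderiv_ext with (fun u => RtoC x + RtoC u * Ci)%C; [|apply rderiv_affine].
intros u; apply C_eq; simpl; ring.
Qed.

Lemma ccont_continuity_2d (f : C -> C) x y : ccont f (x, y) ->
  continuity_2d_pt (fun u v => Re (f (u, v))) x y.
Proof.
intros H eps; destruct (H eps (cond_pos eps)) as [d [D Hd]].
exists (mkposreal (d/2) ltac:(lra)); simpl; intros u v Hu Hv.
rewrite <- re_minus; eapply Rle_lt_trans; [apply re_le_Cmod|apply Hd].
eapply Rle_lt_trans; [apply Cmod_le_Re_Im|]; simpl; unfold Rminus in *; lra.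
Qed.

(** * Mean values over circles, in the coordinate log z *)

Section MeanValue.

Variables (W dW : C -> C).
Hypothesis HW : forall z, Re z < 0 -> cderiv W z (dW z).
Hypothesis HdW : forall z, Re z < 0 -> ccont dW z.
Hypothesis HP : forall x t, W (x, t + 2 * PI) = W (x, t).

(** With z = exp(x + it) a circle becomes a vertical period, and the centre of the disk lies at x =
    -infinity. The starting point [a] is free so that the period can be centred at a prescribed
    angle. *)
Let mean (a x : R) := RInt (fun t => Re (W (x, t))) a (a + 2 * PI).

Lemma vertical_continuous (f : C -> C) x t : ccont f (x, t) ->
  continuous (fun t => Re (f (x, t))) t.
Proof.
intros H; apply continuity_pt_filterlim, (rcont_continuity_Re (fun t => f (x, t))).
apply (rcont_comp f (fun t => (x, t) : C)); auto.
eapply rderiv_cont, rderiv_vertical.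
Qed.

Lemma mean_ex_RInt x a b : x < 0 -> ex_RInt (fun t => Re (W (x, t))) a b.
Proof.
intros Hx; apply (ex_RInt_continuous (V := R_CompleteNormedModule)); intros t _.
apply vertical_continuous; eapply cderiv_cont, HW; exact Hx.
Qed.

Lemma horizontal_is_derive x t : x < 0 ->
  is_derive (fun u => Re (W (u, t))) x (Re (dW (x, t))).
Proof.
intros Hx; rewrite <- (Cmult_1_r (dW (x, t))).
apply (rderiv_Re (fun u => W (u, t))), (rderiv_comp W (fun u => (u, t) : C)).
- apply rderiv_horizontal.
- now apply HW.
Qed.

(* The derivative of the mean in x is the integral over a period of
   Re W' = d/dt Im W. *)
Lemma mean_is_derive a x : x < 0 -> is_derive (mean a) x 0.
Proof.
intros Hx; pose proof PI_RGT_0 as PP.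
assert (Hd : is_derive (mean a) x
  (RInt (fun t => Derive (fun u => Re (W (u, t))) x) a (a + 2 * PI))).
{ apply is_derive_RInt_param.
  - exists (mkposreal (- x) ltac:(lra)); intros y Hy t _.
    change (Rabs (y - x) < - x) in Hy; apply Rabs_def2 in Hy.
    eexists; apply horizontal_is_derive; lra.
  - intros t _.
    apply continuity_2d_pt_ext_loc with (fun u v => Re (dW (u, v))).
    + exists (mkposreal (- x) ltac:(lra)); simpl; intros u v Hu _.
      apply Rabs_def2 in Hu; symmetry; apply is_derive_unique, horizontal_is_derive; lra.
    + now apply ccont_continuity_2d, HdW.
  - exists (mkposreal (- x) ltac:(lra)); intros y Hy.
    change (Rabs (y - x) < - x) in Hy; apply Rabs_def2 in Hy.
    apply mean_ex_RInt; lra. }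
replace 0 with (RInt (fun t => Derive (fun u => Re (W (u, t))) x) a (a + 2 * PI)); auto.
apply is_RInt_unique.
apply is_RInt_ext with (fun t => Re (dW (x, t))).
{ intros t _; symmetry; now apply is_derive_unique, horizontal_is_derive. }
replace 0 with (minus (G := R_AbelianGroup) (Im (W (x, a + 2 * PI))) (Im (W (x, a)))).
- apply (is_RInt_derive (V := R_CompleteNormedModule) (fun t => Im (W (x, t)))).
  + intros t _; replace (Re (dW (x, t))) with (Im (dW (x, t) * Ci)) by (rewrite im_mult; change (Im Ci) with 1; change (Re Ci) with 0; ring).
    apply (rderiv_Im (fun t => W (x, t))), (rderiv_comp W (fun u => (x, u) : C)).
    * apply rderiv_vertical.
    * now apply HW.
  + intros t _; now apply vertical_continuous, HdW.
- rewrite HP; apply (minus_eq_zero (G := R_AbelianGroup)).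
Qed.

Lemma mean_const a x y : x < y -> y < 0 -> mean a x = mean a y.
Proof.
intros Hxy Hy; apply (eq_is_derive (V := R_NormedModule)); auto.
intros t Ht; apply mean_is_derive; lra.
Qed.

Lemma mean_lower a x m : x < 0 -> (forall t, m <= Re (W (x, t))) -> m * (2 * PI) <= mean a x.
Proof.
intros Hx H; pose proof PI_RGT_0 as PP.
replace (m * (2 * PI)) with (RInt (fun _ => m) a (a + 2 * PI)).
- apply RInt_le; [lra|apply ex_RInt_const|now apply mean_ex_RInt|auto].
- rewrite (RInt_const (V := R_CompleteNormedModule)).
  change ((a + 2 * PI - a) * m = m * (2 * PI)); ring.
Qed.

(** By continuity Re W <= 1 - eta on a window around [t0]. Starting the period at t0 - pi puts the
    window inside it, as its half-width is at most pi/2. *)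
Lemma mean_upper_strict x t0 : x < 0 -> (forall t, Re (W (x, t)) <= 1) -> Re (W (x, t0)) < 1 ->
  mean (t0 - PI) x < 2 * PI.
Proof.
intros Hx H H0; pose proof PI_RGT_0 as PP.
assert (Cv : rcont (fun t => W (x, t)) t0).
{ apply (rcont_comp W (fun t => (x, t) : C)); [eapply rderiv_cont, rderiv_vertical|].
  eapply cderiv_cont, HW; exact Hx. }
set (eta := (1 - Re (W (x, t0))) / 2).
destruct (Cv eta) as [d [D Hd]]; [unfold eta; lra|].
set (e := Rmin (d / 2) (PI / 2)).
assert (He : 0 < e) by (apply Rmin_pos; lra).
assert (He1 : e <= d / 2) by apply Rmin_l.
assert (He2 : e <= PI / 2) by apply Rmin_r.
unfold mean; replace (t0 - PI + 2 * PI) with (t0 + PI) by ring.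
set (f := fun t => Re (W (x, t))) in *.
assert (Hex : forall a b, ex_RInt f a b) by (intros; now apply mean_ex_RInt).
assert (Hc : forall a b m, a <= b -> (forall t, a < t < b -> f t <= m) -> RInt f a b <= m * (b - a)).
{ intros a b m Hab Hm.
  replace (m * (b - a)) with (RInt (fun _ => m) a b).
  - apply RInt_le; auto; apply ex_RInt_const.
  - rewrite (RInt_const (V := R_CompleteNormedModule)); change ((b - a) * m = m * (b - a)); ring. }
rewrite <- (RInt_Chasles f (t0 - PI) (t0 - e) (t0 + PI)) by auto.
rewrite <- (RInt_Chasles f (t0 - e) (t0 + e) (t0 + PI)) by auto.
change (RInt f (t0 - PI) (t0 - e) + (RInt f (t0 - e) (t0 + e) + RInt f (t0 + e) (t0 + PI)) < 2 * PI).
pose proof (Hc (t0 - PI) (t0 - e) 1 ltac:(lra) ltac:(intros; apply H)).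
pose proof (Hc (t0 + e) (t0 + PI) 1 ltac:(lra) ltac:(intros; apply H)).
assert (RInt f (t0 - e) (t0 + e) <= (1 - eta) * (t0 + e - (t0 - e))).
{ apply Hc; [lra|]; intros t Ht.
  assert (Q : Rabs (t - t0) < d) by (apply Rabs_def1; lra).
  specialize (Hd t Q).
  pose proof (Rle_lt_trans _ _ _ (re_le_Cmod _) Hd) as T; rewrite re_minus in T.
  apply Rabs_def2 in T; unfold f, eta in *; lra. }
assert (0 < eta) by (unfold eta; lra).
nra.
Qed.

End MeanValue.

(** The mean of Re U over a circle does not depend on the radius and tends to U(0) = 1 at the
    centre, whereas Re U < 1 at one point would make it strictly smaller. Then Re U = 1 and |U| <= 1
    force Im U = 0. Derivatives are asked for off 0 only, since U arises as a quotient by z. *)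
Lemma rigid_at_center (U dU : C -> C) : U 0%C = 1%C -> ccont U 0 ->
  (forall z, in_disk z -> Cmod (U z) <= 1) ->
  (forall z, in_disk z -> z <> 0%C -> cderiv U z (dU z) /\ ccont dU z) ->
  forall z, in_disk z -> U z = 1%C.
Proof.
intros U0 UC Ule UD z Hz; destruct (Ceq_dec z 0) as [->|n]; auto.
destruct (Cexp_surj z n) as [[x t0] Hxt].
set (W := fun u => U (Cexp u)); set (dW := fun u => (dU (Cexp u) * Cexp u)%C).
assert (Hin : forall u, Re u < 0 -> in_disk (Cexp u)).
{ intros u Hu; unfold in_disk; rewrite Cmod_Cexp, <- exp_0; now apply exp_increasing. }
assert (Hx : x < 0).
{ unfold in_disk in Hz; rewrite <- Hxt, Cmod_Cexp, <- exp_0 in Hz; now apply exp_lt_inv in Hz. }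
assert (HW : forall u, Re u < 0 -> cderiv W u (dW u)).
{ intros u Hu; apply (cderiv_comp U Cexp); [apply cderiv_Cexp|apply UD; auto; apply Cexp_neq_0]. }
assert (HdW : forall u, Re u < 0 -> ccont dW u).
{ intros u Hu; apply ccont_mult; [|eapply cderiv_cont, cderiv_Cexp].
  apply (ccont_comp dU Cexp); [eapply cderiv_cont, cderiv_Cexp|apply UD; auto; apply Cexp_neq_0]. }
assert (HP : forall x t, W (x, t + 2 * PI) = W (x, t)) by (intros; unfold W; now rewrite Cexp_period).
assert (Wle : forall u, Re u < 0 -> Re (W u) <= 1).
{ intros u Hu; eapply Rle_trans; [apply Rle_abs|]; eapply Rle_trans; [apply re_le_Cmod|]; apply Ule; auto. }
assert (R1 : Re (U z) = 1).
{ apply Rle_antisym.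
  - eapply Rle_trans; [apply Rle_abs|]; eapply Rle_trans; [apply re_le_Cmod|]; auto.
  - rewrite <- Hxt; apply Rnot_lt_le; intros Hlt.
    pose proof (mean_upper_strict W dW HW x t0 Hx ltac:(intros; now apply Wle) Hlt) as Q.
    pose proof PI_RGT_0 as PP.
    set (m := RInt (fun t => Re (W (x, t))) (t0 - PI) (t0 - PI + 2 * PI) : R) in *.
    (* This tolerance costs half of the gap 2 pi - m, so on a small circle the mean still exceeds
       m. *)
    destruct (UC ((2 * PI - m) / (4 * PI))) as [d [D Hd]]; [apply Rdiv_lt_0_compat; lra|].
    set (y := Rmin (x - 1) (ln d - 1)).
    assert (Y1 : y <= x - 1) by apply Rmin_l; assert (Y2 : y <= ln d - 1) by apply Rmin_r.
    assert (Hyd : exp y < d).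
    { rewrite <- (exp_ln d) by auto; apply exp_increasing; lra. }
    pose proof (mean_const W dW HW HdW HP (t0 - PI) y x ltac:(lra) Hx) as E.
    cbv beta zeta in E; fold m in E.
    assert (L : (1 - (2 * PI - m) / (4 * PI)) * (2 * PI) <= m).
    { eapply Rle_trans; [|right; exact E].
      apply (mean_lower W dW HW); [lra|]; intros t.
      assert (T : Cmod (Cexp (y, t) - 0) < d).
      { replace (Cexp (y, t) - 0)%C with (Cexp (y, t)) by ring; now rewrite Cmod_Cexp. }
      specialize (Hd _ T); pose proof (Rle_lt_trans _ _ _ (re_le_Cmod _) Hd) as T2.
      rewrite re_minus, U0, re_RtoC in T2; apply Rabs_def2 in T2; change (W (y, t)) with (U (Cexp (y, t))); lra. }
    replace ((1 - (2 * PI - m) / (4 * PI)) * (2 * PI)) with (2 * PI - (2 * PI - m) / 2) in L by (field; lra).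
    lra. }
pose proof (Cmod2_alt (U z)) as Q; rewrite R1 in Q; pose proof (Ule z Hz); pose proof (Cmod_ge_0 (U z)).
apply C_eq; [rewrite R1; reflexivity|simpl; change (snd (U z)) with (Im (U z))].
assert (Im (U z) ^ 2 <= 0) by nra. nra.
Qed.

Lemma schwarz_lift_rigid k w v : dominated k w -> Cmod (k 0%C) = 1 ->
  (forall z, in_disk z -> in_disk (v z) /\ Cmod (v z) <= Cmod z /\ logtau (v z) = Cint0 k z /\
    cderiv v z (k z / arctanq (v z))%C) ->
  forall z, in_disk z -> v z = (k 0%C * z)%C.
Proof.
intros [Hw [Hk [Hm [H0 HG]]]] K1 Hv z Hz.
set (c := k 0%C) in *.
assert (V0 : v 0%C = 0%C).
{ destruct (Hv 0%C in_disk_0) as [_ [A _]]; rewrite Cmod_0 in A.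
  apply Cmod_eq_0; pose proof (Cmod_ge_0 (v 0%C)); lra. }
assert (Vd : cderiv v 0 c).
{ eapply cderiv_eq; [|apply Hv, in_disk_0]; rewrite V0, arctanq_0; unfold c; field; apply C1_nz. }
assert (Vc : cont_on_disk v) by (intros u Hu; eapply cderiv_cont, Hv, Hu).
assert (Ec : (Cconj c * c = 1)%C) by (rewrite Cconj_mul_self, K1; f_equal; ring).
(* v(z)/z normalized to 1 at the origin: |c| = 1, so conj c = 1/c. *)
set (U := fun u => (Cconj c * slope0 v c u)%C).
assert (EU : U z = 1%C).
{ apply (rigid_at_center U (fun u => Cconj c * ((k u / arctanq (v u) * u - v u * 1) / (u * u)))%C); auto.
  - unfold U; now rewrite slope0_0.
  - apply ccont_mult; [apply ccont_const|apply slope0_cont; auto; apply in_disk_0].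
  - intros u Hu; unfold U; rewrite Cmod_mult, Cmod_conj, K1, Rmult_1_l.
    unfold slope0; destruct (Ceq_dec u 0) as [E|n]; [lra|].
    assert (P : 0 < Cmod u) by (now apply Cmod_gt_0).
    rewrite Cmod_div by auto; destruct (Hv u Hu) as [_ [A _]].
    apply Rmult_le_reg_r with (Cmod u); auto.
    unfold Rdiv; rewrite Rmult_assoc, Rinv_l by lra; lra.
  - intros u Hu n; split.
    + apply cderiv_ext_loc with (fun x => Cconj c * (v x / x))%C (Cmod u); [now apply Cmod_gt_0| |].
      * intros x Hx; unfold U, slope0; destruct (Ceq_dec x 0) as [->|]; auto.
        replace (0 - u)%C with (- u)%C in Hx by ring; rewrite Cmod_opp in Hx; lra.
      * apply cderiv_scal, cderiv_div; [apply Hv, Hu|apply cderiv_id|auto].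
    + apply ccont_mult; [apply ccont_const|].
      apply ccont_mult; [|apply ccont_inv; [apply ccont_mult; apply ccont_id|now apply Cmult_neq_0]].
      apply ccont_plus.
      * apply ccont_mult; [|apply ccont_id]; apply ccont_mult; [now apply Hk|].
        apply ccont_inv; [|now apply arctanq_nz, Hv].
        apply (ccont_comp arctanq v); [now apply Vc|apply arctanq_cont, Hv, Hu].
      * apply ccont_ext with (fun x => (-1) * (v x * 1))%C; [intros; ring|].
        apply ccont_mult; [apply ccont_const|apply ccont_mult; [now apply Vc|apply ccont_const]]. }
assert (Es : (z * slope0 v c z)%C = v z) by (now apply slope0_mul).
rewrite <- Es.
replace (slope0 v c z) with ((Cconj c * c) * slope0 v c z)%C by (rewrite Ec; ring).
replace ((Cconj c * c) * slope0 v c z)%C with (c * U z)%C by (unfold U; ring).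
rewrite EU; ring.
Qed.

(** * Growth, rotation and covering *)

(** A nondecreasing function with equal end values is constant, so its slope at 0 vanishes. The sign
    is asked for s > 0 only because it is obtained after division by s. *)
Lemma nondecr_slope (phi dphi : R -> R) :
  (forall s, 0 <= s <= 1 -> is_derive phi s (dphi s)) ->
  (forall s, 0 < s <= 1 -> 0 <= dphi s) ->
  phi 0 <= phi 1 /\ (phi 0 = phi 1 -> dphi 0 = 0).
Proof.
intros Hd Hp.
assert (M : forall a b, 0 <= a < b -> b <= 1 -> phi a <= phi b).
{ intros a b Hab Hb.
  destruct (MVT_cor2 phi dphi a b) as [c [E Hc]]; [lra| |].
  - intros c Hc; apply is_derive_Reals, Hd; lra.
  - specialize (Hp c ltac:(lra)); nra. }
split; [apply M; lra|]; intros E.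
destruct (Req_dec (dphi 0) 0) as [|n]; auto; exfalso.
pose proof (Hd 0 ltac:(lra)) as D0; apply is_derive_Reals in D0.
destruct (D0 (Rabs (dphi 0)) (Rabs_pos_lt _ n)) as [d Hdl].
pose proof (cond_pos d) as Pd.
set (h := Rmin (d / 2) 1).
assert (Hh : 0 < h) by (apply Rmin_pos; lra).
assert (H1 : h <= d / 2) by apply Rmin_l; assert (H2 : h <= 1) by apply Rmin_r.
specialize (Hdl h ltac:(lra) ltac:(rewrite Rabs_right; lra)).
rewrite Rplus_0_l in Hdl.
assert (Eh : phi h = phi 0).
{ pose proof (M 0 h ltac:(lra) H2); destruct (Req_dec h 1) as [->|]; [lra|].
  pose proof (M h 1 ltac:(lra) ltac:(lra)); lra. }
rewrite Eh in Hdl; replace ((phi 0 - phi 0) / h - dphi 0) with (- dphi 0) in Hdl by (field; lra).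
rewrite Rabs_Ropp in Hdl; lra.
Qed.

Lemma axis_Cmod e : axis e -> Cmod e = 1 /\ (Cconj e * e)%C = 1%C.
Proof.
assert (Q : forall u, Cmod u = 1 -> (Cconj u * u)%C = 1%C)
  by (intros u Hu; rewrite Cconj_mul_self, Hu; f_equal; ring).
intros He; assert (Cmod e = 1); [|auto].
destruct He as [->|[->|[->| ->]]]; rewrite ?Cmod_opp, ?Cmod_Ci; auto; rewrite Cmod_R;
[apply Rabs_R1|rewrite Rabs_left; lra].
Qed.

(** Lets the extremal function be compared with itself, which locates the maximum of arg(tau(z)/z)
    on a circle. *)
Lemma dominated_arctanq : dominated arctanq (fun z => z).
Proof.
repeat split; [intros; lra|apply arctanq_cont|apply arctanq_mul| |apply cderiv_logtau].
rewrite arctanq_0, Cmod_1; lra.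
Qed.

(** Let phi(s) be the gap between the two sides at s e|z| and s z. Then s phi'(s) is the gap in
    [Carctan_extremal], as z k = arctan w and |w(s z)| <= s |z|. Equality at s = 1 forces phi'(0) =
    |z| - Re(conj e k(0) z) = 0, so |k(0)| >= 1. *)
Lemma dominated_ray k w e z : dominated k w -> axis e -> in_disk z ->
  Re (Cconj e * Cint0 k z) <= Re (Cconj e * logtau (e * RtoC (Cmod z))) /\
  (z <> 0%C -> Re (Cconj e * Cint0 k z) = Re (Cconj e * logtau (e * RtoC (Cmod z))) ->
   Cmod (k 0%C) = 1).
Proof.
intros [Hw [Hk [Hm [H0 HG]]]] He Hz.
destruct (axis_Cmod e He) as [Ee1 Ee2].
set (r := Cmod z) in *; pose proof (Cmod_ge_0 z) as Pr; fold r in Pr.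
assert (Hr : r < 1) by exact Hz.
set (x := (e * RtoC r)%C).
assert (Hx : in_disk x).
{ unfold in_disk, x; rewrite Cmod_mult, Ee1, Cmod_R, Rabs_right; lra. }
set (phi := fun s : R => Re (Cconj e * logtau (RtoC s * x)) - Re (Cconj e * Cint0 k (RtoC s * z))).
set (dphi := fun s : R => Re (Cconj e * (arctanq (RtoC s * x) * x)) - Re (Cconj e * (k (RtoC s * z)%C * z))).
assert (Hd : forall s, 0 <= s <= 1 -> is_derive phi s (dphi s)).
{ intros s Hs; apply (is_derive_minus (V := R_NormedModule)).
  - apply (rderiv_Re (fun s => Cconj e * logtau (RtoC s * x))%C), rderiv_scal, rderiv_ray.
    now apply cderiv_logtau, in_disk_ray.
  - apply (rderiv_Re (fun s => Cconj e * Cint0 k (RtoC s * z))%C), rderiv_scal, rderiv_ray.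
    now apply HG, in_disk_ray. }
assert (Hp : forall s, 0 < s <= 1 -> 0 <= dphi s).
{ intros s Hs; apply Rmult_le_reg_l with s; [lra|]; rewrite Rmult_0_r.
  unfold dphi; rewrite Rmult_minus_distr_l, <- !re_scal_l.
  replace (RtoC s * (Cconj e * (arctanq (RtoC s * x) * x)))%C with (Cconj e * ((RtoC s * x) * arctanq (RtoC s * x)))%C by ring.
  replace (RtoC s * (Cconj e * (k (RtoC s * z)%C * z)))%C with (Cconj e * ((RtoC s * z) * k (RtoC s * z)%C))%C by ring.
  rewrite arctanq_mul, Hm.
  replace (RtoC s * x)%C with (e * RtoC (s * r))%C by (unfold x; rewrite RtoC_mult; ring).
  assert (Hsz : Cmod (w (RtoC s * z)%C) <= s * r).
  { eapply Rle_trans; [apply Hw, in_disk_ray; auto; lra|].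
    rewrite Cmod_mult, Cmod_R, Rabs_right by lra; unfold r; lra. }
  pose proof (Carctan_extremal e _ (s * r) He Hsz ltac:(nra)); lra. }
destruct (nondecr_slope phi dphi Hd Hp) as [A B].
assert (P0 : phi 0 = 0).
{ unfold phi; replace (0 * x)%C with (RtoC 0) by ring; replace (0 * z)%C with (RtoC 0) by ring.
  rewrite logtau_0, Cint0_0; ring. }
assert (P1 : phi 1 = Re (Cconj e * logtau x) - Re (Cconj e * Cint0 k z))
  by (unfold phi; now rewrite !Cmult_1_l).
split; [lra|]; intros n E.
specialize (B ltac:(lra)); unfold dphi in B.
replace (0 * x)%C with (RtoC 0) in B by ring; replace (0 * z)%C with (RtoC 0) in B by ring.
rewrite arctanq_0 in B.
replace (Cconj e * (1 * x))%C with ((Cconj e * e) * RtoC r)%C in B by (unfold x; ring).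
rewrite Ee2, Cmult_1_l, re_RtoC in B.
pose proof (Rle_trans _ _ _ (Rle_abs _) (re_le_Cmod (Cconj e * (k 0%C * z)))) as T.
rewrite !Cmod_mult, Cmod_conj, Ee1 in T; fold r in T.
assert (0 < r) by (unfold r; now apply Cmod_gt_0). nra.
Qed.

(** * The extremal function and its rotations *)

Lemma arctanq_real x : Rabs x < 1 -> Im (arctanq x) = 0.
Proof.
intros Hx; destruct (Req_dec x 0) as [->|n]; [now rewrite arctanq_0|].
pose proof (proj1 (Carctan_real_im x)) as Q; rewrite <- arctanq_mul, im_scal_l in Q.
apply Rmult_integral in Q; destruct Q; [contradiction|auto].
Qed.

Lemma in_disk_real x : Rabs x < 1 -> in_disk (RtoC x).
Proof. unfold in_disk; now rewrite Cmod_R. Qed.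

Lemma segment_real x t : Rabs x < 1 -> 0 <= t <= 1 -> Rabs (t * x) < 1.
Proof. intros Hx Ht; rewrite Rabs_mult, (Rabs_right t) by lra; pose proof (Rabs_pos x); nra. Qed.

Lemma logtau_increment_ge (x m : R) (c : C) : Rabs x < 1 ->
  (forall y, Rabs y < 1 -> m <= Re (c * (arctanq y * x))) -> m <= Re (c * logtau x).
Proof.
intros Hx H.
replace (logtau x) with (logtau x - logtau 0)%C by (rewrite logtau_0; ring).
assert (S : forall t, (0 + RtoC t * (RtoC x - 0))%C = RtoC (t * x)) by (intros; rewrite RtoC_mult; ring).
apply re_increment_ge with arctanq; intros t Ht; rewrite S.
- now apply cderiv_logtau, in_disk_real, segment_real.
- replace (RtoC x - 0)%C with (RtoC x) by ring; now apply H, segment_real.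
Qed.

(** [logtau_increment_ge] with m = 0 and both c = i and c = -i: the real parts to be bounded vanish
    because arctan(y)/y is real. *)
Lemma logtau_real x : Rabs x < 1 -> Im (logtau x) = 0.
Proof.
intros Hx.
assert (A : 0 <= Re (Ci * logtau x)).
{ apply logtau_increment_ge; auto; intros y Hy.
  replace (Ci * (arctanq y * x))%C with (RtoC x * (Ci * arctanq y))%C by ring.
  rewrite re_scal_l, re_mult, arctanq_real by auto; simpl; lra. }
assert (B : 0 <= Re (- Ci * logtau x)).
{ apply logtau_increment_ge; auto; intros y Hy.
  replace (- Ci * (arctanq y * x))%C with (RtoC (- x) * (Ci * arctanq y))%C by (rewrite RtoC_opp; ring).
  rewrite re_scal_l, re_mult, arctanq_real by auto; simpl; lra. }
rewrite re_mult in A, B; change (Re Ci) with 0 in A; change (Im Ci) with 1 in A.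
change (Re (- Ci)) with (-0) in B; change (Im (- Ci)) with (-(1)) in B; lra.
Qed.

Lemma tau_eq z : tau z = (z * Cexp (logtau z))%C.
Proof. reflexivity. Qed.

Lemma tau_re_eq x : Rabs x < 1 -> tau_re x = x * exp (Re (logtau x)).
Proof.
intros Hx; unfold tau_re; rewrite tau_eq, re_scal_l; f_equal.
unfold Cexp; rewrite re_scal_l, logtau_real, cos_0 by auto; simpl; ring.
Qed.

Lemma quot_id_exp (f G : C -> C) z : G 0%C = 0%C -> f z = (z * Cexp (G z))%C ->
  quot_id f z = Cexp (G z).
Proof.
intros G0 E; unfold quot_id; destruct (Ceq_dec z 0) as [->|n]; [now rewrite G0, Cexp_0|].
rewrite E; field; auto.
Qed.

Lemma cderiv_id_exp (G : C -> C) z l : cderiv G z l ->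
  cderiv (fun u => u * Cexp (G u))%C z (Cexp (G z) * (1 + z * l))%C.
Proof.
intros H; eapply cderiv_eq; [|apply cderiv_mult; [apply cderiv_id|]].
2: { apply (cderiv_comp Cexp G); [exact H|apply cderiv_Cexp]. }
cbv beta; ring.
Qed.

Lemma log_deriv_quot_tau z : in_disk z -> log_deriv_quot tau z = (1 + Carctan z)%C.
Proof.
intros Hz; unfold log_deriv_quot; destruct (Ceq_dec z 0) as [->|n]; [rewrite Carctan_0; ring|].
assert (D : C_derive tau z = (Cexp (logtau z) * (1 + z * arctanq z))%C).
{ apply is_C_derive_unique, cderiv_iff, (cderiv_id_exp logtau), cderiv_logtau, Hz. }
rewrite D, arctanq_mul, tau_eq; field; split; auto; apply Cexp_neq_0.
Qed.

Lemma Cint0_rescale k c z : (forall u, in_disk u -> u <> 0%C -> k u = (c * arctanq (c * u))%C) ->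
  in_disk z -> Cint0 k z = logtau (c * z).
Proof.
intros Hk Hz; destruct (Ceq_dec z 0) as [->|n].
{ now rewrite Cmult_0_r, Cint0_0, logtau_0. }
apply (RInt_ext (V := C_R_CompleteNormedModule)); intros s Hs.
rewrite Rmin_left, Rmax_right in Hs by lra.
(* Integrands are compared only for 0 < s < 1, where s z is nonzero. *)
rewrite Hk; [|apply in_disk_ray; auto; lra|].
- replace (c * (RtoC s * z))%C with (RtoC s * (c * z))%C by ring.
  change (z * (c * arctanq (RtoC s * (c * z))) = c * z * arctanq (RtoC s * (c * z)))%C; ring.
- apply Cmult_neq_0; auto; intros E; apply RtoC_inj in E; lra.
Qed.

Lemma arctanq_opp z : arctanq (- z) = arctanq z.
Proof.
destruct (Ceq_dec z 0) as [->|n]; [f_equal; ring|].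
assert (n' : (- z)%C <> 0%C) by (intros E; apply n; rewrite <- (Copp_0); rewrite <- E; ring).
pose proof (arctanq_mul (- z)) as Q; rewrite Carctan_opp, <- (arctanq_mul z) in Q.
replace (arctanq (- z)) with ((- z * arctanq (- z)) / (- z))%C by (field; auto).
rewrite Q; field; auto.
Qed.

Lemma logtau_opp z : in_disk z -> logtau (- z) = (- logtau z)%C.
Proof.
intros Hz; unfold logtau at 1, Cint0.
apply (is_RInt_unique (V := C_R_CompleteNormedModule)).
apply (is_RInt_ext (V := C_R_NormedModule)) with (fun s => opp (G := C_AbelianGroup) (z * arctanq (RtoC s * z))%C).
- intros s _; change (- (z * arctanq (RtoC s * z)) = - z * arctanq (RtoC s * - z))%C.
  replace (RtoC s * - z)%C with (- (RtoC s * z))%C by ring; rewrite arctanq_opp; ring.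
- apply (is_RInt_opp (V := C_R_NormedModule)), is_RInt_Cint0; auto; apply arctanq_cont.
Qed.

Lemma unit_Cexp c : Cmod c = 1 -> exists theta : R, Cexp (Ci * RtoC theta) = c.
Proof.
intros Hc; destruct (Cexp_surj c) as [y Hy]; [apply Cmod_gt_0; lra|].
exists (Im y); rewrite <- Hy; rewrite <- Hy, Cmod_Cexp, <- exp_0 in Hc.
apply exp_inv in Hc; f_equal; apply C_eq; simpl; change (fst y) with (Re y); change (snd y) with (Im y); lra.
Qed.

Lemma Cmod_Cexp_i (theta : R) : Cmod (Cexp (Ci * RtoC theta)) = 1.
Proof. rewrite Cmod_Cexp; replace (Re (Ci * RtoC theta)) with 0 by (simpl; ring); apply exp_0. Qed.

Lemma rotation_of_rescale f G c : Cmod c = 1 -> (forall z, in_disk z -> f z = (z * Cexp (G z))%C) ->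
  (forall z, in_disk z -> G z = logtau (c * z)) -> is_rotation_of f tau.
Proof.
intros Hc Hf HG; destruct (unit_Cexp c Hc) as [theta Ht].
exists theta; intros z Hz; rewrite Hf, HG, Ht, tau_eq by auto.
rewrite <- Ht at 2.
transitivity ((Cexp (Ci * RtoC theta) * Cexp (- (Ci * RtoC theta))) * (z * Cexp (logtau (c * z))))%C; [rewrite Cexp_neg; ring|].
rewrite Ht; ring.
Qed.

(** exp G(z) = exp H(c z) determines G only up to multiples of 2 pi i. Differentiating and
    cancelling the exponential gives k(u) = c arctanq(c u) off 0, and integration along rays
    restores G(z) = H(c z). *)
Lemma rescale_of_rotation f k w : dominated k w ->
  (forall z, in_disk z -> f z = (z * Cexp (Cint0 k z))%C) -> is_rotation_of f tau ->
  exists c, Cmod c = 1 /\ forall z, in_disk z -> Cint0 k z = logtau (c * z).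
Proof.
intros [Hw [Hk [Hm [H0 HG]]]] Hf [theta Hr].
set (c := Cexp (Ci * RtoC theta)) in *.
assert (Hc : Cmod c = 1) by apply Cmod_Cexp_i.
assert (Hcz : forall z, in_disk z -> in_disk (c * z)%C).
{ intros z Hz; unfold in_disk; now rewrite Cmod_mult, Hc, Rmult_1_l. }
assert (HE : forall z, in_disk z -> z <> 0%C -> Cexp (Cint0 k z) = Cexp (logtau (c * z))).
{ intros z Hz n; pose proof (Hr z Hz) as E; rewrite Hf, tau_eq in E by auto.
  assert (E2 : (z * Cexp (Cint0 k z) = z * Cexp (logtau (c * z)))%C).
  { rewrite E; pose proof (Cexp_neg (Ci * RtoC theta)) as Q; fold c in Q.
    transitivity ((c * Cexp (- (Ci * RtoC theta))) * (z * Cexp (logtau (c * z))))%C; [ring|rewrite Q; ring]. }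
  transitivity (/ z * (z * Cexp (Cint0 k z)))%C; [field; auto|rewrite E2; field; auto]. }
exists c; split; auto; intros z Hz; apply Cint0_rescale; auto.
intros u Hu n.
assert (Du1 : cderiv (fun u => Cexp (Cint0 k u)) u (Cexp (Cint0 k u) * k u)%C).
{ apply (cderiv_comp Cexp); [now apply HG|apply cderiv_Cexp]. }
assert (Du2 : cderiv (fun u => Cexp (logtau (c * u))) u (Cexp (logtau (c * u)) * (arctanq (c * u) * (c * 1)))%C).
{ apply (cderiv_comp Cexp (fun u => logtau (c * u))); [|apply cderiv_Cexp].
  apply (cderiv_comp logtau (fun u => c * u)%C); [apply cderiv_scal, cderiv_id|now apply cderiv_logtau, Hcz]. }
assert (P : 0 < Cmod u) by (now apply Cmod_gt_0).
assert (Du3 : cderiv (fun u => Cexp (Cint0 k u)) u (Cexp (logtau (c * u)) * (arctanq (c * u) * (c * 1)))%C).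
{ apply cderiv_ext_loc with (fun u => Cexp (logtau (c * u))) (Rmin (Cmod u) (1 - Cmod u)); auto.
  - apply Rmin_pos; auto; now apply in_disk_open.
  - intros x Hx; symmetry; apply HE.
    + eapply in_disk_near; [exact Hu|eapply Rlt_le_trans; [exact Hx|apply Rmin_r]].
    + intros ->; pose proof (Rlt_le_trans _ _ _ Hx (Rmin_l _ _)) as Q.
      replace (0 - u)%C with (- u)%C in Q by ring; rewrite Cmod_opp in Q; lra. }
pose proof (cderiv_unique _ _ _ _ Du1 Du3) as E.
rewrite (HE u Hu n) in E.
pose proof (Cexp_neq_0 (logtau (c * u))) as N.
transitivity (/ Cexp (logtau (c * u)) * (Cexp (logtau (c * u)) * k u))%C; [field; auto|].
rewrite E; field; auto.
Qed.

Lemma ccont_Im_continuous (G : C -> C) z : ccont G z ->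
  continuous (T := C_UniformSpace) (U := R_UniformSpace) (fun u => Im (G u)) z.
Proof.
intros H P [eps HP]; destruct (H eps (cond_pos eps)) as [d [D Hd]].
exists (mkposreal (d / 2) ltac:(lra)); intros u [Hu1 Hu2]; apply HP.
change (Rabs (Im (G u) - Im (G z)) < eps); rewrite <- im_minus.
eapply Rle_lt_trans; [apply im_le_Cmod|apply Hd].
change (Rabs (Re u - Re z) < d / 2) in Hu1; change (Rabs (Im u - Im z) < d / 2) in Hu2.
eapply Rle_lt_trans; [apply Cmod_le_Re_Im|]; rewrite re_minus, im_minus; lra.
Qed.

Lemma is_arg_branch_exp (f G : C -> C) : G 0%C = 0%C -> cont_on_disk G ->
  (forall z, in_disk z -> f z = (z * Cexp (G z))%C) ->
  is_arg_branch (quot_id f) (fun z => Im (G z)).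
Proof.
intros G0 HG Hf; split; [now rewrite G0|]; intros z Hz; split.
- now apply ccont_Im_continuous, HG.
- rewrite (quot_id_exp f G) by auto; apply Cexp_polar.
Qed.

Lemma Cmod_Ci_mult (r : R) : 0 <= r -> Cmod (Ci * RtoC r) = r.
Proof. intros; rewrite Cmod_mult, Cmod_Ci, Cmod_R, Rabs_right; lra. Qed.

Lemma Re_conj_Ci z : Re (Cconj Ci * z) = Im z.
Proof. rewrite re_mult; simpl; ring. Qed.

Lemma Re_conj_opp_Ci z : Re (Cconj (- Ci) * z) = - Im z.
Proof. rewrite re_mult; simpl; ring. Qed.

Lemma axis_Ci : axis Ci.
Proof. right; right; now left. Qed.

Lemma axis_opp_Ci : axis (- Ci)%C.
Proof. now right; right; right. Qed.

Lemma Im_logtau_opp_Ci (r : R) : 0 <= r < 1 -> Im (logtau (- Ci * RtoC r)) = - Im (logtau (Ci * RtoC r)).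
Proof.
intros Hr; replace (- Ci * RtoC r)%C with (- (Ci * RtoC r))%C by ring.
rewrite logtau_opp, im_opp; auto; unfold in_disk; rewrite Cmod_Ci_mult; lra.
Qed.

Lemma Im_bound k w z : dominated k w -> in_disk z ->
  Rabs (Im (Cint0 k z)) <= Im (logtau (Ci * RtoC (Cmod z))) /\
  (z <> 0%C -> Rabs (Im (Cint0 k z)) = Im (logtau (Ci * RtoC (Cmod z))) -> Cmod (k 0%C) = 1).
Proof.
intros HD Hz.
destruct (dominated_ray k w Ci z HD axis_Ci Hz) as [A1 A2].
destruct (dominated_ray k w (- Ci)%C z HD axis_opp_Ci Hz) as [B1 B2].
rewrite !Re_conj_Ci in *; rewrite !Re_conj_opp_Ci in *.
rewrite Im_logtau_opp_Ci in * by (split; [apply Cmod_ge_0|exact Hz]).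
split; [apply Rabs_le; lra|]; intros n.
unfold Rabs; destruct (Rcase_abs _); intros E; [apply B2; auto; lra|now apply A2].
Qed.

Lemma circle_max_tau (r : R) : 0 <= r < 1 ->
  is_circle_max (fun z => Im (logtau z)) r (Im (logtau (Ci * RtoC r))).
Proof.
intros Hr; split.
- exists (Ci * RtoC r)%C; split; auto; apply Cmod_Ci_mult; lra.
- intros z Hz; assert (Hzd : in_disk z) by (unfold in_disk; lra).
  destruct (dominated_ray arctanq _ Ci z dominated_arctanq axis_Ci Hzd) as [A _].
  rewrite !Re_conj_Ci, Hz in A; exact A.
Qed.

Lemma circle_max_unique a r M1 M2 : is_circle_max a r M1 -> is_circle_max a r M2 -> M1 = M2.
Proof.
intros [[z1 [A1 B1]] C1] [[z2 [A2 B2]] C2].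
pose proof (C1 z2 A2); pose proof (C2 z1 A1); lra.
Qed.

Lemma Im_logtau_nonneg (r : R) : 0 <= r < 1 -> 0 <= Im (logtau (Ci * RtoC r)).
Proof.
intros Hr; destruct (circle_max_tau r Hr) as [_ H].
specialize (H (- Ci * RtoC r)%C); rewrite Im_logtau_opp_Ci in H by auto.
specialize (H ltac:(rewrite Cmod_mult, Cmod_opp, Cmod_Ci, Cmod_R, Rabs_right; lra)); lra.
Qed.

Lemma growth k w f z : dominated k w -> (forall z, in_disk z -> f z = (z * Cexp (Cint0 k z))%C) ->
  in_disk z ->
  (- tau_re (- Cmod z) <= Cmod (f z) <= tau_re (Cmod z)) /\
  (z <> 0%C -> Cmod (f z) = - tau_re (- Cmod z) \/ Cmod (f z) = tau_re (Cmod z) ->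
   Cmod (k 0%C) = 1).
Proof.
intros HD Hf Hz.
pose proof (Cmod_ge_0 z) as Pz; unfold in_disk in Hz; set (r := Cmod z) in *.
destruct (dominated_ray k w 1%C z HD (or_introl eq_refl) Hz) as [A1 A2].
destruct (dominated_ray k w (-1)%C z HD (or_intror (or_introl eq_refl)) Hz) as [B1 B2].
fold r in A1, A2, B1, B2.
assert (E1 : forall u, Re (Cconj 1 * u) = Re u) by (intros; rewrite re_mult; simpl; ring).
assert (E2 : forall u, Re (Cconj (-1) * u) = - Re u) by (intros; rewrite re_mult; simpl; ring).
rewrite !E1 in *; rewrite !E2 in *.
replace (1 * RtoC r)%C with (RtoC r) in * by ring.
replace (-1 * RtoC r)%C with (RtoC (- r)) in * by (apply C_eq; simpl; ring).
rewrite !tau_re_eq by (rewrite ?Rabs_Ropp, Rabs_right; lra).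
rewrite Hf, Cmod_mult, Cmod_Cexp by auto; fold r.
replace (- (- r * exp (Re (logtau (RtoC (- r)))))) with (r * exp (Re (logtau (RtoC (- r))))) by ring.
assert (Mono : forall a b, a <= b -> exp a <= exp b).
{ intros a b [H| ->]; [left; now apply exp_increasing|lra]. }
pose proof (Mono _ _ A1); assert (M2 : exp (Re (logtau (RtoC (- r)))) <= exp (Re (Cint0 k z))) by (apply Mono; lra).
split; [split; apply Rmult_le_compat_l; lra|].
intros n; assert (Hr : 0 < r) by (unfold r; now apply Cmod_gt_0).
intros [E|E]; apply Rmult_eq_reg_l in E; try lra; apply exp_inv in E; [apply B2; auto; lra|apply A2; auto].
Qed.

(** * The covering radius and the covering theorem *)

Definition lower (r : R) : R := - tau_re (- r).

Lemma lower_eq r : Rabs r < 1 -> lower r = r * exp (Re (logtau (RtoC (- r)))).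
Proof. intros H; unfold lower; rewrite tau_re_eq by (now rewrite Rabs_Ropp); ring. Qed.

Lemma lower_is_derive r : Rabs r < 1 ->
  is_derive (fun r => r * exp (Re (logtau (RtoC (- r))))) r (exp (Re (logtau (RtoC (- r)))) * (1 + Re (Carctan (RtoC (- r))))).
Proof.
intros Hr.
assert (D : is_derive (fun t => Re (logtau (RtoC (- t)))) r (- Re (arctanq (RtoC (- r))))).
{ apply is_derive_ext with (fun t => Re (logtau (RtoC t * (-1)))).
  - intros t; do 2 f_equal; apply C_eq; simpl; ring.
  - replace (- Re (arctanq (RtoC (- r)))) with (Re (arctanq (RtoC (- r)) * (-1))) by (rewrite re_mult; simpl; ring).
    apply (rderiv_Re (fun t => logtau (RtoC t * (-1)))), rderiv_ray.
    replace (RtoC r * -1)%C with (RtoC (- r)) by (apply C_eq; simpl; ring).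
    apply cderiv_logtau, in_disk_real; now rewrite Rabs_Ropp. }
replace (exp (Re (logtau (RtoC (- r)))) * (1 + Re (Carctan (RtoC (- r))))) with
  (1 * exp (Re (logtau (RtoC (- r)))) + r * (- Re (arctanq (RtoC (- r))) * exp (Re (logtau (RtoC (- r)))))).
- apply (is_derive_mult (K := R_AbsRing) (fun r => r) (fun r => exp (Re (logtau (RtoC (- r)))))).
  + apply (is_derive_id (K := R_AbsRing)).
  + apply (is_derive_comp (K := R_AbsRing) (V := R_NormedModule) exp (fun t => Re (logtau (RtoC (- t))))); auto.
    apply is_derive_Reals, derivable_pt_lim_exp.
  + exact Rmult_comm.
- rewrite <- (arctanq_mul (RtoC (- r))), re_scal_l; ring.
Qed.

(** The derivative is positive because 1 + Re arctan > 1 - pi/4 >= 0. *)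
Lemma lower_increasing a b : 0 <= a < b -> b < 1 -> lower a < lower b.
Proof.
intros Hab Hb; rewrite !lower_eq by (rewrite Rabs_right; lra).
destruct (MVT_cor2 (fun r => r * exp (Re (logtau (RtoC (- r)))))
  (fun r => exp (Re (logtau (RtoC (- r)))) * (1 + Re (Carctan (RtoC (- r))))) a b) as [c [E Hc]]; [lra| |].
- intros c Hc; apply is_derive_Reals, lower_is_derive; rewrite Rabs_right; lra.
- assert (S : Rabs (Re (Carctan (RtoC (- c)))) < PI / 4).
  { apply Carctan_strip; rewrite Cmod_R, Rabs_Ropp, Rabs_right; lra. }
  apply Rabs_def2 in S; pose proof PI_4; pose proof (exp_pos (Re (logtau (RtoC (- c))))).
  assert (0 < exp (Re (logtau (RtoC (- c)))) * (1 + Re (Carctan (RtoC (- c))))) by (apply Rmult_lt_0_compat; lra).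
  nra.
Qed.

(** Re H' > 0 makes Re H(-r) <= 0. The bound makes the supremum in [lower_limit] finite. *)
Lemma lower_le_1 r : 0 <= r < 1 -> lower r <= 1.
Proof.
intros Hr; rewrite lower_eq by (rewrite Rabs_right; lra).
assert (A : 0 <= Re (-1 * logtau (RtoC (- r)))).
{ apply logtau_increment_ge; [rewrite Rabs_Ropp, Rabs_right; lra|]; intros y Hy.
  replace (-1 * (arctanq y * RtoC (- r)))%C with (RtoC r * arctanq y)%C by (rewrite RtoC_opp; apply C_eq; simpl; ring).
  rewrite re_scal_l; pose proof (arctanq_re y (in_disk_real y Hy)); nra. }
rewrite re_mult in A; change (Re (-1)) with (-1) in A; change (Im (-1)) with 0 in A.
assert (exp (Re (logtau (RtoC (- r)))) <= 1).
{ rewrite <- exp_0; destruct (Req_dec (Re (logtau (RtoC (- r)))) 0) as [->|]; [lra|left; apply exp_increasing; lra]. }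
pose proof (exp_pos (Re (logtau (RtoC (- r))))); nra.
Qed.

(** [L] is the supremum over 0 < r < 1, and monotonicity makes it the limit. The second clause
    provides the radius that [covering] asks for when |w| < L. *)
Lemma lower_limit : exists L, filterlim lower (at_left 1) (locally L) /\
  forall x, x < L -> exists r, 0 < r < 1 /\ x < lower r.
Proof.
destruct (completeness (fun y => exists r, 0 < r < 1 /\ y = lower r)) as [L [L1 L2]].
- exists 1; intros y [r [Hr ->]]; apply lower_le_1; lra.
- exists (lower (/ 2)), (/ 2); split; auto; lra.
- assert (Ap : forall x, x < L -> exists r, 0 < r < 1 /\ x < lower r).
  { intros x Hx; apply NNPP; intros Hno.
    assert (L <= x); [|lra].
    apply L2; intros y [r [Hr ->]]; apply Rnot_lt_le; intros Hlt; apply Hno; now exists r. }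
  exists L; split; auto.
  apply filterlim_locally; intros eps.
  destruct (Ap (L - eps)) as [r0 [Hr0 Hl]]; [pose proof (cond_pos eps); lra|].
  exists (mkposreal (1 - r0) ltac:(lra)); intros r Hr Hr1.
  change (Rabs (r - 1) < 1 - r0) in Hr; apply Rabs_def2 in Hr.
  change (Rabs (lower r - L) < eps).
  pose proof (lower_increasing r0 r ltac:(lra) Hr1).
  assert (Hr2 : 0 < r < 1) by lra.
  pose proof (L1 (lower r) (ex_intro _ (r : R) (conj Hr2 eq_refl))). 
  pose proof (cond_pos eps); apply Rabs_def1; lra.
Qed.

(* At a boundary minimum of |f - w0|, w0 = f(z)(1 + mu p(z)) with mu >= 0 and
   p = z f'/f of positive real part, so |w0| >= |f(z)|. *)
Lemma covering k w f (rho : R) w0 : dominated k w ->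
  (forall z, in_disk z -> f z = (z * Cexp (Cint0 k z))%C) -> 0 < rho < 1 ->
  Cmod w0 < lower rho -> exists z, in_disk z /\ f z = w0.
Proof.
intros HD Hf Hrho Hw0; pose proof HD as [Hw [Hk [Hm [H0 HG]]]].
set (p := fun z => (1 + Carctan (w z))%C).
assert (Hin : forall z, Cmod z <= rho -> in_disk z) by (intros; unfold in_disk; lra).
assert (Hp : forall z, in_disk z -> 0 < Re (p z)).
{ intros z Hz; unfold p; rewrite re_plus, re_RtoC.
  assert (Q : Rabs (Re (Carctan (w z))) < PI / 4).
  { apply Carctan_strip; eapply Rle_lt_trans; [now apply Hw|exact Hz]. }
  apply Rabs_def2 in Q; pose proof PI_4; lra. }
set (phi := fun z => (f z - w0)%C).
assert (Hd : forall z, in_disk z -> cderiv phi z (Cexp (Cint0 k z) * p z)%C).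
{ intros z Hz; apply cderiv_eq with (Cexp (Cint0 k z) * p z - 0)%C; [ring|].
  apply cderiv_minus; [|apply cderiv_const].
  apply cderiv_ext_loc with (fun u => u * Cexp (Cint0 k u))%C (1 - Cmod z); [now apply in_disk_open| |].
  - intros u Hu; symmetry; apply Hf; eapply in_disk_near; eauto.
  - unfold p; rewrite <- Hm; apply cderiv_id_exp; auto. }
destruct (ball_min_Cmod phi rho ltac:(lra)) as [z [Hz Hmin]].
{ intros z Hz; eapply cderiv_cont, Hd, Hin, Hz. }
exists z; split; auto; apply Ceq_minus.
assert (Hl : (Cexp (Cint0 k z) * p z)%C <> 0%C).
{ apply Cmult_neq_0; [apply Cexp_neq_0|apply C_nz_re; auto]. }
destruct (Rle_lt_or_eq_dec _ _ Hz) as [Hlt|Heq].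
{ apply (interior_min_zero phi z _ rho (Hd z (Hin z Hz)) Hl Hlt Hmin). }
destruct (Ceq_dec (f z - w0) 0) as [|n]; auto; exfalso.
assert (zn : z <> 0%C) by (apply Cmod_gt_0; lra).
destruct (disk_min_condition phi z _ rho 1 Rlt_0_1 (Hd z (Hin z Hz)) zn Hz) as [I1 I2]; [auto|].
set (A := (f z - w0)%C) in *; set (a := (f z * p z)%C).
assert (Ea : (Cconj (phi z) * (Cexp (Cint0 k z) * p z) * z)%C = (Cconj A * a)%C).
{ unfold a; rewrite (Hf z) by auto; change (phi z) with A; ring. }
rewrite Ea in I1, I2.
(* conj(A) a is real and at most 0, so A is the multiple -mu a of [a] with mu = lam/|a|^2 >= 0. *)
set (lam := - Re (Cconj A * a)).
assert (EA : (Cconj A * a)%C = RtoC (- lam)) by (apply C_eq; unfold lam; simpl in *; lra).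
assert (fn : f z <> 0%C) by (rewrite Hf by auto; apply Cmult_neq_0; auto; apply Cexp_neq_0).
assert (an : a <> 0%C) by (apply Cmult_neq_0; auto; apply C_nz_re; auto).
assert (Pa : 0 < Cmod a) by (now apply Cmod_gt_0).
set (mu := lam / Cmod a ^ 2).
assert (Hmu : 0 <= mu) by (apply Rdiv_le_0_compat; [unfold lam; lra|nra]).
assert (E1 : A = (- (RtoC mu * a))%C).
{ assert (Q : (A * (Cconj a * a) = RtoC (- lam) * a)%C).
  { rewrite <- (Cconj_conj A) at 1.
    replace (Cconj (Cconj A) * (Cconj a * a))%C with (Cconj (Cconj A * a) * a)%C by (rewrite Cmult_conj; ring).
    rewrite EA; f_equal; apply C_eq; simpl; ring. }
  rewrite Cconj_mul_self in Q.
  assert (N : RtoC (Cmod a ^ 2) <> 0%C) by (intros E; apply RtoC_inj in E; nra).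
  replace A with ((A * RtoC (Cmod a ^ 2)) / RtoC (Cmod a ^ 2))%C by (field; auto).
  rewrite Q; unfold mu; rewrite RtoC_div by nra; rewrite RtoC_opp; field; auto. }
assert (E2 : w0 = (f z * (1 + RtoC mu * p z))%C).
{ replace w0 with (f z - A)%C by (unfold A; ring); rewrite E1; unfold a; ring. }
assert (G1 : 1 <= Cmod (1 + RtoC mu * p z)).
{ eapply Rle_trans; [|eapply Rle_trans; [apply Rle_abs|apply re_le_Cmod]].
  rewrite re_plus, re_scal_l, re_RtoC; pose proof (Hp z (Hin z Hz)); nra. }
destruct (growth k w f z HD Hf (Hin z Hz)) as [[Gr _] _].
rewrite Heq in Gr; fold (lower rho) in Gr.
rewrite E2, Cmod_mult in Hw0; pose proof (Cmod_ge_0 (f z)); nra.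
Qed.

Theorem theorem2p9 (f : C -> C) (hf : class_Stau f) :
  (* subordination *)
  subordinate (log_deriv_quot f) (log_deriv_quot tau) /\
  subordinate (quot_id f) (quot_id tau) /\
  (* growth *)
  (forall (r : R) (z : C), r < 1 -> Cmod z = r ->
     - tau_re (- r) <= Cmod (f z) <= tau_re r) /\
  (* covering *)
  (exists L : R,
     filterlim (fun r : R => - tau_re (- r)) (at_left 1) (locally L) /\
     (is_rotation_of f tau \/
      forall w : C, Cmod w < L -> exists z : C, in_disk z /\ f z = w)) /\
  (* rotation *)
  (exists argf argtau : C -> R,
     is_arg_branch (quot_id f) argf /\
     is_arg_branch (quot_id tau) argtau /\
     (forall (r : R) (z : C), r < 1 -> Cmod z = r ->
        exists M : R, is_circle_max argtau r M /\ Rabs (argf z) <= M) /\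
     ((exists z : C, in_disk z /\ z <> RtoC 0 /\
         is_circle_max argtau (Cmod z) (Rabs (argf z))) <->
      is_rotation_of f tau)) /\
  (* equality in the two growth bounds *)
  ((exists z : C, in_disk z /\ z <> RtoC 0 /\
      Cmod (f z) = - tau_re (- Cmod z)) <->
   is_rotation_of f tau) /\
  ((exists z : C, in_disk z /\ z <> RtoC 0 /\
      Cmod (f z) = tau_re (Cmod z)) <->
   is_rotation_of f tau).
Proof.
destruct (Stau_dominated f hf) as [k [w [HD Hf]]].
pose proof HD as [Hw [Hk [Hm [H0 HG]]]].
destruct (schwarz_lift k w HD) as [v Hv].
assert (Htau : forall z, in_disk z -> tau z = (z * Cexp (logtau z))%C) by (intros; apply tau_eq).
assert (Rot : Cmod (k 0%C) = 1 -> is_rotation_of f tau).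
{ intros K1; apply (rotation_of_rescale f (Cint0 k) (k 0%C) K1 Hf); intros z Hz.
  rewrite <- (schwarz_lift_rigid k w v HD K1 Hv z Hz); symmetry; apply Hv, Hz. }
(* The witness z = conj c * y turns G(z) = H(c z) into H(y). *)
assert (Tor : forall y, in_disk y -> y <> 0%C -> is_rotation_of f tau ->
   exists z, in_disk z /\ z <> 0%C /\ Cmod z = Cmod y /\ Cint0 k z = logtau y).
{ intros y Hy n HR; destruct (rescale_of_rotation f k w HD Hf HR) as [c [Hc HE]].
  assert (Hz : Cmod (Cconj c * y) = Cmod y) by (rewrite Cmod_mult, Cmod_conj, Hc; ring).
  assert (Hzd : in_disk (Cconj c * y)%C) by (unfold in_disk; rewrite Hz; exact Hy).
  exists (Cconj c * y)%C; repeat split; auto.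
  - apply Cmod_gt_0; rewrite Hz; now apply Cmod_gt_0.
  - rewrite HE by auto; f_equal.
    replace (c * (Cconj c * y))%C with ((Cconj c * c) * y)%C by ring.
    rewrite Cconj_mul_self, Hc; replace (1 ^ 2) with 1 by ring; ring. }
split; [|split; [|split; [|split; [|split; [|split]]]]].
(* On the disk z tau'/tau = 1 + arctan z, so the Schwarz function from the definition of the class
   serves here. *)
- destruct hf as [_ [u [U1 [U2 [U3 [U4 U5]]]]]]; exists u; repeat split; auto.
  intros z Hz; rewrite log_deriv_quot_tau by auto; auto.
- exists v; repeat split.
  + intros z Hz; eexists; apply cderiv_iff, Hv, Hz.
  + apply Cmod_eq_0; pose proof (Cmod_ge_0 (v 0%C)).
    destruct (Hv 0%C in_disk_0) as [_ [Q _]]; rewrite Cmod_0 in Q; lra.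
  + intros z Hz; apply Hv, Hz.
  + intros z Hz; apply Hv, Hz.
  + intros z Hz; destruct (Hv z Hz) as [V1 [_ [V2 _]]].
    rewrite (quot_id_exp f (Cint0 k)), (quot_id_exp tau logtau); auto using Cint0_0, logtau_0.
    now rewrite V2.
- intros r z Hr <-; now apply (growth k w f z).
(* The disk of radius [L] is covered for every [f] in the class, rotations included, so the second
   alternative is proved. *)
- destruct lower_limit as [L [L1 L2]]; exists L; split; [exact L1|right].
  intros w0 Hw0; destruct (L2 _ Hw0) as [rho [Hrho Hlt]].
  now apply (covering k w f rho w0).
- exists (fun z => Im (Cint0 k z)), (fun z => Im (logtau z)); repeat split.
  + now rewrite Cint0_0.
  + apply (is_arg_branch_exp f (Cint0 k)); auto using Cint0_0, Cint0_cont.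
  + apply (is_arg_branch_exp f (Cint0 k)); auto using Cint0_0, Cint0_cont.
  + now rewrite logtau_0.
  + apply (is_arg_branch_exp tau logtau); auto using logtau_0, logtau_cont.
  + apply (is_arg_branch_exp tau logtau); auto using logtau_0, logtau_cont.
  + intros r z Hr <-; exists (Im (logtau (Ci * RtoC (Cmod z)))); split.
    * apply circle_max_tau; split; [apply Cmod_ge_0|auto].
    * now apply (Im_bound k w z).
  + intros [z [Hz [n Hmx]]]; apply Rot, (Im_bound k w z HD Hz); auto.
    eapply circle_max_unique; [exact Hmx|apply circle_max_tau; split; [apply Cmod_ge_0|exact Hz]].
  + intros HR.
    (* On |y| = 1/2 the maximum of Im H is at i/2; any radius strictly between 0 and 1 would do. The
       growth bounds below use -1/2 and 1/2 in the same way. *)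
    assert (Ey : Cmod (Ci * RtoC (/ 2)) = / 2) by (apply Cmod_Ci_mult; lra).
    destruct (Tor (Ci * RtoC (/ 2))%C) as [z [Hz [n [Ez EG]]]]; auto.
    * unfold in_disk; lra.
    * apply Cmod_gt_0; lra.
    * exists z; repeat split; auto; rewrite EG, Ez, Ey, Rabs_right;
      try (apply circle_max_tau; lra); apply Rle_ge, Im_logtau_nonneg; lra.
- split.
  + intros [z [Hz [n E]]]; apply Rot, (growth k w f z); auto.
  + intros HR; assert (Hy : Rabs (- / 2) < 1) by (rewrite Rabs_left; lra).
    destruct (Tor (RtoC (- / 2))) as [z [Hz [n [Ez EG]]]]; auto.
    * now apply in_disk_real.
    * intros E; apply RtoC_inj in E; lra.
    * exists z; repeat split; auto.
      rewrite Hf, Cmod_mult, Cmod_Cexp, EG, Ez, Cmod_R, Rabs_left by (auto; lra).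
      replace (- - / 2) with (/ 2) by ring; rewrite tau_re_eq by auto; ring.
- split.
  + intros [z [Hz [n E]]]; apply Rot, (growth k w f z); auto.
  + intros HR; assert (Hy : Rabs (/ 2) < 1) by (rewrite Rabs_right; lra).
    destruct (Tor (RtoC (/ 2))) as [z [Hz [n [Ez EG]]]]; auto.
    * now apply in_disk_real.
    * intros E; apply RtoC_inj in E; lra.
    * exists z; repeat split; auto.
      rewrite Hf, Cmod_mult, Cmod_Cexp, EG, Ez, Cmod_R, Rabs_right by (auto; lra).
      rewrite tau_re_eq by auto; ring.
Qed.
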